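(* Let $A_1,\dots,A_c$ be simple undirected graphs on a common finite vertex set $V$ such that the sum graph $H=A_1+\cdots+A_c$ is connected and each $\underline{A}_j$ is nonempty and connected. Then for every integer $N\ge1$ there is an additive $N$-lift $G$ of $H$ such that every new eigenvalue $\lambda\in\operatorname{spec}(G)\setminus\operatorname{spec}(H)$ (multiset difference) satisfies $\lambda\le\rho(A_1\boxplus\cdots\boxplus A_c)$.
   Context: For a finite graph, $\operatorname{spec}$ is the multiset of eigenvalues of its adjacency matrix. The sum graph $A_1+\cdots+A_c$ is the multigraph whose adjacency matrix is the sum of the adjacency matrices of the $A_j$ (the ''atoms''). $\underline{A}_j$ denotes $A_j$ with isolated vertices removed. Additive $N$-lift: given $\mathcal{Q}=(Q_1,\dots,Q_c)$ with $Q_i:V\to\mathfrak{S}_N$ arbitrary functions to the symmetric group on $[N]$, the additive $N$-lift of $H$ by $\mathcal Q$ is the multigraph $H^{\mathcal Q}=A_1^{Q_1}+\cdots+A_c^{Q_c}$ on vertex set $V\times[N]$, where $A_i^{Q_i}$ has an edge between $(u,a)$ and $(v,b)$ exactly when $\{u,v\}$ is an edge of $A_i$ and $Q_i(v)b=Q_i(u)a$. It is well known that $\operatorname{spec}(H)\subseteq\operatorname{spec}(H^{\mathcal Q})$ as multisets; the remaining $|V|(N-1)$ eigenvalues are the ''new'' ones. Spectral radius of a connected bounded-degree graph $X$: $\rho(X)=\limsup_{t\to\infty}(c_{uv}^{(t)})^{1/t}$, where $c_{uv}^{(t)}$ is the number of walks of length $t$ from $u$ to $v$ (independent of $u,v$).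 Additive product: fix $v_1\in V$. The graph $A_1\boxplus\cdots\boxplus A_c$ has as vertex set $\mathcal V$ the strings $v_1C_1v_2C_2\cdots v_kC_kv_{k+1}$, $k\ge0$, with $v_i\in V$, $C_i\in[c]$, $C_i\ne C_{i+1}$ for $i<k$, and $v_i\neq v_{i+1}$ both vertices of $\underline{A}_{C_i}$ for $i\le k$; its edges are all pairs of elements of $\mathcal V$ of the following forms ($s$ a string in $\mathcal V$): $\{sCu,sCv\}$ with $\{u,v\}$ an edge of $\underline{A}_C$; $\{sCu,sCuC'v\}$ with $\{u,v\}$ an edge of $\underline{A}_{C'}$; and $\{v_1,v_1Cv\}$ with $\{v_1,v\}$ an edge of $\underline{A}_C$. Up to isomorphism it does not depend on $v_1$. *)

(* Defs.v *)
From HB Require Import structures.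
From mathcomp Require Import all_boot all_order all_algebra all_fingroup.
From mathcomp Require Import finmap multiset.
From mathcomp Require Import all_classical all_reals all_analysis.

Set Implicit Arguments.
Unset Strict Implicit.
Unset Printing Implicit Defensive.

Import Order.TTheory GRing.Theory Num.Theory.

Local Open Scope nat_scope.

(* A multigraph on T is given by its edge multiplicities T -> T -> nat, a simple
   graph by a symmetric irreflexive relation on T. *)
Definition sum_graph (T : finType) (c : nat) (B : 'I_c -> rel T) : T -> T -> nat :=
  fun u v => \sum_(i < c) B i u v.

Definition connected_graph (T : finType) (e : rel T) : Prop :=
  0 < #|T| /\ forall u v : T, connect e u v.

Definition connected_multigraph (T : finType) (G : T -> T -> nat) : Prop :=
  connected_graph (fun u v => 0 < G u v).

Definition nonisolated (V : finType) (A : rel V) : {set V} :=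
  [set u | [exists v, A u v]].

(* The graph A with its isolated vertices removed. *)
Definition core (V : finType) (A : rel V) : rel {u : V | u \in nonisolated A} :=
  fun u v => A (val u) (val v).
Arguments core {V} A.

Definition adj_mx (R : realType) (T : finType) (G : T -> T -> nat) : 'M[R]_#|T| :=
  (\matrix_(i, j) (G (enum_val i) (enum_val j))%:R)%R.

(* Eigenvalues with algebraic multiplicity. No eigenvalue is lost by working over
   the reals, since adjacency matrices of undirected multigraphs are symmetric. *)
Definition spec (R : realType) (T : finType) (G : T -> T -> nat) : {mset R}%mset :=
  let p := char_poly (adj_mx R G) in
  [fsfun x in fset_set [set x | root p x]%classic => mup x p].

Lemma specE (R : realType) (T : finType) (G : T -> T -> nat) (x : R) :
  spec R G x = mup x (char_poly (adj_mx R G)).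
Proof.
rewrite /spec fsfunE; set p := char_poly _.
have p0 : (p != 0)%R by rewrite monic_neq0 ?char_poly_monic.
have fin : finite_set [set x | root p x]%classic.
  apply: contrapT => /(infinite_set_fset (size p))[X XR sX].
  have /(max_poly_roots p0) : all (root p) X by apply/allP => y /XR.
  by move=> /(_ (fset_uniq X)); rewrite ltnNge sX.
rewrite in_fset_set//; case: ifPn => //; rewrite mem_setE => nr.
by rewrite mupNroot.
Qed.

Definition lift_atom (V : finType) (N : nat) (A : rel V) (Q : V -> 'S_N) :
    rel (V * 'I_N) :=
  fun x y => A x.1 y.1 && (Q y.1 y.2 == Q x.1 x.2).

Definition additive_lift (V : finType) (c N : nat) (A : 'I_c -> rel V)
    (Q : 'I_c -> V -> 'S_N) : V * 'I_N -> V * 'I_N -> nat :=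
  sum_graph (fun i => lift_atom (A i) (Q i)).

(* The string v1 C1 v2 C2 ... vk Ck v(k+1) is encoded as the list
   [:: (C1, v2); ...; (Ck, v(k+1))], the first letter v1 being fixed. In
   addprod_word A o u s, u is the letter before s and o the index before u, if
   any. *)
Fixpoint addprod_word (V : finType) (c : nat) (A : 'I_c -> rel V)
    (o : option 'I_c) (u : V) (s : seq ('I_c * V)) : bool :=
  if s is (C, v) :: s' then
    [&& o != Some C, u != v, u \in nonisolated (A C), v \in nonisolated (A C)
      & addprod_word A (Some C) v s']
  else true.

Definition addprod (V : finType) (c : nat) (A : 'I_c -> rel V) (v1 : V) :
    choiceType :=
  {s : seq ('I_c * V) | addprod_word A None v1 s}.

Inductive addprod_arc (V : finType) (c : nat) (A : 'I_c -> rel V) (v1 : V) :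
    seq ('I_c * V) -> seq ('I_c * V) -> Prop :=
| addprod_same s C u v :
    A C u v -> addprod_arc A v1 (rcons s (C, u)) (rcons s (C, v))
| addprod_next s C u C' v :
    A C' u v ->
    addprod_arc A v1 (rcons s (C, u)) (rcons (rcons s (C, u)) (C', v))
| addprod_root C v : A C v1 v -> addprod_arc A v1 [::] [:: (C, v)].

Definition addprod_edge (V : finType) (c : nat) (A : 'I_c -> rel V) (v1 : V)
    (x y : addprod A v1) : Prop :=
  addprod_arc A v1 (val x) (val y) \/ addprod_arc A v1 (val y) (val x).

Definition walks (X : choiceType) (E : X -> X -> Prop) (u v : X) (t : nat) :
    set (seq X) :=
  [set p | [/\ size p = t, path (fun x y => `[< E x y >]) u p & last u p = v]]%classic.

Lemma finite_walks (X : choiceType) (E : X -> X -> Prop) (u v : X) (t : nat) :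
  (forall x, finite_set [set y | E x y]) -> finite_set (walks E u v t).
Proof.
move=> finE; elim: t u => [|t IHt] u.
  by apply: (@sub_finite_set _ _ [set [::]]%classic) => // p [/size0nil->].
apply: (@sub_finite_set _ _ (\bigcup_(w in [set y | E u y]) (cons w @` walks E w v t))%classic).
  move=> [|w p] [//= [sp] /andP[/asboolP Euw Ep] lp].
  by exists w => //; exists p.
by apply: bigcup_finite => // w _; apply: finite_image; apply: IHt.
Qed.

Lemma finite_addprod_edge (V : finType) (c : nat) (A : 'I_c -> rel V) (v1 : V)
  (x : addprod A v1) : finite_set [set y | addprod_edge x y].
Proof.
pose short : set (seq ('I_c * V)) := [set s | size s <= (size (val x)).+1]%classic.
have fshort : finite_set short.
  apply: (@sub_finite_set _ _ (range (fun w : {n : 'I_(size (val x)).+2 &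
    n.-tuple ('I_c * V)} => val (tagged w)))).
    move=> s /= sz.
    by exists (Tagged (fun n : 'I_(size (val x)).+2 => n.-tuple ('I_c * V))
      (in_tuple s : (Ordinal (sz : size s < (size (val x)).+2)).-tuple _)).
  by apply: finite_image; apply: finite_finset.
apply: (@sub_finite_set _ _ (val @^-1` short)%classic).
  have arc_size s s' : addprod_arc A v1 s s' -> size s <= size s' <= (size s).+1.
    by case=> *; rewrite /= ?size_rcons ?leqnn ?leqnSn.
  move=> y [] /arc_size /andP[sxy syx]; rewrite /short //=.
  exact: leq_trans sxy (leqnSn _).
by apply: finite_preimage => // ? ? _ _; apply: val_inj.
Qed.

Definition nb_walks (X : choiceType) (E : X -> X -> Prop) (u v : X) (t : nat) : nat :=
  #|` fset_set (walks E u v t)|%fset.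

Definition spectral_radius (R : realType) (X : choiceType) (E : X -> X -> Prop)
    (u v : X) : \bar R :=
  limn_esup (fun t : nat => (((nb_walks E u v t)%:R : R) `^ (t%:R)^-1)%R%:E).

(* Main.v *)
Require Import Defs.
From HB Require Import structures.
From mathcomp Require Import all_boot all_order all_algebra all_fingroup.
From mathcomp Require Import finmap multiset.
From mathcomp Require Import all_classical all_reals all_analysis.
From mathcomp Require Import complex polyrcf ring lra.
(* Last, so that [setT], [set0] and [inE] refer to finite sets. *)
From mathcomp Require Import finset.

(** Take [N] copies of every atom. A site is a pair of an atom [j] and a vertex [v]; a permutation
of the [N] copies at each site, followed by the identification of the points which
the different atoms have in common, produces an additive lift, and every lift arises in this way.
The part of the spectrum that is new belongs to the functions of sum zero on each fibre, and
is the spectrum of a compression [newpart *m X *m newpart^T] of the permuted adjacency matrix [X]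
of the copies ([char_poly_lift]). It remains to find permutations for which the characteristic
polynomial of this compression is positive to the right of the spectral radius. Three ideas
lead there.

Interlacing. The map from [X] to this polynomial is [hyperbolic]: all roots are real, and they
move to the right under positive perturbations of rank one. Exchanging two indices of [X] adds one
square of a vector and removes another, so the polynomials before and after the exchange have a
common interlacing, and averaging over a random exchange is again hyperbolic
([hyperbolic_swap]). A uniform permutation is a product of random exchanges. Hence, whenever
the average over all lifts is positive from some point on, so is the polynomial of one
of the lifts ([averageable_fixing]).

From permutations to signs. The permutations of [N] copies act on the vectors of sum zero,
a space of dimension [d = N - 1], and the average polynomial only depends on this action.
As a function of a reflecting vector, the determinant of a conjugated matrix is a quartic form
divided by the fourth power of the norm. If an average of determinants is
invariant under the reflections in two vectors which are neither parallel nor orthogonal, its quartic form is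
invariant under a rotation of their plane, hence constant on the circle, and the
average is invariant under all reflections of the plane. Consequently the average over the symmetric
group is invariant under the signed permutations of [d] coordinates, and conversely, so the two
averages coincide ([std_avg_eq_signed_avg]): the average over [N]-lifts is a positive multiple of a
sum, over [d]-lifts, of averages over independent signs for each atom and vertex.

Averages over signs. Expand the determinant of [x] minus a signed adjacency matrix along rows. Only
paths which close up within a single atom survive the average over the signs, so that
averaged minors obey a recursion along paths in the atoms ([alphaU], [kappa_rec]).
This is the recursion that counts walks on the additive product, whose copies of the atoms meet in a
treelike fashion, except that the paths must be simple. If [f] is a
positive function on the additive product and [x' * f] dominates the sum of [f] over the neighbours,
for some [x' < x], induction shows that all the averaged minors are positive
([alpha_gt0]). For [x'] larger than the spectral radius the Green function [green] is such an [f].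

Finally suppose that each lift has a new eigenvalue larger than the spectral radius, and consider a
lift for which the chosen eigenvalue is the smallest possible, [lam]. From [lam] on the
average is positive, so the new eigenvalues of some lift are all smaller than [lam], the
one chosen for it included, against the minimality of [lam]. *)

Set Implicit Arguments.
Unset Strict Implicit.
Unset Printing Implicit Defensive.

Import Order.TTheory GRing.Theory Num.Theory.
Import numFieldNormedType.Exports.

Local Open Scope ring_scope.

(** * Pencils of real-rooted polynomials *)

Section RealRooted.
Import ComplexField.Normc.
Variable R : rcfType.
Implicit Types (p q f : {poly R}) (z : R[i]).

Definition evalC p z : R[i] := (map_poly (real_complex R) p).[z].

(** For a polynomial with real coefficients the non-real roots come in conjugate pairs,
so it is enough to exclude one of the two half-planes. *)
Definition real_rooted p : Prop := forall z, 0 < complex.Im z -> evalC p z != 0.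

Lemma evalCD p q z : evalC (p + q) z = evalC p z + evalC q z.
Proof. by rewrite /evalC rmorphD hornerD. Qed.
Lemma evalCB p q z : evalC (p - q) z = evalC p z - evalC q z.
Proof. by rewrite /evalC rmorphB hornerD hornerN. Qed.
Lemma evalCZ a p z : evalC (a *: p) z = real_complex R a * evalC p z.
Proof. by rewrite /evalC map_polyZ hornerZ. Qed.
Lemma evalC_real p (x : R) : evalC p (real_complex R x) = real_complex R p.[x].
Proof. by rewrite /evalC horner_map. Qed.

Lemma real_rooted_factor p : p \is monic -> real_rooted p ->
  exists rs : seq R, p = \prod_(r <- rs) ('X - r%:P).
Proof.
move=> pm pr; set pC := map_poly (real_complex R) p.
have [zs zsE] := closed_field_poly_normal pC.
have pCm : lead_coef pC = 1 by rewrite lead_coef_map (eqP pm).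
rewrite pCm scale1r in zsE.
have zs_real : forall z, z \in zs -> z = real_complex R (complex.Re z).
  move=> z zin; have rz : root pC z by rewrite zsE root_prod_XsubC.
  suff : complex.Im z = 0 by case: (z) => a b /= ->.
  apply/eqP; rewrite eq_le; apply/andP; split.
    by rewrite leNgt; apply/negP => /pr /negP; apply; rewrite /evalC -/pC.
  rewrite leNgt; apply/negP => zn.
  have rz' : root pC (conjc z).
    rewrite -complex_root_conj /pC -map_poly_comp.
    by rewrite (@eq_map_poly _ _ _ (real_complex R)) // => x /=; rewrite oppr0.
  have /negP[] : evalC p (conjc z) != 0.
    by apply: pr; case: (z) zn => a b /=; rewrite oppr_gt0.
  exact: rz'.
exists (map (@complex.Re R) zs).
apply: (map_poly_inj (real_complex R)); rewrite -/pC zsE rmorph_prod big_map.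
rewrite big_seq [RHS]big_seq; apply: eq_bigr => z zin.
by rewrite rmorphB /= map_polyX map_polyC /= -zs_real.
Qed.

Lemma evalC_prod_XsubC (rs : seq R) z :
  evalC (\prod_(r <- rs) ('X - r%:P)) z = \prod_(r <- rs) (z - real_complex R r).
Proof.
rewrite /evalC rmorph_prod horner_prod; apply: eq_bigr => r _.
by rewrite rmorphB /= map_polyX map_polyC /= hornerXsubC.
Qed.

Lemma normc_prod (I : Type) (rs : seq I) (F : I -> R[i]) :
  ComplexField.Normc.normc (\prod_(r <- rs) F r) = \prod_(r <- rs) ComplexField.Normc.normc (F r).
Proof.
apply: (big_morph _ (@ComplexField.Normc.normcM R)); exact: ComplexField.Normc.normc1.
Qed.

Lemma normc_ge_Im z : `|complex.Im z| <= ComplexField.Normc.normc z.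
Proof.
case: z => a b /=; rewrite -sqrtr_sqr; apply: ler_wsqrtr.
by rewrite lerDr sqr_ge0.
Qed.

Lemma Im_subr z (r : R) : complex.Im (z - real_complex R r) = complex.Im z.
Proof. by case: z => a b /=; rewrite subr0. Qed.

Lemma prodr_const_seq (I : Type) (rs : seq I) (b : R) :
  \prod_(r <- rs) b = b ^+ size rs.
Proof. by rewrite big_const_seq count_predT iter_mulr_1. Qed.

Lemma normc_ge0 z : 0 <= ComplexField.Normc.normc z.
Proof. by case: z => a b /=; rewrite sqrtr_ge0. Qed.

Lemma evalC_eq0 q : (forall z, evalC q z = 0) -> q = 0.
Proof.
move=> q0; apply/eqP; apply: contraT => qn0.
have : (size [seq i%:R : R | i <- iota 0 (size q)] < size q)%N.
  apply: max_poly_roots => //.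
    apply/allP => x _; rewrite /root; apply/eqP; apply: (@complexI R).
    by rewrite -evalC_real q0.
  rewrite map_inj_uniq ?iota_uniq // => i j /eqP.
  by rewrite eqr_nat => /eqP.
by rewrite size_map size_iota ltnn.
Qed.

Lemma monic_subZ n f q s : f \is monic -> size f = n.+1 -> (size q <= n)%N ->
  (f - s *: q \is monic) /\ size (f - s *: q) = n.+1.
Proof.
move=> fm sf sq.
have lt : (size (- (s *: q)) < size f)%N.
  by rewrite size_polyN sf ltnS (leq_trans (size_scale_leq _ _)).
by split; [rewrite monicE lead_coefDl // -monicE | rewrite size_polyDl].
Qed.

Lemma size_monic_sub n f g : f \is monic -> size f = n.+1 ->
  g \is monic -> size g = n.+1 -> (size (g - f)%R <= n)%N.
Proof.
move=> fm sf gm sg; apply/leq_sizeP => j; rewrite leq_eqVlt coefB.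
case/orP=> [/eqP <-|nj]; last by rewrite !nth_default ?subrr // ?sf ?sg.
have := monicP fm; have := monicP gm; rewrite !lead_coefE sf sg /= => -> ->.
by rewrite subrr.
Qed.

Lemma convex_monic n (p : R) (f g : {poly R}) :
  f \is monic -> size f = n.+1 -> g \is monic -> size g = n.+1 ->
  ((1 - p) *: g + p *: f \is monic) /\ size ((1 - p) *: g + p *: f) = n.+1.
Proof.
move=> fm sf gm sg.
have -> : (1 - p) *: g + p *: f = g - p *: (g - f).
  by rewrite scalerBl scale1r scalerBr opprB addrA addrAC.
by apply: monic_subZ => //; apply: size_monic_sub.
Qed.

(** If [q] vanished at [z1], all [f - s *: q] would take the value of [f] at [z1]. As their roots
are real, all at distance at least [Im z1] from [z1], the product of the distances being fixed would
bound each of them. The roots would be bounded uniformly in [s], hence so would be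
the value of [f - s *: q] at any point [z2], which forces [q] to vanish at [z2]. *)
Lemma pencil_neq0 n f q : f \is monic -> size f = n.+1 -> (size q <= n)%N ->
  (forall s : R, real_rooted (f - s *: q)) -> q != 0 ->
  forall z, 0 < complex.Im z -> evalC q z != 0.
Proof.
move=> fm sf sq rr qn0 z1 z1p; apply/eqP => q1.
set eta := complex.Im z1 in z1p.
have n_gt0 : (0 < n)%N.
  by apply: leq_trans sq; rewrite lt0n size_poly_eq0.
(* [B] bounds the distance from [z1] to a root, all other distances being at least [eta]. *)
pose B := normc (evalC f z1) / eta ^+ n.-1.
have eta_le r : eta <= normc (z1 - real_complex R r).
  by apply: le_trans (normc_ge_Im _); rewrite Im_subr ler_norm.
suff : q = 0 by move=> q0; rewrite q0 eqxx in qn0.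
apply: evalC_eq0 => z2; apply: eq0_normc; apply/eqP; apply: contraT => q2.
have q2p : 0 < normc (evalC q z2) by rewrite lt_neqAle eq_sym q2 normc_ge0.
pose M := (normc (z2 - z1) + B) ^+ n.
have bound s : normc (evalC (f - s *: q) z2) <= M.
  have [fsm fss] := monic_subZ s fm sf sq.
  have [rs rsE] := real_rooted_factor fsm (rr s).
  have srs : size rs = n.
    by move: fss; rewrite rsE size_prod_XsubC => -[].
  have f1 : normc (evalC f z1) = \prod_(r <- rs) normc (z1 - real_complex R r).
    by rewrite -normc_prod -evalC_prod_XsubC -rsE evalCB evalCZ q1 mulr0 subr0.
  rewrite rsE evalC_prod_XsubC normc_prod /M -srs -prodr_const_seq.
  rewrite big_seq [X in _ <= X]big_seq; apply: ler_prod => r rin.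
  rewrite normc_ge0 /=.
  have -> : z2 - real_complex R r = (z2 - z1) + (z1 - real_complex R r) by ring.
  apply: le_trans (le_normcD _ _) _; rewrite lerD2l /B f1 ler_pdivlMr ?exprn_gt0 //.
  rewrite (big_rem r) //= ler_wpM2l ?normc_ge0 //.
  have -> : n.-1 = size (rem r rs) by rewrite size_rem // srs.
  rewrite -prodr_const_seq; apply: ler_prod => r' _.
  by rewrite eta_le ltW.
(* For this [s] the value at [z2] has modulus at least [M + 1]. *)
pose s := (M + normc (evalC f z2) + 1) / normc (evalC q z2).
have M0 : 0 <= M by rewrite exprn_ge0 // addr_ge0 ?normc_ge0 // divr_ge0 ?normc_ge0 // exprn_ge0 // ltW.
have s0 : 0 <= s by rewrite divr_ge0 ?addr_ge0 ?normc_ge0.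
have : normc (real_complex R s * evalC q z2) <= M + normc (evalC f z2).
  have -> : real_complex R s * evalC q z2 = - evalC (f - s *: q) z2 + evalC f z2.
    by rewrite evalCB evalCZ; ring.
  by apply: le_trans (le_normcD _ _) _; rewrite lerD2r normcN.
have -> : normc (real_complex R s * evalC q z2) = M + normc (evalC f z2) + 1.
  rewrite normcM (_ : normc (real_complex R s) = s); last first.
    by rewrite /= expr0n addr0 sqrtr_sqr ger0_norm.
  by rewrite /s divfK // gt_eqF.
by rewrite gerDl ler10.
Qed.

(** Where [f * conj q] is real, [f / q] is a real number [s], and the point is a root of
[f - s *: q]. *)
Lemma Im_mul_conj_neq0 n f q : f \is monic -> size f = n.+1 -> (size q <= n)%N ->
  (forall s : R, real_rooted (f - s *: q)) -> q != 0 ->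
  forall z, 0 < complex.Im z -> complex.Im (evalC f z * conjc (evalC q z)) != 0.
Proof.
move=> fm sf sq rr qn0 z zp; apply/negP => /eqP Im0.
have qz := pencil_neq0 fm sf sq rr qn0 zp.
pose w := evalC f z / evalC q z.
have wreal : complex.Im w = 0.
  rewrite /w; move: (evalC f z) (evalC q z) Im0 => [a b] [c d] /=.
  move=> h; have -> : a * - (d / (c ^+ 2 + d ^+ 2)) + b * (c / (c ^+ 2 + d ^+ 2))
     = (a * - d + b * c) / (c ^+ 2 + d ^+ 2) by ring.
  by rewrite h mul0r.
have /negP[] := rr (complex.Re w) z zp.
rewrite evalCB evalCZ (_ : real_complex R (complex.Re w) = w); last first.
  by move: wreal; case: (w) => a b /= ->.
by rewrite /w divfK // subrr.
Qed.

Definition Im_poly (P : {poly R[i]}) : {poly R} := \poly_(k < size P) complex.Im P`_k.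

Lemma Im_polyE P (y : R) : (Im_poly P).[y] = complex.Im P.[real_complex R y].
Proof.
rewrite horner_poly horner_coef.
rewrite (big_morph (@complex.Im R) (id1 := 0) (op1 := +%R)); last 2 first.
- by move=> [a b] [c d].
- by [].
apply: eq_bigr => k _; rewrite -rmorphXn /=.
by case: (P`_k) => a b /=; rewrite mulr0 add0r.
Qed.

(** One half of the Hermite-Kakeya-Obreschkoff theorem: for a real-rooted pencil, [f / q] maps the
upper half-plane to itself. The imaginary part has no zero there, so its sign can be
computed far up on the vertical line through [z], from a leading coefficient. *)
Lemma Im_mul_conj_gt0 n f q : f \is monic -> size f = n.+1 -> (size q <= n)%N ->
  (forall s : R, real_rooted (f - s *: q)) -> 0 < q`_n.-1 ->
  forall z, 0 < complex.Im z -> 0 < complex.Im (evalC f z * conjc (evalC q z)).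
Proof.
move=> fm sf sq rr qpos z zp.
have qn0 : q != 0 by apply/eqP => q0; rewrite q0 coef0 ltxx in qpos.
have n_gt0 : (0 < n)%N by apply: leq_trans sq; rewrite lt0n size_poly_eq0.
have sq' : size q = n.
  apply/eqP; rewrite eqn_leq sq leqNgt /=; apply/negP => h.
  by move: qpos; rewrite nth_default ?ltxx // -ltnS prednK.
pose x := complex.Re z; pose eta := complex.Im z.
(* [L] runs through the vertical line: its value at [y] is [x + i y]. *)
pose L : {poly R[i]} := Complex 0 1 *: 'X + (real_complex R x)%:P.
have i0 : (Complex 0 1 : R[i]) != 0 by rewrite eq_complex /= oner_eq0 andbF.
have sL : size L = 2.
  rewrite /L size_polyDl size_scale ?size_polyX //.
  by rewrite (leq_ltn_trans (size_polyC_leq1 _)).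
have lL : lead_coef L = Complex 0 1.
  rewrite /L lead_coefDl ?lead_coefZ ?lead_coefX ?mulr1 //.
  by rewrite size_scale // size_polyX (leq_ltn_trans (size_polyC_leq1 _)).
pose F := map_poly (real_complex R) f \Po L.
pose G := map_poly (@conjc R) (map_poly (real_complex R) q \Po L).
have ev y : (Im_poly (F * G)).[y] =
    complex.Im (evalC f (Complex x y) * conjc (evalC q (Complex x y))).
  rewrite Im_polyE hornerM /F /G horner_comp.
  have Ly : L.[real_complex R y] = Complex x y.
    rewrite /L hornerD hornerZ hornerX hornerC /=.
    by apply/eqP; rewrite eq_complex /= ?mul0r ?mul1r ?mulr0 ?subr0 ?oppr0 ?addr0 ?add0r !eqxx.
  rewrite Ly -/(evalC f _); congr (complex.Im (_ * _)).
  have -> : real_complex R y = conjc (real_complex R y) by rewrite /= oppr0.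
  by rewrite horner_map /= horner_comp Ly.
have lF : lead_coef F = Complex 0 1 ^+ n.
  by rewrite /F lead_coef_comp ?sL // lL lead_coef_map (eqP fm) rmorph1 mul1r size_map_poly sf.
have lG : lead_coef G = real_complex R (q`_n.-1) * Complex 0 (-1) ^+ n.-1.
  rewrite /G lead_coef_map lead_coef_comp ?sL // lL lead_coef_map size_map_poly sq' /=.
  by rewrite rmorphM rmorphXn /= lead_coefE sq' /= oppr0.
have lFG : lead_coef (F * G) = Complex 0 (q`_n.-1).
  rewrite lead_coefM lF lG -{1}(prednK n_gt0) exprS mulrCA -mulrA -exprMn.
  have -> : (Complex 0 1 * Complex 0 (-1) : R[i]) = 1.
    by apply/eqP; rewrite eq_complex /= ?(mul0r, mulr0, mul1r, mulr1, sub0r, subr0, addr0, add0r, opprK) !eqxx.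
  rewrite expr1n mulr1 mulrC.
  by apply/eqP; rewrite eq_complex /= !mul0r mulr0 mul1r subr0 add0r !eqxx.
have lI : lead_coef (Im_poly (F * G)) = q`_n.-1.
  have s0 : (0 < size (F * G)%R)%N.
    rewrite lt0n size_poly_eq0 -lead_coef_eq0 lFG eq_complex /= negb_and.
    by rewrite (gt_eqF qpos) orbT.
  have E : complex.Im (F * G)`_(size (F * G)).-1 = q`_n.-1.
    by rewrite -lead_coefE lFG.
  by rewrite /Im_poly lead_coef_poly // E // gt_eqF.
have [M Mpos] : exists M, forall y, M <= y -> q`_n.-1 <= (Im_poly (F * G)).[y].
  by have := poly_pinfty_gt_lc (p := Im_poly (F * G)); rewrite lI => /(_ qpos).
have z_eq : z = Complex x eta by rewrite /x /eta; case: (z).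
rewrite z_eq -ev ltNge; apply/negP => le0.
pose b := Num.max eta M.
have eb : eta <= b by rewrite /b le_max lexx.
have [|y /andP[y1 _] ry] := @Num.Theory.poly_ivt R (Im_poly (F * G)) eta b eb.
  rewrite le0 /=; apply: le_trans (ltW qpos) _; apply: Mpos.
  by rewrite /b le_max lexx orbT.
have yp : 0 < complex.Im (Complex x y) by rewrite /=; apply: lt_le_trans y1.
have := Im_mul_conj_neq0 fm sf sq rr qn0 yp.
by rewrite -ev (eqP ry) eqxx.
Qed.

Lemma coef_prod_XaddC_gt0 (rs : seq R) : all (fun r => 0 < r) rs ->
  forall k, (k <= size rs)%N -> 0 < (\prod_(r <- rs) ('X + r%:P))`_k.
Proof.
elim: rs => [_|r rs IH /= /andP[rp rsp]] k.
  by rewrite leqn0 => /eqP ->; rewrite big_nil coef1 ltr01.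
rewrite big_cons mulrDl mulrC coefD coefMX mulrC coefMC => kle.
case: k kle => [|k] kle /=; first by rewrite add0r mulr_gt0 // IH.
rewrite ltr_pwDl ?IH //; case: (ltnP k (size rs)) => h; first by rewrite mulr_ge0 ?ltW // IH.
rewrite nth_default ?mul0r // (eq_bigr (fun r => 'X - (- r)%:P)) ?size_prod_XsubC //.
by move=> i _; rewrite polyCN opprK.
Qed.

Definition pos_from (t0 : R) p := forall t, t0 <= t -> 0 < p.[t].

(** Expanded at [t0], the polynomial is a product of factors ['X + r] with [r > 0], since
all roots lie to the left of [t0]. *)
Lemma shift_coef_gt0 n (t0 : R) f : f \is monic -> size f = n.+1 -> real_rooted f ->
  pos_from t0 f -> forall k, (k <= n)%N -> 0 < (f \Po ('X + t0%:P))`_k.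
Proof.
move=> fm sf rr fpos k kn; have [rs rsE] := real_rooted_factor fm rr.
have srs : size rs = n by move: sf; rewrite rsE size_prod_XsubC => -[].
have -> : f \Po ('X + t0%:P) = \prod_(r <- [seq t0 - r | r <- rs]) ('X + r%:P).
  rewrite rsE rmorph_prod /= big_map; apply: eq_bigr => r _.
  by rewrite rmorphB /= comp_polyX comp_polyC rmorphB /= addrA.
apply: coef_prod_XaddC_gt0; last by rewrite size_map srs.
apply/allP => _ /mapP[r rin ->]; rewrite subr_gt0 ltNge; apply/negP => /fpos.
by rewrite rsE (rootP _) ?ltxx // root_prod_XsubC.
Qed.

Lemma pos_from_shift n (t0 : R) f : (size f <= n.+1)%N ->
  (forall k, (k <= n)%N -> 0 <= (f \Po ('X + t0%:P))`_k) -> 0 < f.[t0] -> pos_from t0 f.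
Proof.
move=> sf cf f0 t t0t.
have E u : f.[u] = (f \Po ('X + t0%:P)).[u - t0].
  by rewrite horner_comp hornerD hornerX hornerC subrK.
have sg : (size (f \Po ('X + t0%:P)) <= n.+1)%N.
  by rewrite size_comp_poly2 // -(opprK t0%:P) -polyCN size_XsubC.
move: f0; rewrite !E subrr horner_coef0 (horner_coef_wide _ sg) big_ord_recl expr0 mulr1 => f0.
rewrite ltr_pwDl // sumr_ge0 // => i _; apply: mulr_ge0.
  by apply: cf; rewrite /= /bump leq0n add1n ltn_ord.
by rewrite exprn_ge0 // subr_ge0.
Qed.

(** The coefficients of the expansion at [t0] are positive for [g]. Let [s] be the first parameter on
the segment from [g] to [f] at which one of them vanishes, and [h] the polynomial at [s]. Its
coefficients at [t0] are nonnegative and its value there is positive, so [h] is positive from [t0] on;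
as [h] is real-rooted, its coefficients at [t0] are then all positive, a contradiction. *)
Lemma pos_from_endpoint n (t0 : R) f g :
  f \is monic -> size f = n.+1 -> g \is monic -> size g = n.+1 ->
  (forall s, 0 <= s <= 1 -> real_rooted ((1 - s) *: g + s *: f)) ->
  pos_from t0 g -> 0 < f.[t0] -> pos_from t0 f.
Proof.
move=> fm sf gm sg rr gpos f0.
pose a k := (g \Po ('X + t0%:P))`_k; pose b k := (f \Po ('X + t0%:P))`_k.
have rrg : real_rooted g.
  by have := rr 0; rewrite subr0 scale1r scale0r addr0; apply; rewrite lexx ler01.
have apos k : (k <= n)%N -> 0 < a k by apply: shift_coef_gt0.
suff bpos k : (k <= n)%N -> 0 < b k.
  by apply: (@pos_from_shift n); rewrite ?sf // => k kn; apply/ltW/bpos.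
move=> kn; rewrite ltNge; apply/negP => bk.
(* The parameter at which the coefficient [i] vanishes, if [b i <= 0 < a i]. *)
pose S (i : 'I_n.+1) := a i / (a i - b i).
have kn' : (k < n.+1)%N by [].
have Pk : b (Ordinal kn') <= 0 by [].
case: (@Order.TotalTheory.arg_minP _ _ _ (Ordinal kn') (fun i : 'I_n.+1 => b i <= 0) S Pk) => i bi imin.
have ai : 0 < a i by apply: apos; rewrite -ltnS ltn_ord.
have di : 0 < a i - b i by lra.
pose s := S i; have s01 : 0 <= s <= 1.
  apply/andP; split; first by apply: divr_ge0; lra.
  by rewrite /s /S ler_pdivrMr // mul1r; lra.
pose h := (1 - s) *: g + s *: f.
have cE j : (h \Po ('X + t0%:P))`_j = (1 - s) * a j + s * b j.
  by rewrite /h comp_polyD !comp_polyZ coefD !coefZ.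
have [hm sh] : h \is monic /\ size h = n.+1 by apply: convex_monic.
have h0 : 0 < h.[t0].
  rewrite /h hornerD !hornerZ; have g0 := gpos t0 (lexx _).
  case/andP: s01 => s0 s1; have [->|] := eqVneq s 0.
    by rewrite subr0 mul1r mul0r addr0.
  move=> sn0; have sp : 0 < s by rewrite lt_neqAle eq_sym sn0.
  by apply: ltr_wpDl; [apply: mulr_ge0; lra | apply: mulr_gt0].
have hc j : (j <= n)%N -> 0 <= (h \Po ('X + t0%:P))`_j.
  move=> jn; rewrite cE; have aj := apos _ jn.
  case: (lerP (b j) 0) => bj; last first.
    by case/andP: s01 => s0 s1; apply: addr_ge0; apply: mulr_ge0; lra.
  have jn' : (j < n.+1)%N by [].
  have : s <= a j / (a j - b j) := imin (Ordinal jn') bj.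
  rewrite ler_pdivlMr; last by lra.
  by move=> h1; nra.
have hpos : pos_from t0 h by apply: (@pos_from_shift n); rewrite ?sh.
have := shift_coef_gt0 hm sh (rr s s01) hpos (k := i).
rewrite -ltnS ltn_ord cE => /(_ isT).
suff -> : (1 - s) * a i + s * b i = 0 by rewrite ltxx.
by rewrite /s /S; field; rewrite gt_eqF.
Qed.

(** This is how a good permutation is selected from an average of two: a real-rooted segment which
has a member positive from [t0] on has such an end, namely one which is positive at [t0]. *)
Lemma pos_from_convex n (t0 p : R) f g :
  f \is monic -> size f = n.+1 -> g \is monic -> size g = n.+1 -> 0 <= p <= 1 ->
  (forall s, 0 <= s <= 1 -> real_rooted ((1 - s) *: g + s *: f)) ->
  pos_from t0 ((1 - p) *: g + p *: f) -> pos_from t0 g \/ pos_from t0 f.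
Proof.
move=> fm sf gm sg p01 rr hpos; set h := _ + _ in hpos.
case/andP: (p01) => p0 p1.
have [hm sh] : h \is monic /\ size h = n.+1 by apply: convex_monic.
have : 0 < h.[t0] by apply: hpos.
rewrite /h hornerD !hornerZ => h0.
have [f0|f0] := ltrP 0 f.[t0].
  right; apply: (pos_from_endpoint fm sf hm sh _ hpos f0) => s /andP[s0 s1].
  have -> : (1 - s) *: h + s *: f = (1 - (p + s - p * s)) *: g + (p + s - p * s) *: f.
    rewrite /h scalerDr !scalerA -addrA -scalerDl; congr (_ *: _ + _ *: _); ring.
  by apply: rr; apply/andP; split; nra.
left; apply: (pos_from_endpoint gm sg hm sh _ hpos); last by nra.
move=> s /andP[s0 s1].
have -> : (1 - s) *: h + s *: g = (1 - (p - p * s)) *: g + (p - p * s) *: f.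
  rewrite /h scalerDr !scalerA addrAC -scalerDl; congr (_ *: _ + _ *: _); ring.
by apply: rr; apply/andP; split; nra.
Qed.

End RealRooted.

(** * Hyperbolic maps and random exchanges *)

Section Hyperbolic.
Variable R : rcfType.

Definition relabel n (s : 'S_n) (X : 'M[R]_n) : 'M[R]_n := \matrix_(i, j) X (s i) (s j).

Definition gram n (a : 'rV[R]_n) : 'M[R]_n := a^T *m a.

Lemma gramE n (a : 'rV[R]_n) i j : gram a i j = a 0 i * a 0 j.
Proof. by rewrite mxE big_ord1 !mxE. Qed.

Lemma tr_gram n (a : 'rV[R]_n) : (gram a)^T = gram a.
Proof. by apply/matrixP => i j; rewrite mxE !gramE mulrC. Qed.

Lemma relabel_gram n (s : 'S_n) (a : 'rV[R]_n) : relabel s (gram a) = gram (\row_j a 0 (s j)).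
Proof. by apply/matrixP => i j; rewrite mxE !gramE !mxE. Qed.

Lemma relabelD n (s : 'S_n) X Y : relabel s (X + Y) = relabel s X + relabel s Y.
Proof. by apply/matrixP => i j; rewrite !mxE. Qed.

Lemma relabelZ n (s : 'S_n) k X : relabel s (k *: X) = k *: relabel s X.
Proof. by apply/matrixP => i j; rewrite !mxE. Qed.

Lemma relabelM n (s t : 'S_n) X : relabel (s * t)%g X = relabel s (relabel t X).
Proof. by apply/matrixP => i j; rewrite !mxE !permM. Qed.

Lemma relabel1 n (X : 'M[R]_n) : relabel 1%g X = X.
Proof. by apply/matrixP => i j; rewrite !mxE !perm1. Qed.

Lemma tr_relabel n (s : 'S_n) X : X^T = X -> (relabel s X)^T = relabel s X.
Proof. by move=> sX; apply/matrixP => i j; rewrite !mxE -[in RHS]sX mxE. Qed.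

Lemma gramZ n k (a : 'rV[R]_n) : gram (k *: a) = k ^+ 2 *: gram a.
Proof. by apply/matrixP => i j; rewrite gramE [RHS]mxE gramE !mxE; ring. Qed.

(** With [w] the difference of the unit vectors [i] and [j], the exchange subtracts
[w^T *m z + z^T *m w] for some row [z], and polarization makes this a difference of two squares. *)
Lemma swap_gram n (i j : 'I_n) (X : 'M[R]_n) : X^T = X ->
  exists u v, relabel (tperm i j) X = X + gram u - gram v.
Proof.
move=> sX; have [->|ij] := eqVneq i j.
  by exists 0, 0; rewrite tperm1 relabel1 addrK.
pose w k : R := (k == i)%:R - (k == j)%:R.
pose c := X i i - X i j - X j i + X j j.
pose z k := X i k - X j k - (c / 2) * w k.
pose r : R := Num.sqrt (1 / 2).
have r2 : r * r = 1 / 2 by rewrite -expr2 sqr_sqrtr // divr_ge0 ?ler01 ?ler0n.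
exists (\row_k (r * (w k - z k))), (\row_k (r * (w k + z k))).
have Xs a b : X a b = X b a by rewrite -{1}sX mxE.
apply/matrixP => a b.
have -> : (X + gram (\row_k (r * (w k - z k))) - gram (\row_k (r * (w k + z k)))) a b =
   X a b - w a * (X i b - X j b) - (X i a - X j a) * w b + c * w a * w b.
  transitivity (X a b + (r * r) * ((w a - z a) * (w b - z b))
                 - (r * r) * ((w a + z a) * (w b + z b))); last by rewrite r2 /z; field.
  rewrite [LHS]mxE [in X in X + _]mxE [in X in _ + X]mxE !gramE !mxE; ring.
rewrite mxE /c /w.
case: tpermP => [->|->|/eqP/negbTE ai /eqP/negbTE aj];
  case: tpermP => [->|->|/eqP/negbTE bi /eqP/negbTE bj];
  rewrite ?eqxx ?ai ?aj ?bi ?bj ?(negbTE ij) 1?(eq_sym j i) ?(negbTE ij) /=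
    ?(Xs j i) ?(Xs a i) ?(Xs a j) ; ring.
Qed.

(** A rank-one perturbation of [X] moves [P X] in a pencil of direction [q = P X - P (X + gram a)].
The coefficient of [q] in degree [m - 1] is the increase of the sum of the roots;
its sign says that the roots move to the right. *)
Definition hyperbolic m n (P : 'M[R]_n -> {poly R}) : Prop := forall X, X^T = X ->
  [/\ P X \is monic, size (P X) = m.+1, real_rooted (P X) &
     forall a, [/\ forall k, P (X + k *: gram a) = P X - k *: (P X - P (X + gram a)),
                   0 <= (P X - P (X + gram a))`_m.-1 &
                   (P X - P (X + gram a))`_m.-1 = 0 -> P (X + gram a) = P X]].

Lemma sym_add n (X : 'M[R]_n) a k : X^T = X -> (X + k *: gram a)^T = X + k *: gram a.
Proof. by move=> sX; rewrite linearD linearZ /= tr_gram sX. Qed.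

Lemma hyperbolic_Im m n (P : 'M[R]_n -> {poly R}) X a z : hyperbolic m P -> X^T = X ->
  0 < complex.Im z ->
  P (X + gram a) = P X \/
  0 < complex.Im (evalC (P X) z * conjc (evalC (P X - P (X + gram a)) z)).
Proof.
move=> hP sX zp; have [Pm Ps Pr Pa] := hP X sX.
have [Pk q_ge0 q_eq0] := Pa a.
have [/esym /q_eq0|q_neq0] := eqVneq 0 (P X - P (X + gram a))`_m.-1; first by left.
right; have [Pam Pas _ _] := hP _ (sym_add a 1 sX); rewrite scale1r in Pam Pas.
apply: (@Im_mul_conj_gt0 _ m) => //.
- exact: size_monic_sub.
- by move=> s; rewrite -Pk; have [] := hP _ (sym_add a s sX).
- by rewrite lt_neqAle q_neq0.
Qed.

(** [X] and its relabelling are both perturbations, by a square, of a common matrix [Y]. At a point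
of the upper half-plane, the values of both polynomials therefore lie on the same side of the line
through the origin and the value [f] of [P Y], unless they are equal to [f]; so no convex combination
of them vanishes. *)
Lemma hyperbolic_swap m n (P : 'M[R]_n -> {poly R}) i j p : 0 <= p <= 1 -> hyperbolic m P ->
  hyperbolic m (fun X => (1 - p) *: P X + p *: P (relabel (tperm i j) X)).
Proof.
move=> /andP[p0 p1] hP X sX; set t := tperm i j.
have [Xm Xs Xr Xa] := hP X sX.
have [Ym Ys Yr Ya] := hP _ (tr_relabel t sX).
have [cm cs] := convex_monic p Ym Ys Xm Xs.
split => //.
- move=> z zp; have [u [v E]] := swap_gram i j sX; rewrite -/t in E.
  pose Y := X - gram v.
  have sY : Y^T = Y by rewrite /Y -scaleN1r sym_add.
  have XE : X = Y + gram v by rewrite subrK.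
  have tXE : relabel t X = Y + gram u by rewrite E /Y addrAC.
  have [_ _ rrY _] := hP Y sY; have fz := rrY z zp.
  have Iv := hyperbolic_Im v hP sY zp; have Iu := hyperbolic_Im u hP sY zp.
  rewrite -XE in Iv; rewrite -tXE in Iu.
  rewrite evalCD !evalCZ.
  (* The cross product tells on which side of the line through the value of [P Y] that of [g] lies. *)
  have cross (g : {poly R}) : (g = P Y \/ 0 < complex.Im (evalC (P Y) z *
        conjc (evalC (P Y - g) z))) ->
      evalC g z = evalC (P Y) z \/
      0 < complex.Re (evalC (P Y) z) * complex.Im (evalC g z)
          - complex.Im (evalC (P Y) z) * complex.Re (evalC g z).
    case=> [->|]; first by left.
    rewrite evalCB; case: (evalC (P Y) z) => f1 f2; case: (evalC g z) => x1 x2 /= h.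
    by right; move: h; congr (0 < _); ring.
  move: (cross _ Iv) (cross _ Iu) fz.
  case: (evalC (P Y) z) => f1 f2; case: (evalC (P X) z) => x1 x2.
  case: (evalC (P (relabel t X)) z) => y1 y2 /=.
  move=> cv cu; rewrite !eq_complex /= !mul0r !subr0 !addr0.
  apply: contra => /andP[/eqP h1 /eqP h2].
  have D : (1 - p) * (f1 * x2 - f2 * x1) + p * (f1 * y2 - f2 * y1) = 0.
    transitivity (f1 * ((1 - p) * x2 + p * y2) - f2 * ((1 - p) * x1 + p * y1)).
      by ring.
    by rewrite h1 h2 !mulr0 subrr.
  case: cv => [[-> ->]|cv] in h1 h2 D *; case: cu => [[-> ->]|cu] in h1 h2 D *.
  + by apply/andP; split; apply/eqP; lra.
  + have /eqP : p * (f1 * y2 - f2 * y1) = 0 by lra.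
    rewrite mulf_eq0 (gt_eqF cu) orbF => /eqP p00.
    by rewrite p00 in h1 h2; apply/andP; split; apply/eqP; lra.
  + have /eqP : (1 - p) * (f1 * x2 - f2 * x1) = 0 by lra.
    rewrite mulf_eq0 (gt_eqF cv) orbF => /eqP p10.
    have p11 : p = 1 by lra.
    by rewrite p11 in h1 h2; apply/andP; split; apply/eqP; lra.
  + have q1 : 0 <= (1 - p) * (f1 * x2 - f2 * x1) by apply: mulr_ge0; lra.
    have q2 : 0 <= p * (f1 * y2 - f2 * y1) by apply: mulr_ge0; lra.
    have /eqP : p * (f1 * y2 - f2 * y1) = 0 by lra.
    have /eqP : (1 - p) * (f1 * x2 - f2 * x1) = 0 by lra.
    by rewrite !mulf_eq0 (gt_eqF cu) (gt_eqF cv) !orbF => /eqP h3 /eqP h4; lra.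
- move=> a; have [X1 X2 X3] := Xa a.
  have [Y1 Y2 Y3] := Ya (\row_k a 0 (t k)); rewrite -relabel_gram in Y1 Y2 Y3.
  have E (g1 g2 h1 h2 : {poly R}) : (1 - p) *: g1 + p *: g2 - ((1 - p) *: h1 + p *: h2) =
    (1 - p) *: (g1 - h1) + p *: (g2 - h2).
    by rewrite !scalerBr opprD addrACA.
  rewrite relabelD; split.
  + move=> k; rewrite relabelD relabelZ X1 Y1 E.
    move: (P X - P (X + gram a)) (P (relabel t X) - P (relabel t X + relabel t (gram a))) => A B.
    rewrite !scalerBr !scalerDr !scalerA [k * (1 - p)]mulrC [k * p]mulrC opprD.
    by rewrite addrACA.
  + by rewrite E coefD !coefZ addr_ge0 ?mulr_ge0 ?subr_ge0.
  + rewrite E coefD !coefZ => /eqP.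
    rewrite paddr_eq0 ?mulr_ge0 ?subr_ge0 // !mulf_eq0 => /andP[hx hy].
    congr (_ + _).
      by case/orP: hx => [/eqP->|/eqP/X3->//]; rewrite !scale0r.
    by case/orP: hy => [/eqP->|/eqP/Y3->//]; rewrite !scale0r.
Qed.
End Hyperbolic.

(** * Averages over site-preserving permutations *)

Section SitePerm.
Variables (n : nat) (T : eqType) (site : 'I_n -> T).

(** The chain from [fixing 0], which is trivial, to [fixing n], which consists of all site-preserving
permutations, has steps that amount to one random transposition each. *)
Definition fixing (k : nat) : {set 'S_n} :=
  [set s : 'S_n | [forall i, (site (s i) == site i) && ((k <= i)%N ==> (s i == i))]]%SET.

Lemma fixingP k (s : 'S_n) : reflect ((forall i, site (s i) = site i) /\
   forall i : 'I_n, (k <= i)%N -> s i = i) (s \in fixing k).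
Proof.
rewrite inE; apply: (iffP forallP) => [h|[h1 h2] i].
  split=> i; first by case/andP: (h i) => /eqP.
  by move=> ki; case/andP: (h i) => _ /implyP/(_ ki)/eqP.
by rewrite h1 eqxx /=; apply/implyP => ki; rewrite h2.
Qed.

Lemma fixing1 k : 1%g \in fixing k.
Proof. by apply/fixingP; split=> i; rewrite perm1. Qed.

Lemma fixing0 : fixing 0 = [set 1%g]%SET.
Proof.
apply/setP => s; rewrite finset.in_set1; apply/fixingP/eqP => [[_ h]|->].
  by apply/permP => i; rewrite h ?perm1.
by split=> i; rewrite perm1.
Qed.

Lemma fixingM k : {in fixing k &, forall s t, (s * t)%g \in fixing k}.
Proof.
move=> s t /fixingP[s1 s2] /fixingP[t1 t2]; apply/fixingP; split=> i.
  by rewrite permM t1 s1.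
by move=> ki; rewrite permM s2 // t2.
Qed.

Lemma fixing_mono k l : (k <= l)%N -> {subset fixing k <= fixing l}.
Proof.
move=> kl s /fixingP[s1 s2]; apply/fixingP; split=> // i li.
by apply: s2; apply: leq_trans li.
Qed.

Lemma fixingV k : {in fixing k, forall s, (s^-1)%g \in fixing k}.
Proof.
move=> s /fixingP[s1 s2]; apply/fixingP; split=> i; first by rewrite -s1 permKV.
by move=> ki; rewrite -{1}(s2 i ki) permK.
Qed.

Lemma tperm_fixing k (i j : 'I_n) : site i = site j -> (i < k)%N -> (j < k)%N ->
  tperm i j \in fixing k.
Proof.
move=> ij ik jk; apply/fixingP; split=> l.
  by case: tpermP => [->|->|].
by move=> kl; rewrite tpermD //; apply: contraTneq kl => <-; rewrite -ltnNge.
Qed.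

(** [fixing w.+1] splits into cosets of [fixing w], according to the image of [w]. *)
Lemma sum_fixingS (W : nmodType) (w : 'I_n) (phi : 'S_n -> W) :
  \sum_(s in fixing w.+1) phi s =
  \sum_(i : 'I_n | (i <= w)%N && (site i == site w)) \sum_(s in fixing w) phi (s * tperm i w)%g.
Proof.
rewrite (partition_big (fun s : 'S_n => s w)
  (fun i : 'I_n => (i <= w)%N && (site i == site w))) /=; last first.
  move=> s /fixingP[s1 s2]; rewrite s1 eqxx andbT leqNgt; apply/negP => sw.
  by have := s2 _ sw => /perm_inj E; rewrite E ltnn in sw.
apply: eq_bigr => i /andP[iw /eqP si].
rewrite [LHS](reindex_inj (mulIg (tperm i w))) /=; apply: eq_bigl => s.
have ti : tperm i w \in fixing w.+1 by apply: tperm_fixing.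
have tK : (s * tperm i w * tperm i w = s)%g by rewrite -mulgA tperm2 mulg1.
rewrite permM -[X in _ == X](tpermR i w) (inj_eq perm_inj).
apply/andP/idP => [[sin /eqP sw]|sin].
  have : s \in fixing w.+1 by rewrite -tK fixingM.
  case/fixingP => s1 s2; apply/fixingP; split=> // j.
  by rewrite leq_eqVlt => /orP[/eqP/val_inj <-|/s2].
split; last by case/fixingP: sin => _ ->.
by apply: fixingM => //; apply: fixing_mono sin.
Qed.

Lemma fixing_ind (P : 'S_n -> Prop) : P 1%g ->
  (forall s i j, site i = site j -> P s -> P (s * tperm i j)%g) ->
  forall s, s \in fixing n -> P s.
Proof.
move=> P1 PM s; suff : forall k, (k <= n)%N -> s \in fixing k -> P s by apply.
move=> k; elim: k s => [s _|k IH s kn sk].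
  by rewrite fixing0 finset.in_set1 => /eqP ->.
pose w := Ordinal kn; have [s1 s2] := fixingP _ _ sk.
have ss : site (s w) = site w by apply: s1.
have -> : s = (s * tperm (s w) w * tperm (s w) w)%g by rewrite -mulgA tperm2 mulg1.
apply: PM => //; apply: IH (ltnW kn) _.
apply/fixingP; split=> i; rewrite permM.
  by case: tpermP => [/perm_inj->|<-|_ _]; rewrite ?s1 // ss.
rewrite leq_eqVlt => /orP[/eqP ki|ki].
  by have -> : i = w by [apply: val_inj]; rewrite tpermL.
rewrite (s2 i ki) tpermD //; last by rewrite -val_eqE /= ltn_eqF.
rewrite -[X in _ != X](s2 i ki) (inj_eq perm_inj) -val_eqE /=.
by rewrite ltn_eqF.
Qed.

Lemma card_fixing_gt0 k : (0 < #|fixing k|)%N.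
Proof. by apply/card_gt0P; exists 1%g; apply: fixing1. Qed.

Lemma card_fixingS (w : 'I_n) : #|fixing w.+1| =
  (#|[pred i : 'I_n | (i <= w)%N && (site i == site w)]| * #|fixing w|)%N.
Proof.
rewrite -sum1_card (sum_fixingS w (fun=> 1%N)) sum_nat_const.
by rewrite sum1_card.
Qed.

Variable R : rcfType.

Definition avg k (W : lmodType R) (P : 'M[R]_n -> W) (X : 'M[R]_n) : W :=
  (#|fixing k|%:R)^-1 *: \sum_(s in fixing k) P (relabel s X).

Lemma avg_invariant k (W : lmodType R) (P : 'M[R]_n -> W) h X : h \in fixing k ->
  avg k P (relabel h X) = avg k P X.
Proof.
move=> hk; rewrite /avg; congr (_ *: _).
rewrite [RHS](reindex_inj (mulIg h)) /=; apply: eq_big => s; last by rewrite relabelM.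
apply/idP/idP => sk; first by rewrite fixingM.
by rewrite -(mulgK h s) fixingM ?fixingV.
Qed.

Lemma avgS (W : lmodType R) (P : 'M[R]_n -> W) (w : 'I_n) X :
  avg w.+1 P X = (#|[pred i : 'I_n | (i <= w)%N && (site i == site w)]|%:R)^-1 *:
  \sum_(i : 'I_n | (i <= w)%N && (site i == site w)) avg w P (relabel (tperm i w) X).
Proof.
rewrite /avg sum_fixingS card_fixingS natrM invfM -scalerA; congr (_ *: _).
rewrite scaler_sumr; apply: eq_bigr => i _; congr (_ *: _).
by apply: eq_bigr => s _; rewrite relabelM.
Qed.

(** The statement to be propagated along the chain: averaging keeps hyperbolic maps hyperbolic, and
one of the averaged polynomials is at least as far to the left as the average. *)
Definition averageable k : Prop := forall m (P : 'M[R]_n -> {poly R}), hyperbolic m P ->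
  hyperbolic m (avg k P) /\
  forall X t0, X^T = X -> pos_from t0 (avg k P X) ->
  exists2 g, g \in fixing n & pos_from t0 (P (relabel g X)).

Lemma eq_hyperbolic m (P P' : 'M[R]_n -> {poly R}) : P =1 P' -> hyperbolic m P -> hyperbolic m P'.
Proof.
move=> E hP X sX; have [h1 h2 h3 h4] := hP X sX; rewrite -E; split=> // a.
by have [a1 a2 a3] := h4 a; rewrite -!E; split=> // k; rewrite -!E a1 E.
Qed.

Lemma tperm_swap_eq (i j w : 'I_n) : i != w -> j != w -> j != i ->
  (tperm i w * tperm j w = tperm j i * tperm i w)%g.
Proof.
move=> iw jw ji.
have -> : tperm j i = (tperm j w ^ tperm i w)%g.
  by rewrite tpermJ tpermR tpermD 1?eq_sym // eq_sym.
by rewrite conjgE tpermV -!mulgA tperm2 mulg1.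
Qed.

(** Choosing one of the transpositions [tperm i w], or none, with probability [1 / K] for each of
the former, is the same as performing independent random exchanges one after the other. A second
exchange [tperm j w] which follows [tperm i w] differs from [tperm j w] alone by a permutation
below [w], under which [Q] is invariant. *)
Lemma hyperbolic_swaps m (Q : 'M[R]_n -> {poly R}) (w : 'I_n) (K : R) (r : seq 'I_n) :
  hyperbolic m Q -> (forall h X, h \in fixing w -> Q (relabel h X) = Q X) ->
  uniq r -> {in r, forall i : 'I_n, (i < w)%N /\ site i = site w} ->
  (size r)%:R + 1 <= K ->
  let Qr X := (1 - (size r)%:R / K) *: Q X + K^-1 *: \sum_(i <- r) Q (relabel (tperm i w) X) in
  hyperbolic m Qr /\
  forall X t0, X^T = X -> pos_from t0 (Qr X) ->
  exists2 g, g \in fixing n & pos_from t0 (Q (relabel g X)).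
Proof.
move=> hQ Qinv; elim: r => [_ _ _|i r IH /= /andP[ir ur] rP sK].
  have E X : (1 - (size ([::] : seq 'I_n))%:R / K) *: Q X
     + K^-1 *: \sum_(i <- [::]) Q (relabel (tperm i w) X) = Q X.
    by rewrite big_nil scaler0 addr0 mul0r subr0 scale1r.
  split; first by apply: eq_hyperbolic hQ => X; rewrite E.
  move=> X t0 sX /=; rewrite E => h; exists 1%g; last by rewrite relabel1.
  exact: fixing1.
have [iw si] := rP i (mem_head _ _).
have rP' : {in r, forall i : 'I_n, (i < w)%N /\ site i = site w}.
  by move=> j jr; apply: rP; rewrite inE jr orbT.
rewrite -natr1 in sK *; set sr : R := (size r)%:R in sK *.
have sr0 : 0 <= sr by rewrite ler0n.
have [] := IH ur rP'; first by rewrite -/sr; lra.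
rewrite -/sr; set Qr := fun X => _ + _ => hQr pQr.
(* This makes the weight [p * (1 - sr / K)] of the new exchange equal to [1 / K]. *)
pose p := (K - sr)^-1.
have Ksr : 0 < K - sr by lra.
have K0 : K != 0 by rewrite gt_eqF //; lra.
have p01 : 0 <= p <= 1.
  by rewrite /p invr_ge0 ltW //= invf_le1 //; lra.
have E X : (1 - p) *: Qr X + p *: Qr (relabel (tperm i w) X) =
   (1 - (sr + 1) / K) *: Q X + K^-1 *: \sum_(j <- i :: r) Q (relabel (tperm j w) X).
  have sumE : \sum_(j <- r) Q (relabel (tperm j w) (relabel (tperm i w) X)) =
    \sum_(j <- r) Q (relabel (tperm j w) X).
    rewrite big_seq [RHS]big_seq; apply: eq_bigr => j jr.
    have [jw sj] := rP' j jr.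
    rewrite -relabelM tperm_swap_eq.
    - rewrite relabelM Qinv //; apply: tperm_fixing => //; by rewrite si sj.
    - by rewrite -val_eqE /= ltn_eqF.
    - by rewrite -val_eqE /= ltn_eqF.
    - by apply: contraNneq ir => ->.
  rewrite /Qr sumE big_cons; move: (\sum_(j <- r) _) (Q X) (Q (relabel _ X)) => S A B.
  rewrite !scalerDr !scalerA addrACA -scalerDl [RHS]addrA.
  by congr (_ *: _ + _ *: _ + _ *: _); rewrite /p; field; rewrite K0 gt_eqF.
split; first exact: eq_hyperbolic E (hyperbolic_swap i w p01 hQr).
move=> X t0 sX; rewrite -E => h; set t := tperm i w in E h *.
have stX : (relabel t X)^T = relabel t X by apply: tr_relabel.
have [Xm Xs Xr _] := hQr X sX; have [Ym Ys Yr _] := hQr _ stX.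
have tfix : t \in fixing n by apply: tperm_fixing.
have rr s : 0 <= s <= 1 -> real_rooted ((1 - s) *: Qr X + s *: Qr (relabel t X)).
  by move=> s01; have [] := hyperbolic_swap i w s01 hQr sX.
have [/(pQr _ _ sX) [g gf gp]|/(pQr _ _ stX) [g gf gp]] :=
  pos_from_convex Ym Ys Xm Xs p01 rr h.
  by exists g.
by exists (g * t)%g; rewrite ?fixingM // relabelM.
Qed.

Lemma averageable_fixing k : (k <= n)%N -> averageable k.
Proof.
elim: k => [_ m P hP|k IH kn m P hP].
  have E X : avg 0 P X = P X.
    by rewrite /avg fixing0 cards1 invr1 scale1r big_set1 relabel1.
  split; first by apply: eq_hyperbolic hP => X.
  move=> X t0 _; rewrite E => h; exists 1%g; last by rewrite relabel1.
  exact: fixing1.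
have [hQ pQ] := IH (ltnW kn) m P hP.
pose w := Ordinal kn.
pose r := [seq i : 'I_n <- enum 'I_n | (i < w)%N && (site i == site w)].
have ur : uniq r by rewrite filter_uniq ?enum_uniq.
have rP : {in r, forall i : 'I_n, (i < w)%N /\ site i = site w}.
  by move=> i; rewrite mem_filter => /andP[/andP[iw /eqP si] _].
pose K : R := (size r)%:R + 1.
have sumE (W : nmodType) (F : 'I_n -> W) :
    \sum_(i : 'I_n | (i <= w)%N && (site i == site w)) F i = F w + \sum_(i <- r) F i.
  rewrite (bigD1 w) ?leqnn ?eqxx //=; congr (_ + _).
  rewrite big_filter big_enum_cond /=; apply: eq_bigl => i.
  by rewrite [RHS]andbC ltn_neqAle -(val_eqE i w) /=; case: (site i == _); rewrite ?andbT ?andbF //= andbC.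
have cardE : #|[pred i : 'I_n | (i <= w)%N && (site i == site w)]|%:R = K.
  by rewrite -sum1_card natr_sum sumE addrC /K -natr_sum sum1_size.
have := @hyperbolic_swaps m (avg k P) w K r hQ _ ur rP (lexx _).
have inv h X : h \in fixing w -> avg k P (relabel h X) = avg k P X.
  by apply: avg_invariant.
case/(_ inv) => h1 h2.
have K0 : K != 0 by rewrite gt_eqF // ltr_wpDl ?ler0n.
have E X : (1 - (size r)%:R / K) *: avg k P X + K^-1 *: \sum_(i <- r) avg k P (relabel (tperm i w) X)
    = avg k.+1 P X.
  rewrite -[k.+1]/(w.+1) avgS cardE sumE tperm1 relabel1 scalerDr; congr (_ *: _ + _).
  by rewrite /K; field.
split; first exact: eq_hyperbolic E h1.
move=> X t0 sX; rewrite -E => /(h2 _ _ sX) [g gf gp].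
have sgX : (relabel g X)^T = relabel g X by apply: tr_relabel.
have [g' g'f g'p] := pQ _ _ sgX gp.
by exists (g' * g)%g; rewrite ?fixingM // relabelM.
Qed.

End SitePerm.

(** * Determinants of perturbations of rank one and two *)

Section RankOne.
Variable K : comNzRingType.

Definition set_row n (A : 'M[K]_n) i0 (u : 'rV[K]_n) : 'M[K]_n :=
  \matrix_(i, j) if i == i0 then u 0 j else A i j.

Lemma det_set_row_linear n (A : 'M[K]_n) i0 a b u v :
  \det (set_row A i0 (a *: u + b *: v)) = a * \det (set_row A i0 u) + b * \det (set_row A i0 v).
Proof.
apply: (@determinant_multilinear _ _ _ _ _ i0).
- by apply/rowP => j; rewrite !mxE eqxx.
- by apply/matrixP => i j; rewrite !mxE eq_sym (negbTE (neq_lift _ _)).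
- by apply/matrixP => i j; rewrite !mxE eq_sym (negbTE (neq_lift _ _)).
Qed.

Lemma block_mx_set_row n (d : 'M[K]_1) (r : 'rV[K]_n) c A :
  block_mx d r c A = set_row (block_mx 0 0 c A) (lshift n 0) (row_mx d r).
Proof.
apply/matrixP => i j; rewrite [RHS]mxE.
case: (split_ordP i) => i' ->.
  have -> : i' = 0 by apply: ord1.
  rewrite eqxx; case: (split_ordP j) => j' ->.
    by rewrite block_mxEul row_mxEl.
  by rewrite block_mxEur row_mxEr.
rewrite eq_rlshift; case: (split_ordP j) => j' ->.
  by rewrite !block_mxEdl.
by rewrite !block_mxEdr.
Qed.

(** The number [r *m \adj A *m c]; as a bordered determinant it is visibly linear in [r] and [c]. *)
Definition bord n (A : 'M[K]_n) (c : 'cV[K]_n) (r : 'rV[K]_n) : K :=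
  \det (block_mx (0 : 'M[K]_1) (- r) c A).

(** The matrix determinant lemma: the determinant bordered by [1] splits by linearity in its first
row. *)
Lemma det_add_rank1 n (A : 'M[K]_n) (c : 'cV[K]_n) (r : 'rV[K]_n) :
  \det (A + c *m r) = \det A + bord A c r.
Proof.
have -> : \det (A + c *m r) = \det (block_mx (1%:M : 'M[K]_1) (- r) c A).
  rewrite (_ : block_mx _ _ _ _ =
     block_mx 1%:M 0 c 1%:M *m block_mx 1%:M (- r) 0 (A + c *m r)).
    by rewrite det_mulmx det_lblock det_ublock !det1 !mul1r.
  rewrite mulmx_block !mul1mx !mulmx1 !mul0mx ?mulmx0 !addr0 mulmxN addrCA.
  by rewrite addNr addr0.
rewrite block_mx_set_row.
have -> : row_mx 1%:M (- r) = 1 *: row_mx 1%:M 0 + 1 *: row_mx (0 : 'M[K]_1) (- r).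
  by rewrite !scale1r add_row_mx add0r addr0.
rewrite det_set_row_linear !mul1r -!block_mx_set_row.
by rewrite det_lblock det1 mul1r.
Qed.

Lemma bord_linr n (A : 'M[K]_n) c a b r r' :
  bord A c (a *: r + b *: r') = a * bord A c r + b * bord A c r'.
Proof.
have E r0 : bord A c r0 =
    \det (set_row (block_mx 0 0 c A) (lshift n 0) (row_mx (0 : 'M[K]_1) (- r0))).
  by rewrite /bord block_mx_set_row.
rewrite !E -det_set_row_linear; congr (\det (set_row _ _ _)).
by rewrite !scale_row_mx add_row_mx !scaler0 addr0 opprD !scalerN.
Qed.

Lemma bord_tr n (A : 'M[K]_n) c r : bord A c r = bord A^T r^T c^T.
Proof.
apply: (addrI (\det A)); rewrite -det_add_rank1 -det_tr -[X in _ = X + _]det_tr.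
by rewrite -det_add_rank1 linearD /= trmx_mul.
Qed.

Lemma bord_linl n (A : 'M[K]_n) a b c c' r :
  bord A (a *: c + b *: c') r = a * bord A c r + b * bord A c' r.
Proof. by rewrite bord_tr linearP /= linearZ bord_linr -!bord_tr. Qed.

(** The mixed second difference of the determinant, in two directions of rank one. It is symmetric
in the two directions, hence linear in each of the four vectors. *)
Definition bord2 n (A : 'M[K]_n) (c : 'cV[K]_n) (r : 'rV[K]_n)
    (c' : 'cV[K]_n) (r' : 'rV[K]_n) : K := bord (A + c' *m r') c r - bord A c r.

Lemma bord2C n (A : 'M[K]_n) c r c' r' : bord2 A c r c' r' = bord2 A c' r' c r.
Proof.
have E (B : 'M[K]_n) (u : 'cV[K]_n) (v : 'rV[K]_n) : bord B u v = \det (B + u *m v) - \det B.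
  by rewrite det_add_rank1 addrAC subrr add0r.
by rewrite /bord2 !E [A + c' *m r' + _]addrAC; ring.
Qed.

Lemma det_add_rank2 n (A : 'M[K]_n) (c : 'cV[K]_n) (r : 'rV[K]_n)
    (c' : 'cV[K]_n) (r' : 'rV[K]_n) :
  \det (A + c *m r + c' *m r') = \det A + bord A c r + bord A c' r' + bord2 A c r c' r'.
Proof.
by rewrite addrAC det_add_rank1 (det_add_rank1 A c') /bord2; ring.
Qed.

Lemma bord2_lin1 n (A : 'M[K]_n) a b c d r c' r' :
  bord2 A (a *: c + b *: d) r c' r' = a * bord2 A c r c' r' + b * bord2 A d r c' r'.
Proof. by rewrite /bord2 !bord_linl; ring. Qed.

Lemma bord2_lin2 n (A : 'M[K]_n) a b c r d c' r' :
  bord2 A c (a *: r + b *: d) c' r' = a * bord2 A c r c' r' + b * bord2 A c d c' r'.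
Proof. by rewrite /bord2 !bord_linr; ring. Qed.

(** Sylvester's identity: both sides are the determinant of one block matrix, factored in two
ways. *)
Lemma det_mulC_add m n (A : 'M[K]_(m, n)) (B : 'M[K]_(n, m)) :
  \det (1%:M + A *m B) = \det (1%:M + B *m A).
Proof.
transitivity (\det (block_mx 1%:M (- A) B 1%:M)).
  have -> : block_mx 1%:M (- A) B 1%:M =
     block_mx 1%:M (- A) 0 1%:M *m block_mx (1%:M + A *m B) 0 B 1%:M.
    rewrite mulmx_block !mul1mx !mulmx1 ?mul0mx ?mulmx0 ?addr0 ?add0r mulNmx.
    by rewrite addrK.
  by rewrite det_mulmx det_lblock det_ublock !det1 !mul1r mulr1.
have -> : block_mx 1%:M (- A) B 1%:M =
     block_mx 1%:M 0 B 1%:M *m block_mx 1%:M (- A) 0 (1%:M + B *m A).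
  rewrite mulmx_block !mul1mx !mulmx1 ?mul0mx ?mulmx0 ?addr0 ?add0r mulmxN.
  by rewrite addrCA addNr addr0.
by rewrite det_mulmx det_lblock det_ublock !det1 !mul1r.
Qed.

End RankOne.

(** * Characteristic polynomials of symmetric matrices *)

Section Base.
Variable R : rcfType.

Lemma char_poly_add_rank1 n (A : 'M[R]_n) (c : 'cV[R]_n) (r : 'rV[R]_n) k :
  char_poly (A + k *: (c *m r)) =
  char_poly A - k *: (char_poly A - char_poly (A + c *m r)).
Proof.
have E k' : char_poly (A + k' *: (c *m r)) =
    char_poly A + k' *: - bord (char_poly_mx A) (map_mx polyC c) (map_mx polyC r).
  rewrite /char_poly /char_poly_mx.
  have -> : map_mx polyC (A + k' *: (c *m r)) = map_mx polyC A
       + map_mx polyC c *m (k'%:P *: map_mx polyC r).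
    by rewrite map_mxD map_mxZ map_mxM scalemxAr.
  rewrite opprD addrA -mulmxN -scalerN det_add_rank1.
  rewrite -[k'%:P *: _]addr0 -(scale0r 0) bord_linr mul0r addr0 mul_polyC.
  congr (_ + _ *: _).
  rewrite -scaleN1r -[-1 *: _]addr0 -(scale0r 0) bord_linr mul0r addr0.
  by rewrite mulN1r.
have := E 1; rewrite !scale1r => ->; rewrite E opprD addrA subrr add0r opprK.
by rewrite scalerN.
Qed.

Lemma real_rooted_char_poly n (A : 'M[R]_n) : A^T = A -> real_rooted (char_poly A).
Proof.
move=> sA z zp; rewrite /evalC map_char_poly; apply/negP => rz.
set AC := map_mx _ A in rz.
have : eigenvalue AC z by rewrite eigenvalue_root_char.
case/eigenvalueP => v vA vn0.
pose w : 'cV[R[i]]_n := map_mx (@conjc R) v^T.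
have wA : AC *m w = conjc z *: w.
  have sAC : AC^T = AC by rewrite /AC -[in RHS]sA; apply/matrixP => i j; rewrite !mxE.
  have -> : AC = map_mx (@conjc R) AC.
    by apply/matrixP => i j; rewrite !mxE /= oppr0.
  rewrite -map_mxM -[AC *m _]trmxK trmx_mul trmxK sAC vA.
  by apply/matrixP => i j; rewrite !mxE rmorphM.
have E : z *: (v *m w) = conjc z *: (v *m w).
  by rewrite scalemxAl -vA -mulmxA wA scalemxAr.
have : (v *m w) 0 0 = 0.
  move/matrixP/(_ 0 0)/eqP: E; rewrite !mxE -subr_eq0 -mulrBl mulf_eq0 => /orP[|/eqP //].
  case: (z) zp => a b /= bp; rewrite eq_complex /= opprK => /andP[_].
  by rewrite -mulr2n mulrn_eq0 /= (gt_eqF bp).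
rewrite mxE => S0; case/eqP: vn0; apply/rowP => j; rewrite mxE.
have ge0 i : 0 <= v 0 i * w i 0.
  by rewrite !mxE; apply: mulcJ_ge0.
move/eqP: S0; rewrite psumr_eq0 => [/allP/(_ j)|i _]; last exact: ge0.
rewrite mem_index_enum => /(_ isT) /=; rewrite !mxE mulf_eq0 conjc_eq0 orbb.
by move/eqP.
Qed.

(** Compressing a square gives a square, namely that of [b = M *m a^T], and by the trace the
sum of the eigenvalues increases by the squared norm of [b]. *)
Lemma hyperbolic_char_poly m n (M : 'M[R]_(m, n)) :
  hyperbolic m (fun X : 'M[R]_n => char_poly (M *m X *m M^T)).
Proof.
move=> X sX; split.
- exact: char_poly_monic.
- exact: size_char_poly.
- by apply: real_rooted_char_poly; rewrite !trmx_mul trmxK sX mulmxA.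
move=> a; pose b : 'cV[R]_m := M *m a^T.
have E k : M *m (X + k *: gram a) *m M^T = M *m X *m M^T + k *: (b *m b^T).
  rewrite mulmxDr mulmxDl; congr (_ + _).
  by rewrite -scalemxAr -scalemxAl /gram /b trmx_mul trmxK !mulmxA.
have E1 : M *m (X + gram a) *m M^T = M *m X *m M^T + b *m b^T.
  by have := E 1; rewrite !scale1r.
have tr : (char_poly (M *m X *m M^T) - char_poly (M *m (X + gram a) *m M^T))`_m.-1
   = \sum_i b i 0 ^+ 2.
  rewrite E1 coefB; case: (posnP m) b E E1 => [m0|m_gt0] b E E1.
    move: b {E E1}; subst m => b; rewrite big_ord0.
    by rewrite /char_poly !det_mx00 subrr.
  rewrite !char_poly_trace // mxtraceD; transitivity (\tr (b *m b^T)); first by ring.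
  by apply: eq_bigr => i _; rewrite mxE big_ord1 !mxE expr2.
rewrite tr; split.
- by move=> k; rewrite E E1 char_poly_add_rank1.
- by apply: sumr_ge0 => i _; apply: sqr_ge0.
move/eqP; rewrite psumr_eq0 => [/allP h|i _]; last exact: sqr_ge0.
have b0 : b = 0.
  apply/colP => i; rewrite [RHS]mxE; apply/eqP; rewrite -sqrf_eq0.
  by apply: (h i); rewrite mem_index_enum.
by rewrite E1 b0 mul0mx addr0.
Qed.

End Base.

(** * Reflections and quartic forms *)

Section Reflection.
Variable R : rcfType.

Definition dot n (u v : 'rV[R]_n) : R := (u *m v^T) 0 0.

Lemma dot_linl n a b (u v w : 'rV[R]_n) : dot (a *: u + b *: v) w = a * dot u w + b * dot v w.
Proof. by rewrite /dot mulmxDl -!scalemxAl !mxE. Qed.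

Lemma dotC n (u v : 'rV[R]_n) : dot u v = dot v u.
Proof. by rewrite /dot -[u in LHS]trmxK -trmx_mul mxE. Qed.

Lemma dot_linr n a b (u v w : 'rV[R]_n) : dot w (a *: u + b *: v) = a * dot w u + b * dot w v.
Proof. by rewrite dotC dot_linl !(dotC w). Qed.

Lemma dotE n (u v : 'rV[R]_n) : dot u v = \sum_i u 0 i * v 0 i.
Proof. by rewrite /dot mxE; apply: eq_bigr => i _; rewrite mxE. Qed.

Lemma dot_ge0 n (u : 'rV[R]_n) : 0 <= dot u u.
Proof. by rewrite dotE sumr_ge0 // => i _; rewrite -expr2 sqr_ge0. Qed.

Lemma dot_eq0 n (u : 'rV[R]_n) : (dot u u == 0) = (u == 0).
Proof.
apply/eqP/eqP => [|->]; last by rewrite /dot mul0mx mxE.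
move/eqP; rewrite dotE psumr_eq0 => [/allP h|i _]; last by rewrite -expr2 sqr_ge0.
apply/rowP => i; have := h i; rewrite mem_index_enum mxE => /(_ isT) /=.
by rewrite mulf_eq0 orbb => /eqP.
Qed.

Lemma mul_row_tr n (u v : 'rV[R]_n) : u *m v^T = (dot u v)%:M.
Proof. exact: mx11_scalar. Qed.

(** For [w = 0] this is the identity, the inverse of [0] being [0]. *)
Definition refl n (w : 'rV[R]_n) : 'M[R]_n := 1%:M - (2 / dot w w) *: gram w.

Lemma refl0 n : refl (0 : 'rV[R]_n) = 1%:M.
Proof. by rewrite /refl /gram mulmx0 scaler0 subr0. Qed.

Lemma reflZ n a (w : 'rV[R]_n) : a != 0 -> refl (a *: w) = refl w.
Proof.
move=> a0; rewrite /refl gramZ scalerA; congr (_ - _ *: _).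
have -> : dot (a *: w) (a *: w) = a ^+ 2 * dot w w.
  by rewrite /dot linearZ -scalemxAl -scalemxAr !mxE expr2 mulrA.
have [->|d0] := eqVneq (dot w w) 0; first by rewrite mulr0 invr0 !mulr0 mul0r.
by field; rewrite ?a0 ?d0.
Qed.

Lemma tr_refl n (w : 'rV[R]_n) : (refl w)^T = refl w.
Proof. by rewrite /refl linearB /= trmx1 linearZ /= tr_gram. Qed.

Lemma refl_sq n (w : 'rV[R]_n) : refl w *m refl w = 1%:M.
Proof.
have [->|w0] := eqVneq w 0; first by rewrite refl0 mulmx1.
have d0 : dot w w != 0 by rewrite dot_eq0.
rewrite /refl mulmxBl mul1mx mulmxBr mulmx1 -scalemxAl -scalemxAr scalerA.
have -> : gram w *m gram w = dot w w *: gram w.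
  by rewrite /gram mulmxA -(mulmxA _ w) mul_row_tr mul_mx_scalar -scalemxAl.
set k := 2 / dot w w.
have -> : 1%:M - k *: gram w - (k *: gram w - (k * k) *: (dot w w *: gram w)) =
   1%:M + (k * k * dot w w - (k + k)) *: gram w.
  rewrite scalerA scalerBl scalerDl opprB -!addrA; congr (_ + _).
  by rewrite addrCA opprD.
have -> : k * k * dot w w - (k + k) = 0 by rewrite /k; field.
by rewrite scale0r addr0.
Qed.

Lemma det_refl n (w : 'rV[R]_n) : w != 0 -> \det (refl w) = -1.
Proof.
move=> w0; have d0 : dot w w != 0 by rewrite dot_eq0.
rewrite /refl; have -> : 1%:M - (2 / dot w w) *: gram w = 1%:M + (- (2 / dot w w) *: w^T) *m w.
  by rewrite -scalemxAl scaleNr.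
rewrite det_mulC_add -scalemxAr mul_row_tr det_mx11 !mxE /= !mulr1n; field; exact: d0.
Qed.

Definition quadrilinear n (m : 'rV[R]_n -> 'rV[R]_n -> 'rV[R]_n -> 'rV[R]_n -> R) : Prop :=
  [/\ forall a b u v y z t, m (a *: u + b *: v) y z t = a * m u y z t + b * m v y z t,
      forall a b u v x z t, m x (a *: u + b *: v) z t = a * m x u z t + b * m x v z t,
      forall a b u v x y t, m x y (a *: u + b *: v) t = a * m x y u t + b * m x y v t &
      forall a b u v x y z, m x y z (a *: u + b *: v) = a * m x y z u + b * m x y z v].

Lemma quadrilinear_form n m (p q : 'rV[R]_n) : quadrilinear m ->
  exists a0 a1 a2 a3 a4, forall s t, let w := s *: p + t *: q in
  m w w w w = a0 * s ^+ 4 + a1 * s ^+ 3 * t + a2 * s ^+ 2 * t ^+ 2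
     + a3 * s * t ^+ 3 + a4 * t ^+ 4.
Proof.
case=> l1 l2 l3 l4.
exists (m p p p p), (m q p p p + m p q p p + m p p q p + m p p p q),
  (m q q p p + m q p q p + m q p p q + m p q q p + m p q p q + m p p q q),
  (m p q q q + m q p q q + m q q p q + m q q q p), (m q q q q).
move=> s t /=; rewrite l1 !l2 !l3 !l4; ring.
Qed.

(** In the coordinates [s ^+ 2 - t ^+ 2] and [2 * s * t], which turn with the double angle, a
quartic form has components of frequencies [0], [2] and [4]. When neither the cosine [c] nor the sine
[d] vanishes, the double and the quadruple of the angle are not multiples of [2 * pi], so invariance
kills the last two components. *)
Lemma rotation_invariant_quartic (c d a0 a1 a2 a3 a4 : R) :
  let f s t := a0 * s ^+ 4 + a1 * s ^+ 3 * t + a2 * s ^+ 2 * t ^+ 2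
     + a3 * s * t ^+ 3 + a4 * t ^+ 4 in
  c ^+ 2 + d ^+ 2 = 1 -> c != 0 -> d != 0 ->
  (forall s t, f (c * s + d * t) (c * t - d * s) = f s t) ->
  forall s t, f s t = a0 * (s ^+ 2 + t ^+ 2) ^+ 2.
Proof.
move=> f cd c0 d0 inv.
(* The coefficients of the components of frequencies [2], [4] and [0]. *)
pose B := (a0 - a4) / 2; pose C := (a1 + a3) / 4.
pose D := (a0 + a4 - a2) / 8; pose E := (a1 - a3) / 8.
pose A := (3 * a0 + 3 * a4 + a2) / 8.
have fE s t : f s t = A * (s ^+ 2 + t ^+ 2) ^+ 2
   + (s ^+ 2 + t ^+ 2) * (B * (s ^+ 2 - t ^+ 2) + C * (2 * s * t))
   + D * ((s ^+ 2 - t ^+ 2) ^+ 2 - (2 * s * t) ^+ 2) + 2 * E * (s ^+ 2 - t ^+ 2) * (2 * s * t).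
  by rewrite /f /A /B /C /D /E; field.
(* The cosines and sines of twice and four times the angle of the rotation. *)
pose C2 := c ^+ 2 - d ^+ 2; pose S2 := - (2 * c * d).
pose C4 := C2 ^+ 2 - S2 ^+ 2; pose S4 := 2 * C2 * S2.
have rhoE s t : (c * s + d * t) ^+ 2 + (c * t - d * s) ^+ 2 = s ^+ 2 + t ^+ 2.
  transitivity ((c ^+ 2 + d ^+ 2) * (s ^+ 2 + t ^+ 2)); first by ring.
  by rewrite cd mul1r.
have XE s t : (c * s + d * t) ^+ 2 - (c * t - d * s) ^+ 2 = C2 * (s ^+ 2 - t ^+ 2) - S2 * (2 * s * t).
  by rewrite /C2 /S2; ring.
have YE s t : 2 * (c * s + d * t) * (c * t - d * s) = C2 * (2 * s * t) + S2 * (s ^+ 2 - t ^+ 2).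
  by rewrite /C2 /S2; ring.
have I s t := inv s t.
have J s t : (s ^+ 2 + t ^+ 2) * (B * (C2 * (s ^+ 2 - t ^+ 2) - S2 * (2 * s * t))
      + C * (C2 * (2 * s * t) + S2 * (s ^+ 2 - t ^+ 2)))
   + D * (C4 * ((s ^+ 2 - t ^+ 2) ^+ 2 - (2 * s * t) ^+ 2) - S4 * (2 * (s ^+ 2 - t ^+ 2) * (2 * s * t)))
   + E * (C4 * (2 * (s ^+ 2 - t ^+ 2) * (2 * s * t)) + S4 * ((s ^+ 2 - t ^+ 2) ^+ 2 - (2 * s * t) ^+ 2))
  = (s ^+ 2 + t ^+ 2) * (B * (s ^+ 2 - t ^+ 2) + C * (2 * s * t))
   + D * ((s ^+ 2 - t ^+ 2) ^+ 2 - (2 * s * t) ^+ 2) + 2 * E * (s ^+ 2 - t ^+ 2) * (2 * s * t).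
  have := I s t; rewrite !fE rhoE XE YE /C4 /S4 => h.
  by clear -h; lra.
(* Five points suffice to compare the coefficients. *)
have J10 := J 1 0; have J01 := J 0 1; have J11 := J 1 1; have J1n := J 1 (-1); have J21 := J 2 1.
clear J I inv.
have e1 : B * C2 + C * S2 = B by lra.
have e2 : D * C4 + E * S4 = D by lra.
have e3 : C * C2 - B * S2 = C by lra.
have CS : C2 ^+ 2 + S2 ^+ 2 = 1.
  transitivity ((c ^+ 2 + d ^+ 2) ^+ 2); first by rewrite /C2 /S2; ring.
  by rewrite cd expr1n.
have S2n0 : S2 != 0.
  by rewrite /S2 oppr_eq0 !mulf_neq0 // pnatr_eq0.
have CS4 : C4 ^+ 2 + S4 ^+ 2 = 1.
  transitivity ((C2 ^+ 2 + S2 ^+ 2) ^+ 2); first by rewrite /C4 /S4; ring.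
  by rewrite CS expr1n.
have C2n1 : C2 != 1.
  apply: contraNneq S2n0 => h; move: CS; rewrite h expr1n => /eqP.
  by rewrite addrC -subr_eq0 addrK sqrf_eq0.
have C4n1 : C4 != 1.
  rewrite -subr_eq0 -[X in _ - X]CS.
  have -> : C4 - (C2 ^+ 2 + S2 ^+ 2) = - (2 * S2 ^+ 2) by rewrite /C4; ring.
  by rewrite oppr_eq0 mulf_neq0 ?pnatr_eq0 // sqrf_eq0.
have solve (c' s' x y : R) : c' ^+ 2 + s' ^+ 2 = 1 -> c' != 1 -> x * c' + y * s' = x ->
   y * c' - x * s' = y -> x = 0 /\ y = 0.
  move=> h1 h2 h3 h4.
  have k0 : 2 * (1 - c') != 0.
    by rewrite mulf_neq0 ?pnatr_eq0 // subr_eq0 eq_sym.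
  have ex : x * (2 * (1 - c')) = 0.
    transitivity (x * (c' ^+ 2 + s' ^+ 2) + x - 2 * x * c'); first by rewrite h1; ring.
    transitivity ((x * c' + y * s') * c' - (y * c' - x * s') * s' + x - 2 * x * c'); first by ring.
    rewrite h3 h4; transitivity (x - (x * c' + y * s')); first by ring.
    by rewrite h3 subrr.
  have ey : y * (2 * (1 - c')) = 0.
    transitivity (y * (c' ^+ 2 + s' ^+ 2) + y - 2 * y * c'); first by rewrite h1; ring.
    transitivity ((y * c' - x * s') * c' + (x * c' + y * s') * s' + y - 2 * y * c'); first by ring.
    rewrite h3 h4; transitivity (y - (y * c' - x * s')); first by ring.
    by rewrite h4 subrr.
  by split; apply/eqP; [move/eqP: ex | move/eqP: ey]; rewrite mulf_eq0 (negbTE k0) orbF.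
have [B0 C0] := solve _ _ _ _ CS C2n1 e1 e3.
rewrite B0 C0 in J21.
have e4 : E * C4 - D * S4 = E by lra.
have [D0 E0] := solve _ _ _ _ CS4 C4n1 e2 e4.
have A0 : A = a0 by move: B0 D0; rewrite /A /B /D; lra.
by move=> s t; rewrite fE B0 C0 D0 E0 A0; ring.
Qed.

End Reflection.

(** * Reflections of a plane *)

Section Plane.
Variable R : rcfType.

Lemma dot_mul_frame m n (T : 'M[R]_(m, n)) (x y : 'rV[R]_m) : T *m T^T = 1%:M ->
  dot (x *m T) (y *m T) = dot x y.
Proof. by move=> TT; rewrite /dot trmx_mul mulmxA -(mulmxA x) TT mulmx1. Qed.

Lemma refl_frame m n (T : 'M[R]_(m, n)) (x : 'rV[R]_m) : T *m T^T = 1%:M ->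
  refl (x *m T) = 1%:M + T^T *m (refl x - 1%:M) *m T.
Proof.
move=> TT; rewrite /refl dot_mul_frame // addrAC subrr sub0r mulmxN mulNmx.
by rewrite -scalemxAr -scalemxAl /gram trmx_mul !mulmxA.
Qed.

(** The embedding of the linear maps of the span of the frame [T], extended by the identity on the
orthogonal complement, is multiplicative. *)
Lemma frame_mul m n (T : 'M[R]_(m, n)) (Z Z' : 'M[R]_m) : T *m T^T = 1%:M ->
  (1%:M + T^T *m (Z - 1%:M) *m T) *m (1%:M + T^T *m (Z' - 1%:M) *m T)
  = 1%:M + T^T *m (Z *m Z' - 1%:M) *m T.
Proof.
move=> TT.
have -> : Z *m Z' - 1%:M = (Z' - 1%:M) + ((Z - 1%:M) + (Z - 1%:M) *m (Z' - 1%:M)).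
  rewrite mulmxBl mul1mx mulmxBr mulmx1; move: (Z *m Z') => W.
  by apply/matrixP => i j; rewrite !mxE; ring.
move: (Z - 1%:M) (Z' - 1%:M) => Y Y'.
rewrite mulmxDl mul1mx mulmxDr mulmx1 -addrA; congr (_ + _).
rewrite !mulmxDr !mulmxDl; congr (_ + (_ + _)).
by rewrite !mulmxA -(mulmxA _ T) TT mulmx1.
Qed.

Definition mx2 (a b c d : R) : 'M[R]_2 := \matrix_(i, j)
  if i == 0 then (if j == 0 then a else b) else (if j == 0 then c else d).

Lemma mx2_mul a b c d a' b' c' d' : mx2 a b c d *m mx2 a' b' c' d' =
  mx2 (a * a' + b * c') (a * b' + b * d') (c * a' + d * c') (c * b' + d * d').
Proof.
apply/matrixP => i j; rewrite !mxE !big_ord_recl big_ord0 !mxE /= addr0.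
by case: ifP => _; case: ifP => _.
Qed.

Definition rv2 (s t : R) : 'rV[R]_2 := \row_j if j == 0 then s else t.

Lemma dot_rv2 s t s' t' : dot (rv2 s t) (rv2 s' t') = s * s' + t * t'.
Proof. by rewrite dotE !big_ord_recl big_ord0 !mxE /= addr0. Qed.

Lemma refl_rv2 s t : s ^+ 2 + t ^+ 2 != 0 -> refl (rv2 s t) = (s ^+ 2 + t ^+ 2)^-1 *:
  mx2 (t ^+ 2 - s ^+ 2) (- (2 * s * t)) (- (2 * s * t)) (s ^+ 2 - t ^+ 2).
Proof.
move=> st; rewrite /refl dot_rv2 -!expr2; apply/matrixP => i j.
rewrite !mxE big_ord1 !mxE.
case: (unliftP 0 i) => [i'|] ->; case: (unliftP 0 j) => [j'|] ->;
  rewrite ?[i']ord1 ?[j']ord1 /= ?mulr1n ?mulr0n; field; exact: st.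
Qed.

(** In a plane, the composite of an odd number of reflections is a reflection; the angles of the
reflecting vectors add up with alternating signs. *)
Lemma refl_rv2_mul3 c d s t : c ^+ 2 + d ^+ 2 = 1 -> s ^+ 2 + t ^+ 2 != 0 ->
  refl (rv2 1 0) *m refl (rv2 c d) *m refl (rv2 s t) = refl (rv2 (c * s + d * t) (c * t - d * s)).
Proof.
move=> cd st.
have E : (c * s + d * t) ^+ 2 + (c * t - d * s) ^+ 2 = s ^+ 2 + t ^+ 2.
  transitivity ((c ^+ 2 + d ^+ 2) * (s ^+ 2 + t ^+ 2)); first by ring.
  by rewrite cd mul1r.
rewrite !refl_rv2 ?E ?cd ?oner_neq0 // ?expr0n ?expr1n /= ?addr0 ?oner_neq0 //.
rewrite -!scalemxAl -!scalemxAr !scalerA -scalemxAl !mx2_mul invr1 !mul1r scalerA ?mul1r.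
congr (_ *: mx2 _ _ _ _); ring.
Qed.

End Plane.

(** * Averages of determinants invariant under reflections *)

Section Average.
Variable R : rcfType.
Variables (n : nat) (x : R) (I : finType) (A : pred I) (g : I -> 'M[R]_n) (K : 'M[R]_n).
Hypothesis g_orth : forall i, A i -> g i *m (g i)^T = 1%:M.

Definition orbit_sum (B : 'M[R]_n) : R := \sum_(i | A i) \det (x%:M + K *m (g i *m B *m (g i)^T)).

Definition reflect_inv (w : 'rV[R]_n) : Prop :=
  forall B, orbit_sum (refl w *m B *m refl w) = orbit_sum B.

Lemma orth_tr i : A i -> (g i)^T *m g i = 1%:M.
Proof. by move=> Ai; apply: mulmx1C; apply: g_orth. Qed.

Lemma orbit_sumE B : orbit_sum B = \sum_(i | A i) \det (x%:M + (g i)^T *m K *m g i *m B).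
Proof.
apply: eq_bigr => i Ai.
have dd : \det ((g i)^T) * \det (g i) = 1 by rewrite -det_mulmx orth_tr ?det1.
rewrite -[LHS]mul1r -dd mulrAC -!det_mulmx; congr (\det _).
rewrite mulmxDr mulmxDl mul_mx_scalar -scalemxAl orth_tr // scalemx1; congr (_ + _).
by rewrite -!mulmxA orth_tr // mulmx1.
Qed.

(** Multiplication by [refl w], which has determinant [-1], turns the conjugation into a perturbation of
[M] of rank two. Cleared of denominators, the expansion is homogeneous of degree [4] in [w]. *)
Lemma det_refl_conj (L B : 'M[R]_n) w : w != 0 -> let M := x%:M + L *m B in
  dot w w ^+ 2 * \det (x%:M + L *m (refl w *m B *m refl w)) =
  - (dot w w * dot w w * \det M
     - 2 * dot w w * (bord M (x *: w^T) w + bord M (L *m w^T) (w *m B))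
     + 4 * bord2 M (x *: w^T) w (L *m w^T) (w *m B)).
Proof.
move=> w0 M; have d0 : dot w w != 0 by rewrite dot_eq0.
set k := 2 / dot w w.
have E : (x%:M + L *m (refl w *m B *m refl w)) *m refl w
   = M + ((- k) *: (x *: w^T)) *m w + ((- k) *: (L *m w^T)) *m (w *m B).
  rewrite mulmxDl mul_scalar_mx -!mulmxA refl_sq mulmx1.
  rewrite {1}/refl -/k scalerBr scalemx1 /M.
  rewrite [refl w *m B]mulmxBl mul1mx mulmxBr -/k.
  rewrite -!scalemxAl -!scalemxAr !scaleNr !scalerA [x * k]mulrC /gram -!scalerA !mulmxA.
  by rewrite addrACA -!addrA.
have : \det (x%:M + L *m (refl w *m B *m refl w)) =
    - \det (M + ((- k) *: (x *: w^T)) *m w + ((- k) *: (L *m w^T)) *m (w *m B)).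
  by rewrite -E det_mulmx det_refl // mulrN1 opprK.
have b1 c r : bord M (- k *: c) r = - k * bord M c r.
  by rewrite -[_ *: c]addr0 -(scale0r 0) bord_linl mul0r addr0.
have b2 c r c' r' : bord2 M (- k *: c) r c' r' = - k * bord2 M c r c' r'.
  by rewrite -[_ *: c]addr0 -(scale0r 0) bord2_lin1 mul0r addr0.
rewrite det_add_rank2 !b1 b2 bord2C b2 bord2C => ->.
by rewrite /k; field; exact: d0.
Qed.

Lemma quadrilinear_orbit B : exists2 m, quadrilinear m &
  forall w, w != 0 -> dot w w ^+ 2 * orbit_sum (refl w *m B *m refl w) = m w w w w.
Proof.
pose L i := (g i)^T *m K *m g i; pose M i := x%:M + L i *m B.
pose m (u v y z : 'rV[R]_n) := \sum_(i | A i)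
  - (dot u v * dot y z * \det (M i)
     - 2 * dot u v * (bord (M i) (x *: y^T) z + bord (M i) (L i *m y^T) (z *m B))
     + 4 * bord2 (M i) (x *: u^T) v (L i *m y^T) (z *m B)).
exists m; last first.
  move=> w w0; rewrite orbit_sumE mulr_sumr; apply: eq_bigr => i _.
  exact: det_refl_conj.
have trl a b (u v : 'rV[R]_n) : (a *: u + b *: v)^T = a *: u^T + b *: v^T.
  by rewrite linearP linearZ.
have mL i a b (u v : 'rV[R]_n) : L i *m (a *: u^T + b *: v^T) = a *: (L i *m u^T) + b *: (L i *m v^T).
  by rewrite mulmxDr -!scalemxAr.
have mx0 a b (u v : 'rV[R]_n) : x *: (a *: u^T + b *: v^T) = a *: (x *: u^T) + b *: (x *: v^T).
  by rewrite scalerDr !scalerA mulrC [x * b]mulrC.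
have mB a b (u v : 'rV[R]_n) : (a *: u + b *: v) *m B = a *: (u *m B) + b *: (v *m B).
  by rewrite mulmxDl -!scalemxAl.
split=> a b u v y z t; rewrite /m !mulr_sumr -big_split /=; apply: eq_bigr => i _.
- rewrite dot_linl trl mx0 bord2_lin1; ring.
- rewrite dot_linr bord2_lin2; ring.
- rewrite dot_linl trl mx0 mL !bord_linl ![bord2 _ _ _ (_ + _) _]bord2C bord2_lin1.
  rewrite ![bord2 _ (L i *m _) _ _ _]bord2C; ring.
- rewrite dot_linr mB !bord_linr bord2C bord2_lin2.
  rewrite ![bord2 _ (L i *m _) _ _ _]bord2C; ring.
Qed.

Lemma reflect_invZ a w : reflect_inv w -> reflect_inv (a *: w).
Proof.
have [->|a0] := eqVneq a 0; last by move=> h B; rewrite reflZ.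
by move=> _ B; rewrite scale0r refl0 mul1mx mulmx1.
Qed.

(** Composing a reflection of the plane with those in [p] and [c *: p + d *: q] rotates its
vector by a fixed angle. The quartic form of [quadrilinear_orbit] is invariant under
this rotation, hence constant on the unit circle of the plane, where its value at [p] is the orbit
sum itself. *)
Lemma reflect_inv_orthonormal p q c d : dot p p = 1 -> dot q q = 1 -> dot p q = 0 ->
  c ^+ 2 + d ^+ 2 = 1 -> c != 0 -> d != 0 ->
  reflect_inv p -> reflect_inv (c *: p + d *: q) ->
  forall s t, reflect_inv (s *: p + t *: q).
Proof.
move=> pp qq pq cd c0 d0 ip iv s t B.
pose T : 'M[R]_(2, n) := \matrix_(i, j) if i == 0 then p 0 j else q 0 j.
have rT s' t' : rv2 s' t' *m T = s' *: p + t' *: q.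
  by apply/rowP => j; rewrite !mxE !big_ord_recl big_ord0 !mxE /= addr0.
have TT : T *m T^T = 1%:M.
  have qp : dot q p = 0 by rewrite dotC.
  move: pp qq pq qp; rewrite !dotE => pp qq pq qp.
  apply/matrixP => i j; rewrite [RHS]mxE [LHS]mxE.
  under eq_bigr do rewrite !mxE.
  case: (unliftP 0 i) => [i'|] ->; case: (unliftP 0 j) => [j'|] ->;
    by rewrite ?[i']ord1 ?[j']ord1 /=.
have [m ml mE] := quadrilinear_orbit B.
have [a0 [a1 [a2 [a3 [a4 fE]]]]] := quadrilinear_form p q ml.
pose f s t := a0 * s ^+ 4 + a1 * s ^+ 3 * t + a2 * s ^+ 2 * t ^+ 2
     + a3 * s * t ^+ 3 + a4 * t ^+ 4.
have dE s' t' : dot (s' *: p + t' *: q) (s' *: p + t' *: q) = s' ^+ 2 + t' ^+ 2.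
  by rewrite -rT dot_mul_frame // dot_rv2 -!expr2.
have fO s' t' r : s' ^+ 2 + t' ^+ 2 = r -> r != 0 -> f s' t' = r ^+ 2 *
    orbit_sum (refl (s' *: p + t' *: q) *m B *m refl (s' *: p + t' *: q)).
  move=> sr r0; rewrite /f -fE -mE; last by rewrite -dot_eq0 dE sr.
  by rewrite dE sr.
have inv s' t' : f (c * s' + d * t') (c * t' - d * s') = f s' t'.
  have [st0|st] := eqVneq (s' ^+ 2 + t' ^+ 2) 0.
    move/eqP: st0; rewrite paddr_eq0 ?sqr_ge0 // !sqrf_eq0 => /andP[/eqP-> /eqP->].
    by rewrite !mulr0 addr0 subr0.
  have E : (c * s' + d * t') ^+ 2 + (c * t' - d * s') ^+ 2 = s' ^+ 2 + t' ^+ 2.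
    transitivity ((c ^+ 2 + d ^+ 2) * (s' ^+ 2 + t' ^+ 2)); first by ring.
    by rewrite cd mul1r.
  apply: etrans (fO _ _ _ E st) (etrans _ (esym (fO _ _ _ erefl st))).
  apply: congr1.
  have h : refl ((c * s' + d * t') *: p + (c * t' - d * s') *: q) =
      refl p *m refl (c *: p + d *: q) *m refl (s' *: p + t' *: q).
    have rp : refl p = refl (rv2 1 0 *m T) by rewrite rT scale1r scale0r addr0.
    by rewrite rp -!rT !refl_frame // !frame_mul // refl_rv2_mul3.
  (* A reflection is symmetric, so the three factors can also be composed in the opposite order. *)
  have h' : refl ((c * s' + d * t') *: p + (c * t' - d * s') *: q) =
      refl (s' *: p + t' *: q) *m refl (c *: p + d *: q) *m refl p.
    by rewrite -tr_refl h !trmx_mul !tr_refl mulmxA.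
  rewrite {1}h h'; rewrite -!mulmxA; set r := refl (s' *: p + _).
  rewrite (mulmxA r) (mulmxA (refl (c *: p + d *: q)) (r *m B)).
  have := ip (refl (c *: p + d *: q) *m (r *m B *m r) *m refl (c *: p + d *: q)).
  rewrite iv !mulmxA => <-; congr orbit_sum; rewrite !mulmxA; reflexivity.
have f0 : forall s' t', f s' t' = a0 * (s' ^+ 2 + t' ^+ 2) ^+ 2 :=
  rotation_invariant_quartic cd c0 d0 inv.
have Bp : orbit_sum B = a0.
  have e1 : 1 ^+ 2 + 0 ^+ 2 = 1 :> R by rewrite expr1n expr0n addr0.
  have := fO 1 0 1 e1 (oner_neq0 _); rewrite f0 e1 expr1n mulr1 mul1r => ->.
  by rewrite scale1r scale0r addr0 ip.
have [st0|st] := eqVneq (s ^+ 2 + t ^+ 2) 0.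
  move/eqP: st0; rewrite paddr_eq0 ?sqr_ge0 // !sqrf_eq0 => /andP[/eqP-> /eqP->].
  by rewrite !scale0r addr0 refl0 mul1mx mulmx1.
have := fO s t _ erefl st; rewrite f0 Bp mulrC => h.
by apply/esym/(mulfI (expf_neq0 2 st)).
Qed.

(** By the Gram-Schmidt process this is the orthonormal case; reflections in parallel vectors
are equal. *)
Lemma reflect_inv_plane u v s t : reflect_inv u -> reflect_inv v -> dot u v != 0 ->
  reflect_inv (s *: u + t *: v).
Proof.
move=> iu iv uv.
have u0 : u != 0 by apply: contraNneq uv => ->; rewrite /dot mul0mx mxE.
have v0 : v != 0 by apply: contraNneq uv => ->; rewrite dotC /dot mul0mx mxE.
have nrm (w : 'rV[R]_n) : w != 0 -> exists a p, [/\ a != 0, w = a *: p & dot p p = 1].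
  move=> w0; have dp : 0 < dot w w by rewrite lt_neqAle eq_sym dot_eq0 w0 dot_ge0.
  have sp : Num.sqrt (dot w w) != 0 by rewrite gt_eqF // sqrtr_gt0.
  exists (Num.sqrt (dot w w)), ((Num.sqrt (dot w w))^-1 *: w); split=> //.
    by rewrite scalerA mulfV // scale1r.
  rewrite /dot linearZ /= -scalemxAl -scalemxAr scalerA mxE -/(dot w w) -invfM -expr2.
  by rewrite sqr_sqrtr ?mulVf ?gt_eqF ?dot_ge0.
have [a [p [a0 uE pp]]] := nrm u u0.
have [b [e [b0 vE ee]]] := nrm v v0.
have dZ (k l : R) (w z : 'rV[R]_n) : dot (k *: w) (l *: z) = k * l * dot w z.
  by rewrite /dot linearZ /= -scalemxAl -scalemxAr scalerA mxE.
pose c := dot p e.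
have c0 : c != 0.
  by apply: contraNneq uv => h; rewrite uE vE dZ -/c h mulr0.
pose y := e - c *: p.
have yE : e = c *: p + y by rewrite addrC subrK.
have py : dot p y = 0.
  have -> : y = 1 *: e + (- c) *: p by rewrite scale1r scaleNr.
  by rewrite dot_linr pp -/c; ring.
have yy : dot y y = 1 - c ^+ 2.
  have {2}-> : y = 1 *: e + (- c) *: p by rewrite scale1r scaleNr.
  rewrite dot_linr (dotC y p) py mulr0 addr0 mul1r.
  have -> : y = 1 *: e + (- c) *: p by rewrite scale1r scaleNr.
  by rewrite dot_linl ee -/c; ring.
have [y0|y0] := eqVneq y 0.
  rewrite vE yE y0 addr0 uE !scalerA -scalerDl.
  have -> : p = a^-1 *: u by rewrite uE scalerA mulVf // scale1r.
  by rewrite scalerA; apply: reflect_invZ.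
have [d [q [d0 qE qq]]] := nrm y y0.
have pq : dot p q = 0.
  have /eqP : d * dot p q = 0.
    by rewrite -[RHS]py qE -[p in RHS]scale1r dZ mul1r.
  by rewrite mulf_eq0 (negbTE d0) => /eqP.
have cd : c ^+ 2 + d ^+ 2 = 1.
  by move: yy; rewrite qE dZ qq mulr1 -expr2 => ->; ring.
have ip : reflect_inv p.
  have -> : p = a^-1 *: u by rewrite uE scalerA mulVf // scale1r.
  exact: reflect_invZ.
have ie : reflect_inv (c *: p + d *: q).
  have -> : c *: p + d *: q = b^-1 *: v.
    by rewrite -qE -yE vE scalerA mulVf // scale1r.
  exact: reflect_invZ.
have -> : s *: u + t *: v = (s * a + t * b * c) *: p + (t * b * d) *: q.
  by rewrite uE vE yE qE !scalerDr !scalerA addrA -scalerDl.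
exact: (reflect_inv_orthonormal pp qq pq cd).
Qed.

(** The vectors are added one at a time with the help of the plane lemma. If the sum [u] so far
happens to be orthogonal to the new vector [w], a multiple of one of the vectors [z] of the sum
is moved to the other side, [u + y w = (u + e z) + (y w - e z)], with [e] chosen so as to destroy
the orthogonality. *)
Lemma reflect_inv_span (J : eqType) (r : seq J) (b : J -> 'rV[R]_n) (y : J -> R) :
  uniq r -> {in r, forall j, reflect_inv (b j)} ->
  {in r &, forall j k, dot (b j) (b k) != 0} ->
  reflect_inv (\sum_(j <- r) y j *: b j).
Proof.
elim: r y => [|j r IH] y /=.
  by move=> _ _ _ B; rewrite big_nil refl0 mul1mx mulmx1.
move=> /andP[jr ur] hb hd; rewrite big_cons.
have hb' : {in r, forall j, reflect_inv (b j)}.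
  by move=> k kr; apply: hb; rewrite inE kr orbT.
have hd' : {in r &, forall j k, dot (b j) (b k) != 0}.
  by move=> k l kr lr; apply: hd; rewrite inE ?kr ?lr orbT.
have IH' z : reflect_inv (\sum_(k <- r) z k *: b k) by apply: IH.
case: r jr ur hb hd hb' hd' IH IH' => [|k r] jr ur hb hd hb' hd' _ IH.
  by rewrite big_nil addr0; apply: reflect_invZ; apply: hb; rewrite mem_head.
set u := \sum_(l <- _) _; set w := b j.
have iw : reflect_inv w by apply: hb; rewrite mem_head.
have iu : reflect_inv u by apply: IH.
have [uw0|uw] := eqVneq (dot u w) 0; last first.
  by rewrite addrC -[u]scale1r; apply: reflect_inv_plane.
set z := b k.
have iz : reflect_inv z by apply: hb'; rewrite mem_head.
have zw : dot z w != 0 by apply: hd; rewrite !inE eqxx ?orbT.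
have zz : dot z z != 0 by apply: hd'; rewrite mem_head.
have [->|yj] := eqVneq (y j) 0; first by rewrite scale0r add0r.
have ie (e : R) : reflect_inv (u + e *: z).
  have -> : u + e *: z = \sum_(l <- k :: r) (y l + (l == k)%:R * e) *: b l.
    rewrite /u !big_cons eqxx mul1r scalerDl -!addrA; congr (_ + _).
    rewrite addrC; congr (_ + _); apply: eq_big_seq => l lr.
    case: eqVneq => [lk|_]; last by rewrite mul0r addr0.
    by move: ur => /= /andP[]; rewrite -lk lr.
  exact: IH.
(* The excluded values of [e] are [0] and one more, so [1] or [2] will do. *)
have [e en0 hen] : exists2 e : R, e != 0 & - dot u z + y j * dot z w - e * dot z z != 0.
  have [h1|h1] := eqVneq (- dot u z + y j * dot z w - 1 * dot z z) 0; last first.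
    by exists 1; rewrite ?oner_neq0.
  exists 2; first by rewrite pnatr_eq0.
  apply: contraNneq zz => h2.
  by apply/eqP; move: h1 h2; move: (dot z z) (dot u z) (y j * _) => *; lra.
have -> : y j *: w + u = 1 *: (u + e *: z) + 1 *: (y j *: w + (- e) *: z).
  by rewrite !scale1r scaleNr addrACA subrr addr0 addrC.
apply: reflect_inv_plane; first exact: ie.
  by apply: reflect_inv_plane iw iz _; rewrite dotC.
have -> : u + e *: z = 1 *: u + e *: z by rewrite scale1r.
rewrite dot_linl !dot_linr uw0 mulr0 add0r mul1r.
have -> : - e * dot u z + e * (y j * dot z w + - e * dot z z) =
   e * (- dot u z + y j * dot z w - e * dot z z) by ring.
by rewrite mulf_neq0.
Qed.

End Average.

Lemma det_scalar_addC (R : rcfType) n (x : R) (A B : 'M[R]_n) : x != 0 ->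
  \det (x%:M + A *m B) = \det (x%:M + B *m A).
Proof.
move=> x0; have E (P Q : 'M[R]_n) : x%:M + P *m Q = x *: (1%:M + (x^-1 *: P) *m Q).
  by rewrite scalerDr scalemx1 -scalemxAl scalerA mulfV // scale1r.
by rewrite !E !detZ det_mulC_add -scalemxAl -scalemxAr.
Qed.

Section TwoGroups.
Variables (R : rcfType) (n : nat) (x : R) (I1 I2 : finType) (A1 : pred I1) (A2 : pred I2).
Variables (g1 : I1 -> 'M[R]_n) (g2 : I2 -> 'M[R]_n).
Hypothesis x0 : x != 0.
Hypothesis o1 : forall i, A1 i -> g1 i *m (g1 i)^T = 1%:M.
Hypothesis o2 : forall i, A2 i -> g2 i *m (g2 i)^T = 1%:M.
Hypothesis V2 : forall f : 'M[R]_n -> R, \sum_(i | A2 i) f (g2 i)^T = \sum_(i | A2 i) f (g2 i).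
Hypothesis inv12 : forall K B i, A2 i ->
  orbit_sum x A1 g1 K (g2 i *m B *m (g2 i)^T) = orbit_sum x A1 g1 K B.
Hypothesis inv21 : forall K B i, A1 i ->
  orbit_sum x A2 g2 K (g1 i *m B *m (g1 i)^T) = orbit_sum x A2 g2 K B.

Lemma orbit_sum_swap (J : finType) (A : pred J) (g : J -> 'M[R]_n) K B :
  (forall i, A i -> g i *m (g i)^T = 1%:M) ->
  (forall f : 'M[R]_n -> R, \sum_(i | A i) f (g i)^T = \sum_(i | A i) f (g i)) ->
  orbit_sum x A g K B = orbit_sum x A g B K.
Proof.
move=> o V; rewrite orbit_sumE // -[RHS](V (fun G => \det (x%:M + B *m (G *m K *m G^T)))).
by apply: eq_bigr => i _; rewrite trmxK det_scalar_addC.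
Qed.

(** Both sides are the sum over the pairs of elements of the two groups: each of the orbit sums can
absorb the other group, and the roles of [K] and [B] are exchanged by
transposition. *)
Lemma orbit_avg_eq K B :
  #|A2|%:R * orbit_sum x A1 g1 K B = #|A1|%:R * orbit_sum x A2 g2 K B.
Proof.
have -> : #|A2|%:R * orbit_sum x A1 g1 K B =
    \sum_(j | A2 j) \sum_(i | A1 i) \det (x%:M + ((g1 i)^T *m K *m g1 i) *m (g2 j *m B *m (g2 j)^T)).
  rewrite mulr_natl -sumr_const; apply: eq_bigr => j Aj.
  by rewrite -(inv12 K B Aj) orbit_sumE.
rewrite exchange_big /= mulr_natl -sumr_const; apply: eq_bigr => i Ai.
rewrite -/(orbit_sum x A2 g2 _ _) orbit_sum_swap // -(inv21 _ _ Ai) !mulmxA o1 // mul1mx.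
by rewrite -!mulmxA o1 // mulmx1 orbit_sum_swap.
Qed.

End TwoGroups.

(** * Permutation and sign matrices as reflections *)

Section PermRefl.
Variable R : rcfType.

Definition e_ n (i : 'I_n) : 'rV[R]_n := delta_mx 0 i.

Lemma relabel_perm_mx n (s : 'S_n) (X : 'M[R]_n) : relabel s X = perm_mx s *m X *m (perm_mx s)^T.
Proof.
rewrite tr_perm_mx -row_permE -col_permE.
by apply/matrixP => i j; rewrite !mxE.
Qed.

Lemma dot_e n (i j : 'I_n) : dot (e_ i) (e_ j) = (i == j)%:R.
Proof.
rewrite dotE (bigD1 i) //= big1 => [|k ki]; last by rewrite !mxE (negbTE ki) andbF mul0r.
by rewrite !mxE !eqxx mul1r addr0.
Qed.

Lemma dotBl n (u v w : 'rV[R]_n) : dot (u - v) w = dot u w - dot v w.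
Proof. by rewrite /dot mulmxBl !mxE. Qed.
Lemma dotBr n (u v w : 'rV[R]_n) : dot w (u - v) = dot w u - dot w v.
Proof. by rewrite !(dotC w) dotBl. Qed.

Lemma perm_mx_tperm n (i k : 'I_n) :
  perm_mx (tperm i k) = 1%:M - gram (e_ i - e_ k) :> 'M[R]_n.
Proof.
apply/matrixP => a b; rewrite [RHS]mxE [in X in _ + X]mxE gramE !mxE /=.
case: tpermP => [->|->|/eqP/negbTE ai /eqP/negbTE ak].
- have [->|ik] := eqVneq i k; first by rewrite ?eqxx (eq_sym k b) /=; ring.
  by rewrite eqxx subr0 mul1r (eq_sym i b) (eq_sym k b); ring.
- have [->|ik] := eqVneq i k; first by rewrite ?eqxx (eq_sym k b) /=; ring.
  by rewrite eqxx (eq_sym i b) (eq_sym k b) /=; ring.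
- by rewrite ai ak subrr mul0r subr0.
Qed.

Lemma refl_tperm n (i k : 'I_n) : i != k -> refl (e_ i - e_ k) = perm_mx (tperm i k).
Proof.
move=> ik; rewrite perm_mx_tperm /refl dotBl !dotBr !dot_e !eqxx (eq_sym k i) (negbTE ik).
by rewrite subr0 sub0r opprK divff ?scale1r // pnatr_eq0.
Qed.

Definition signs n (eps : {ffun 'I_n -> bool}) : 'M[R]_n :=
  diag_mx (\row_i (-1) ^+ eps i).

Lemma signsE n (eps : {ffun 'I_n -> bool}) i j : signs eps i j = (i == j)%:R * (-1) ^+ eps i.
Proof. by rewrite !mxE; case: eqVneq => [->|]; rewrite ?mulr1n ?mul1r ?mulr0n ?mul0r. Qed.

Lemma tr_signs n (eps : {ffun 'I_n -> bool}) : (signs eps)^T = signs eps.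
Proof. exact: tr_diag_mx. Qed.

Lemma signsM n (eps eta : {ffun 'I_n -> bool}) :
  signs eps *m signs eta = signs [ffun i => eps i (+) eta i].
Proof.
rewrite /signs mulmx_diag; congr diag_mx; apply/rowP => i.
by rewrite !mxE ffunE signr_addb.
Qed.

Lemma signs0 n : signs [ffun=> false] = 1%:M :> 'M[R]_n.
Proof. by apply/matrixP => i j; rewrite signsE ffunE expr0 mulr1 mxE. Qed.

Lemma signs_sq n (eps : {ffun 'I_n -> bool}) : signs eps *m signs eps = 1%:M.
Proof. by rewrite signsM -signs0; congr signs; apply/ffunP => i; rewrite !ffunE addbb. Qed.

Lemma refl_e n (i : 'I_n) : refl (e_ i) = signs [ffun j => j == i].
Proof.
apply/matrixP => a b; rewrite signsE ffunE /refl dot_e eqxx divr1 [LHS]mxE.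
rewrite [in X in _ + X]mxE [in X in _ - X]mxE gramE !mxE /=.
have [->|ai] := eqVneq a i; last by rewrite mul0r mulr0 subr0 mulr1.
by rewrite (eq_sym i b); case: (b == i); rewrite /=; ring.
Qed.

Lemma perm_mx_signs n (s : 'S_n) (eps : {ffun 'I_n -> bool}) :
  perm_mx s *m signs eps = signs [ffun i => eps (s i)] *m perm_mx s.
Proof.
apply/matrixP => i j; rewrite /signs mul_mx_diag mul_diag_mx !mxE ffunE mulrC.
by case: eqVneq => [->|]; rewrite ?mulr0.
Qed.

Lemma perm_mx_orth n (s : 'S_n) : perm_mx s *m (perm_mx s)^T = 1%:M :> 'M[R]_n.
Proof. by rewrite tr_perm_mx -perm_mxM mulgV perm_mx1. Qed.

End PermRefl.

Lemma conj_mulmx (R : rcfType) n (P Q C : 'M[R]_n) :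
  (P *m Q) *m C *m (P *m Q)^T = P *m (Q *m C *m Q^T) *m P^T.
Proof. by rewrite trmx_mul !mulmxA. Qed.

(** * The symmetric group and the signed permutations have the same averages *)

Section Frame.
Variables (R : rcfType) (J : eqType) (n N : nat) (sn : 'I_n -> J) (sN : 'I_N -> J).
Variable F : 'M[R]_(n, N).
Hypothesis FF : F *m F^T = 1%:M.
Hypothesis Fs : forall i b, sn i != sN b -> F i b = 0.
Hypothesis F1 : forall i, \sum_b F i b = 0.
Hypothesis Fd : forall b c, sN b = sN c ->
  (e_ R b - e_ R c) *m (F^T *m F) = e_ R b - e_ R c.

(** The rows of [F] are an orthonormal basis of the vectors with sum zero at each site; [std] is the
action of the permutations on these vectors, in coordinates. *)
Definition std (s : 'S_N) : 'M[R]_n := F *m perm_mx s *m F^T.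
Let E := F^T *m F.

Lemma frame_comm s : s \in fixing sN N -> perm_mx s *m E = E *m perm_mx s.
Proof.
move: s; apply: fixing_ind => [|s b c bc sE]; first by rewrite perm_mx1 mul1mx mulmx1.
rewrite perm_mxM -mulmxA; have -> : perm_mx (tperm b c) *m E = E *m perm_mx (tperm b c).
  have ET : E^T = E by rewrite /E trmx_mul trmxK.
  rewrite perm_mx_tperm mulmxBl mulmxBr mul1mx mulmx1; congr (_ - _).
  rewrite /gram -mulmxA Fd // mulmxA; congr (_ *m _).
  by rewrite -[E]ET -trmx_mul Fd.
by rewrite mulmxA sE mulmxA.
Qed.

Lemma FE : F *m E = F. Proof. by rewrite /E mulmxA FF mul1mx. Qed.

Lemma stdM s t : s \in fixing sN N -> std s *m std t = std (s * t)%g.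
Proof.
move=> sf; rewrite /std perm_mxM !mulmxA; congr (_ *m _ *m _).
by rewrite -(mulmxA _ F^T) -/E -mulmxA frame_comm // mulmxA FE.
Qed.

Lemma std1 : std 1%g = 1%:M.
Proof. by rewrite /std perm_mx1 mulmx1 FF. Qed.

Lemma tr_std s : (std s)^T = std (s^-1)%g.
Proof. by rewrite /std !trmx_mul trmxK tr_perm_mx mulmxA. Qed.

Lemma std_orth s : s \in fixing sN N -> std s *m (std s)^T = 1%:M.
Proof. by move=> sf; rewrite tr_std stdM // mulgV std1. Qed.

(** The coordinates of the root [e_ b - e_ c] of the symmetric group. *)
Definition root_ b c : 'rV[R]_n := (e_ R b - e_ R c) *m F^T.

Lemma dot_root b c b' c' : sN b = sN c ->
  dot (root_ b c) (root_ b' c') = dot (e_ R b - e_ R c) (e_ R b' - e_ R c').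
Proof.
by move=> bc; rewrite /dot /root_ trmx_mul trmxK mulmxA -(mulmxA _ F^T) Fd.
Qed.

Lemma std_tperm b c : sN b = sN c -> std (tperm b c) = refl (root_ b c).
Proof.
move=> bc; have [->|bnc] := eqVneq b c.
  by rewrite tperm1 std1 /root_ subrr mul0mx refl0.
rewrite /refl dot_root // /std perm_mx_tperm mulmxBr mulmx1 mulmxBl FF; congr (_ - _).
rewrite dotBl !dotBr !dot_e !eqxx (eq_sym c b) (negbTE bnc) subr0 sub0r opprK.
by rewrite divff ?scale1r ?pnatr_eq0 // /gram /root_ trmx_mul trmxK !mulmxA.
Qed.

(** At one site, the roots with a common second index [b0] generate all vectors of sum zero, and their
inner products with each other are [1] or [2], hence not zero. *)
Lemma supported_root_sum (v : 'rV[R]_n) b0 : (forall i, sn i != sN b0 -> v 0 i = 0) ->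
  v = \sum_(b <- [seq b <- enum 'I_N | (b != b0) && (sN b == sN b0)])
        (v *m F) 0 b *: root_ b b0.
Proof.
move=> vs.
have vF b : sN b != sN b0 -> (v *m F) 0 b = 0.
  move=> bb; rewrite mxE big1 // => i _.
  have [ib|ib] := eqVneq (sn i) (sN b); last by rewrite Fs // mulr0.
  by rewrite vs ?mul0r // ib.
have sum0 : \sum_b (v *m F) 0 b = 0.
  under eq_bigr do rewrite mxE.
  rewrite exchange_big big1 //= => i _.
  by rewrite -mulr_sumr F1 mulr0.
rewrite big_filter big_enum_cond /=.
have -> : \sum_(b | (b != b0) && (sN b == sN b0)) (v *m F) 0 b *: root_ b b0 =
    \sum_b (v *m F) 0 b *: root_ b b0.
  rewrite [RHS](bigID (fun b => (b != b0) && (sN b == sN b0))) /=.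
  rewrite [X in _ = _ + X]big1 ?addr0 // => b; rewrite negb_and negbK => /orP[/eqP->|/vF->].
    by rewrite /root_ subrr mul0mx scaler0.
  by rewrite scale0r.
have -> : \sum_b (v *m F) 0 b *: root_ b b0 =
   (\sum_b (v *m F) 0 b *: e_ R b - (\sum_b (v *m F) 0 b) *: e_ R b0) *m F^T.
  rewrite scaler_suml -sumrB mulmx_suml; apply: eq_bigr => b _.
  by rewrite -scalerBr -scalemxAl.
by rewrite sum0 scale0r subr0 -row_sum_delta -mulmxA FF mulmx1.
Qed.

Variables (x : R) (x0 : x != 0).
Notation psiS := (@orbit_sum R n x _ [pred s : 'S_N | s \in fixing sN N] std).

Lemma sum_fixing_mulr (s : 'S_N) (f : 'S_N -> R) : s \in fixing sN N ->
  \sum_(t in fixing sN N) f (t * s)%g = \sum_(t in fixing sN N) f t.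
Proof.
move=> sf; rewrite [RHS](reindex_inj (mulIg s)) /=; apply: eq_bigl => t.
apply/idP/idP => tf; first by rewrite fixingM.
by rewrite -(mulgK s t) fixingM ?fixingV.
Qed.

Lemma psiS_std K B s : s \in fixing sN N -> psiS K (std s *m B *m (std s)^T) = psiS K B.
Proof.
move=> sf; rewrite /orbit_sum -[RHS](sum_fixing_mulr _ sf); apply: eq_bigr => t tf.
by rewrite -stdM // (conj_mulmx (std t)).
Qed.

Lemma psiS_root K b c : sN b = sN c ->
  reflect_inv x [pred s : 'S_N | s \in fixing sN N] std K (root_ b c).
Proof.
move=> bc B; rewrite -[in X in _ *m X](tr_refl (root_ b c)) -std_tperm //.
by apply: psiS_std; apply: tperm_fixing => //; apply: ltn_ord.
Qed.

(** The reflections in the roots are transpositions, which only permute the terms of the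
average; [reflect_inv_span] passes from the roots to their span. *)
Lemma psiS_supported K b0 (v : 'rV[R]_n) : (forall i, sn i != sN b0 -> v 0 i = 0) ->
  reflect_inv x [pred s : 'S_N | s \in fixing sN N] std K v.
Proof.
move=> vs; rewrite (supported_root_sum vs); apply: reflect_inv_span.
- by move=> s; apply: std_orth.
- by rewrite filter_uniq ?enum_uniq.
- move=> b; rewrite mem_filter => /andP[/andP[_ /eqP bb] _]; exact: psiS_root.
move=> b c; rewrite !mem_filter => /andP[/andP[bn /eqP bb] _] /andP[/andP[cn /eqP cb] _].
rewrite dot_root // dotBl !dotBr !dot_e eqxx (negbTE bn) (eq_sym b0) (negbTE cn).
by rewrite subr0 sub0r opprK -natrD addn1 pnatr_eq0.
Qed.

Lemma psiS_perm K B t : (forall i, exists b, sN b = sn i) -> t \in fixing sn n ->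
  psiS K (perm_mx t *m B *m (perm_mx t)^T) = psiS K B.
Proof.
move=> Fx tf; move: t tf B; apply: fixing_ind => [B|t i k ik IH B].
  by rewrite perm_mx1 trmx1 mul1mx mulmx1.
have [<-|nik] := eqVneq i k; first by rewrite tperm1 mulg1.
have [b0 b0E] := Fx i.
rewrite perm_mxM conj_mulmx IH -refl_tperm // tr_refl.
apply: (@psiS_supported _ b0) => l lb; rewrite !mxE /=.
have -> : l == i = false by apply: contraNF lb => /eqP ->; rewrite b0E.
have -> : l == k = false by apply: contraNF lb => /eqP ->; rewrite b0E ik.
by rewrite subrr.
Qed.

Lemma psiS_signs K B eps : (forall i, exists b, sN b = sn i) ->
  psiS K (signs R eps *m B *m signs R eps) = psiS K B.
Proof.
move=> Fx; pose ep (r : seq 'I_n) := [ffun j => (j \in r) && eps j].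
have -> : eps = ep (enum 'I_n) by apply/ffunP => i; rewrite ffunE mem_enum.
elim: (enum 'I_n) (enum_uniq 'I_n) B => [_ B|i r IH /= /andP[ir ur] B].
  have -> : ep [::] = [ffun=> false] by apply/ffunP => i; rewrite !ffunE.
  by rewrite signs0 mul1mx mulmx1.
have [ei|ei] := boolP (eps i); last first.
  have -> : ep (i :: r) = ep r; last exact: IH.
  apply/ffunP => j; rewrite !ffunE inE; case: eqVneq => //= ->.
  by rewrite (negbTE ei) andbF.
have e1 : signs R (ep (i :: r)) = signs R (ep r) *m refl (e_ R i).
  rewrite refl_e signsM; congr signs; apply/ffunP => j; rewrite !ffunE inE.
  by case: eqVneq => [->|] /=; rewrite ?addbF // ei (negbTE ir).
rewrite -{2}tr_signs e1 conj_mulmx tr_refl tr_signs IH //.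
have [b0 b0E] := Fx i.
apply: (@psiS_supported _ b0) => l lb; rewrite !mxE /=.
by have -> : l == i = false by apply: contraNF lb => /eqP ->; rewrite b0E.
Qed.

Definition sgn_perm (p : 'S_n * {ffun 'I_n -> bool}) : 'M[R]_n := signs R p.2 *m perm_mx p.1.
Notation inB := [pred p : 'S_n * {ffun 'I_n -> bool} | p.1 \in fixing sn n].
Notation psiB := (@orbit_sum R n x _ inB sgn_perm).

Lemma sgn_perm_orth p : sgn_perm p *m (sgn_perm p)^T = 1%:M.
Proof.
rewrite /sgn_perm trmx_mul tr_signs mulmxA -(mulmxA _ (perm_mx _)) perm_mx_orth.
by rewrite mulmx1 signs_sq.
Qed.

Lemma tr_sgn_perm p : (sgn_perm p)^T = sgn_perm (p.1^-1, [ffun i => p.2 (p.1^-1 i)])%g.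
Proof. by rewrite /sgn_perm trmx_mul tr_signs tr_perm_mx /= perm_mx_signs. Qed.

Lemma sum_sgn_permV (f : 'M[R]_n -> R) :
  \sum_(p | inB p) f (sgn_perm p)^T = \sum_(p | inB p) f (sgn_perm p).
Proof.
pose h (p : 'S_n * {ffun 'I_n -> bool}) := (p.1^-1, [ffun i => p.2 (p.1^-1 i)])%g.
have hK : involutive h.
  move=> [s e]; rewrite /h /= invgK; congr (_, _); apply/ffunP => i.
  by rewrite !ffunE permK.
rewrite [RHS](reindex_inj (inv_inj hK)) /=; apply: eq_big => [p|p _].
  by rewrite /=; apply/idP/idP => h1; [apply: fixingV | rewrite -(invgK p.1); apply: fixingV].
by rewrite tr_sgn_perm.
Qed.

Lemma psiB_perm K B t : t \in fixing sn n ->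
  psiB K (perm_mx t *m B *m (perm_mx t)^T) = psiB K B.
Proof.
move=> tf; pose h (p : 'S_n * {ffun 'I_n -> bool}) := (p.1 * t, p.2)%g.
have hi : injective h by move=> [s e] [s' e'] [/mulIg -> ->].
rewrite /orbit_sum [RHS](reindex_inj hi) /=; apply: eq_big => [p|p _].
  rewrite /=; apply/idP/idP => pf; first by rewrite fixingM.
  by rewrite -(mulgK t p.1) fixingM ?fixingV.
have -> : sgn_perm (h p) = sgn_perm p *m perm_mx t.
  by rewrite /sgn_perm /= perm_mxM mulmxA.
by rewrite (conj_mulmx (sgn_perm p)).
Qed.

Lemma psiB_signs K B eta : psiB K (signs R eta *m B *m signs R eta) = psiB K B.
Proof.
pose h (p : 'S_n * {ffun 'I_n -> bool}) := (p.1, [ffun i => p.2 i (+) eta (p.1 i)]).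
have hK : involutive h.
  move=> [s e]; congr (_, _); apply/ffunP => i.
  by rewrite !ffunE /= -addbA addbb addbF.
rewrite /orbit_sum [RHS](reindex_inj (inv_inj hK)) /=; apply: eq_big => [p|p _] //.
have -> : sgn_perm (h p) = sgn_perm p *m signs R eta.
  rewrite /sgn_perm /= -mulmxA perm_mx_signs mulmxA signsM; congr (signs _ _ *m _).
  by apply/ffunP => i; rewrite !ffunE.
by rewrite (conj_mulmx (sgn_perm p)) tr_signs.
Qed.

(** At one site, the vectors [e_ i0] and [e_ i0 - e_ i] form a basis of the vectors
supported there. Their mutual inner products are not zero, and their reflections are signed permutations. *)
Lemma psiB_supported K j (v : 'rV[R]_n) : (forall i, sn i != j -> v 0 i = 0) ->
  reflect_inv x inB sgn_perm K v.
Proof.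
move=> vs; have [i0 i0E|no] := pickP (fun i => sn i == j); last first.
  have -> : v = 0 by apply/rowP => i; rewrite mxE vs ?no.
  by move=> B; rewrite refl0 mul1mx mulmx1.
pose b i := if i == i0 then e_ R i0 else e_ R i0 - e_ R i.
pose y i := if i == i0 then \sum_l v 0 l else - v 0 i.
have -> : v = \sum_(i <- [seq i <- enum 'I_n | sn i == j]) y i *: b i.
  rewrite big_filter big_enum_cond /= (bigD1 i0) //= {1}/y {1}/b eqxx.
  transitivity (\sum_(i | sn i == j) v 0 i *: e_ R i).
    rewrite [LHS]row_sum_delta (bigID (fun i => sn i == j)) /= [X in _ + X]big1 ?addr0 //.
    by move=> i ij; rewrite vs // scale0r.
  have -> : \sum_l v 0 l = \sum_(l | sn l == j) v 0 l.
    by rewrite (bigID (fun i => sn i == j)) /= [X in _ + X]big1 ?addr0.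
  rewrite (bigD1 i0) //= [in RHS](bigD1 i0) //= scalerDl -addrA; congr (_ + _).
  rewrite scaler_suml -big_split /=; apply: eq_bigr => i /andP[_ ii].
  by rewrite /y /b (negbTE ii) scaleNr scalerBr opprB addrCA subrr addr0.
apply: reflect_inv_span.
- by move=> p _; apply: sgn_perm_orth.
- by rewrite filter_uniq ?enum_uniq.
- move=> i; rewrite mem_filter /b => /andP[/eqP ij _]; case: eqVneq => [_|ii] B.
    by rewrite refl_e psiB_signs.
  rewrite -[in X in _ *m X](tr_refl (e_ R i0 - e_ R i)) refl_tperm 1?eq_sym //.
  apply: psiB_perm; apply: tperm_fixing; rewrite ?ltn_ord //.
  by rewrite ij (eqP i0E).
move=> i k _ _; rewrite /b.
case: (eqVneq i i0) => ii; case: (eqVneq k i0) => kk;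
  rewrite ?dotBl ?dotBr ?dot_e ?eqxx ?(negbTE ii) ?(negbTE kk) 1?(eq_sym i0 i) 1?(eq_sym i0 k)
    ?(negbTE ii) ?(negbTE kk) ?subr0 ?oner_neq0 // sub0r opprK.
by case: (i == k); rewrite ?addr0 ?oner_neq0 // -natrD pnatr_eq0.
Qed.

Lemma psiB_std K B s : s \in fixing sN N ->
  psiB K (std s *m B *m (std s)^T) = psiB K B.
Proof.
move=> sf; have [sf' H] : s \in fixing sN N /\ forall B, psiB K (std s *m B *m (std s)^T) = psiB K B.
  2: exact: H.
move: s sf; apply: fixing_ind => [|s b c bc [sf IH]].
  split; first exact: fixing1.
  by move=> C; rewrite std1 trmx1 mul1mx mulmx1.
have tf : tperm b c \in fixing sN N by apply: tperm_fixing; rewrite ?ltn_ord.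
split=> [|C]; first exact: fixingM.
rewrite -stdM // (conj_mulmx (std s)) IH std_tperm // tr_refl.
apply: (@psiB_supported _ (sN b)) => i ib.
rewrite /root_ mxE big1 // => l _; rewrite !mxE.
have [lb|lb] := eqVneq (sN l) (sN b).
  by rewrite Fs ?mulr0 // lb.
have -> : l == b = false by apply: contraNF lb => /eqP ->.
have -> : l == c = false by apply: contraNF lb => /eqP ->; rewrite bc.
by rewrite subrr mul0r.
Qed.

(** The permutations of the coordinates and the changes of sign, on the one hand, and the
transpositions in the standard representation, on the other hand, are all generated by reflections
in vectors supported at one site; so each of the two averages is invariant under the other group. *)
Theorem std_avg_eq_signed_avg K B : (forall i, exists b, sN b = sn i) ->
  #|inB|%:R * psiS K B = #|fixing sN N|%:R * psiB K B.
Proof.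
move=> Fx; rewrite (@orbit_avg_eq R n x _ _ _ inB std sgn_perm x0).
- by rewrite (_ : #|[pred s | s \in fixing sN N]| = #|fixing sN N|) // -cardE; apply: eq_card => s.
- by move=> s; apply: std_orth.
- by move=> p _; apply: sgn_perm_orth.
- exact: sum_sgn_permV.
- move=> {}K {}B p pf; rewrite /sgn_perm conj_mulmx tr_signs psiS_signs //.
  exact: psiS_perm.
- by move=> {}K {}B s sf; apply: psiB_std.
Qed.

End Frame.

(** * Principal minors and their expansions *)

Section TypeDet.
Variables (R : comNzRingType) (W : finType).
Implicit Types (F G : W -> W -> R) (u v : W).

(** Index types are kept abstract so that sets of rows and columns can be removed without
renumbering. *)
Definition mxF (S T : finType) (F : S -> T -> R) : 'M[R]_(#|S|, #|T|) :=
  \matrix_(i, j) F (enum_val i) (enum_val j).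

Definition detF F : R := \det (mxF F).

Lemma eq_detF F G : F =2 G -> detF F = detF G.
Proof. by move=> E; congr (\det _); apply/matrixP => i j; rewrite !mxE E. Qed.

Definition unit_row u : W -> R := fun w => (w == u)%:R.

Definition upd F v (g : W -> R) : W -> W -> R := fun a b => if a == v then g b else F a b.

Lemma detF_upd F v g :
  detF (upd F v g) = \sum_u g u * cofactor (mxF F) (enum_rank v) (enum_rank u).
Proof.
rewrite /detF (expand_det_row _ (enum_rank v)) (reindex (@enum_rank W)) /=; last first.
  by apply: onW_bij; apply: enum_rank_bij.
apply: eq_bigr => u _; rewrite !mxE !enum_rankK /upd eqxx; congr (_ * (_ * \det _)).
apply/matrixP => i j; rewrite !mxE.
by rewrite -(inj_eq enum_rank_inj) enum_valK eq_sym (negbTE (neq_lift _ _)).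
Qed.

Lemma detF_upd_unit F v u :
  detF (upd F v (unit_row u)) = cofactor (mxF F) (enum_rank v) (enum_rank u).
Proof.
rewrite detF_upd (bigD1 u) //= big1 => [|w wu].
  by rewrite /unit_row eqxx mul1r addr0.
by rewrite /unit_row (negbTE wu) mul0r.
Qed.

Lemma detF_expand F v : detF F = \sum_u F v u * detF (upd F v (unit_row u)).
Proof.
have E : F =2 upd F v (F v) by move=> a b; rewrite /upd; case: eqP => [->|].
rewrite {1}(eq_detF E) detF_upd; apply: eq_bigr => u _.
by rewrite detF_upd_unit.
Qed.

Lemma detF_dup F u v : u != v -> F u =1 F v -> detF F = 0.
Proof.
move=> uv E; apply: (@determinant_alternate _ _ _ (enum_rank u) (enum_rank v)).
  by rewrite (inj_eq enum_rank_inj).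
by move=> j; rewrite !mxE !enum_rankK E.
Qed.

Lemma detF_swap F u v g h : u != v ->
  detF (upd (upd F u g) v h) = - detF (upd (upd F u h) v g).
Proof.
move=> uv; set t := tperm (enum_rank u) (enum_rank v).
have ruv : enum_rank u != enum_rank v by rewrite (inj_eq enum_rank_inj).
have -> : detF (upd (upd F u g) v h) = \det (row_perm t (mxF (upd (upd F u h) v g))).
  congr (\det _); apply/matrixP => i j; rewrite !mxE /upd.
  rewrite /t; case: tpermP => [->|->|/eqP iu /eqP iv]; rewrite ?enum_rankK ?eqxx //.
  - by rewrite (negbTE uv).
  - by rewrite (negbTE uv).
  - have H w : (enum_val i == w) = (i == enum_rank w) by rewrite (can2_eq (@enum_valK _) (@enum_rankK _)).
    by rewrite !H (negbTE iu) (negbTE iv).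
by rewrite row_permE det_mulmx det_perm odd_tperm ruv expr1 mulN1r.
Qed.

Lemma detF_col_free F G r k : F r =1 unit_row k -> G r =1 unit_row k ->
  (forall a b, a != r -> b != k -> F a b = G a b) -> detF F = detF G.
Proof.
move=> Fr Gr FG.
have E (H : W -> W -> R) : H r =1 unit_row k -> H =2 upd H r (unit_row k).
  by move=> Hr a b; rewrite /upd; case: eqP => [->|].
rewrite (eq_detF (E F Fr)) (eq_detF (E G Gr)) !detF_upd_unit.
congr (_ * \det _); apply/matrixP => i j; rewrite !mxE.
by apply: FG; rewrite -(inj_eq enum_rank_inj) enum_valK eq_sym neq_lift.
Qed.

Variable Q : W -> W -> R.

(** With unit rows outside [S], the determinant is the principal minor of [S]. For [v] outside [S]
and [u] in [S], [minor1 S v u] is up to sign the minor with the rows of [S] and with the columns of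
[v |: S] other than [u]. *)
Definition keep (S : {set W}) : W -> W -> R := fun a => if a \in S then Q a else unit_row a.

Definition minor S : R := detF (keep S).
Definition minor1 S v u : R := detF (upd (keep S) v (unit_row u)).

Lemma minor1_diag (S : {set W}) v : v \notin S -> minor1 S v v = minor S.
Proof.
move=> vS; apply: eq_detF => a b; rewrite /upd; case: eqP => [->|] //.
by rewrite /keep (negbTE vS).
Qed.

Lemma minor1_out (S : {set W}) v u : u != v -> u \notin S -> minor1 S v u = 0.
Proof.
move=> uv uS; apply: (detF_dup uv) => b.
by rewrite /upd (negbTE uv) eqxx /keep (negbTE uS).
Qed.

Lemma minorU (S : {set W}) v : v \notin S -> minor (v |: S) = \sum_u Q v u * minor1 S v u.
Proof.
move=> vS; rewrite /minor (detF_expand _ v); apply: eq_bigr => u _.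
rewrite {1}/keep setU11; congr (_ * _); apply: eq_detF => a b.
by rewrite /upd /keep in_setU1; case: eqP.
Qed.

(** Expand along the row [u] of [Q]; the unit row at [w] so created is then exchanged with the unit
row [u] sitting at [v]. *)
Lemma minor1_rec (S : {set W}) v u : u \in S -> v \notin S ->
  minor1 S v u = - \sum_w Q u w * minor1 (S :\ u) v w.
Proof.
move=> uS vS; have uv : u != v by apply: contraNneq vS => <-.
rewrite /minor1 (detF_expand _ u) -sumrN; apply: eq_bigr => w _.
rewrite {1}/upd (negbTE uv) {1}/keep uS -mulrN; congr (_ * _).
transitivity (detF (upd (upd (keep (S :\ u)) v (unit_row u)) u (unit_row w))).
  apply: eq_detF => a b; rewrite /upd /keep !inE.
  by case: (eqVneq a u) => //=; case: (eqVneq a v).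
rewrite detF_swap 1?eq_sym //; congr (- _); apply: eq_detF => a b.
rewrite /upd; case: eqP => [->|] //; rewrite (negbTE uv).
by rewrite /keep !inE eqxx.
Qed.

End TypeDet.

(** * Averages over signs *)

Section SignAverage.
Variables (R : realFieldType) (W : finType) (c : nat) (Z : 'I_c -> rel W) (x : R).
Hypothesis Zirr : forall j, irreflexive (Z j).
Notation signing := {ffun 'I_c * W -> bool}.
Implicit Types (eps : signing) (S : {set W}) (u v w : W).

Definition sg eps j w : R := (-1) ^+ eps (j, w).

Definition signed_mx eps : W -> W -> R :=
  fun a b => x * (a == b)%:R - \sum_j sg eps j a * sg eps j b * (Z j a b)%:R.

Definition alpha S : R := \sum_eps minor (signed_mx eps) S.

(** By [kappa_diag] and [kappa_rec] this is the sum of [alpha (S :\: p)] over the simple paths [p] in the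
atom [j] which start at [u], run in [S] and stop before they reach [v], a vertex outside [S]. *)
Definition kappa j S u v : R :=
  \sum_eps sg eps j u * sg eps j v * minor1 (signed_mx eps) S v u.

Lemma sg_sq eps j w : sg eps j w * sg eps j w = 1.
Proof. by rewrite /sg -expr2 sqrr_sign. Qed.

Lemma kappa_diag j S v : v \notin S -> kappa j S v v = alpha S.
Proof. by move=> vS; apply: eq_bigr => eps _; rewrite sg_sq mul1r minor1_diag. Qed.

Lemma kappa_out j S u v : u != v -> u \notin S -> kappa j S u v = 0.
Proof.
move=> uv uS; rewrite /kappa big1 // => eps _.
by rewrite minor1_out // mulr0.
Qed.

Lemma alphaU S v : v \notin S ->
  alpha (v |: S) = x * alpha S - \sum_j \sum_(u | Z j v u) kappa j S u v.
Proof.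
move=> vS; rewrite /alpha; under eq_bigr do rewrite minorU //.
transitivity (\sum_eps (x * minor (signed_mx eps) S
   - \sum_j \sum_(u | Z j v u) sg eps j u * sg eps j v * minor1 (signed_mx eps) S v u)).
  apply: eq_bigr => eps _.
  transitivity (\sum_u (x * (v == u)%:R * minor1 (signed_mx eps) S v u
     - \sum_(j | Z j v u) sg eps j u * sg eps j v * minor1 (signed_mx eps) S v u)).
    apply: eq_bigr => u _; rewrite /signed_mx mulrBl; congr (_ - _).
    rewrite [RHS]big_mkcond mulr_suml; apply: eq_bigr => j _.
    by case: (Z j v u); rewrite ?mulr0 ?mul0r // mulr1 [sg eps j v * _]mulrC.
  rewrite sumrB; congr (_ - _).
    rewrite (bigD1 v) //= big1 ?addr0 => [|u uv].
      by rewrite eqxx mulr1 minor1_diag.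
    by rewrite eq_sym (negbTE uv) mulr0 mul0r.
  rewrite [RHS](eq_bigr (fun j => \sum_u if Z j v u then
     sg eps j u * sg eps j v * minor1 (signed_mx eps) S v u else 0)); last first.
    by move=> j _; rewrite big_mkcond.
  by rewrite exchange_big; apply: eq_bigr => u _; rewrite [LHS]big_mkcond.
rewrite sumrB -mulr_sumr; congr (_ - _).
by rewrite exchange_big /=; apply: eq_bigr => j _; rewrite exchange_big.
Qed.

Definition flip (p : 'I_c * W) eps : signing := [ffun q => eps q (+) (q == p)].

Lemma flipK p : involutive (flip p).
Proof. by move=> eps; apply/ffunP => q; rewrite !ffunE -addbA addbb addbF. Qed.

Lemma sg_flip p eps j w : sg (flip p eps) j w = if (j, w) == p then - sg eps j w else sg eps j w.
Proof.
rewrite /sg ffunE; case: eqP => _; last by rewrite addbF.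
by rewrite signr_addb expr1 mulrN1.
Qed.

Lemma sum_odd0 p (f : signing -> R) : (forall eps, f (flip p eps) = - f eps) ->
  \sum_eps f eps = 0.
Proof.
move=> fo; have E : \sum_eps f eps = - \sum_eps f eps.
  by rewrite {1}(reindex_inj (inv_inj (flipK p))) -sumrN; apply: eq_bigr => eps _.
by move: E; move: (\sum_eps f eps) => t; lra.
Qed.

Lemma signed_mx_flip i u eps a b : a != u -> b != u ->
  signed_mx (flip (i, u) eps) a b = signed_mx eps a b.
Proof.
move=> au bu; rewrite /signed_mx; congr (_ - _); apply: eq_bigr => j _.
by rewrite !sg_flip !xpair_eqE (negbTE au) (negbTE bu) !andbF.
Qed.

(** The row of [u] is a unit row, which wipes out the column of [u] as well, and with it all the
entries affected by the sign at [u]. *)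
Lemma minor1_flip S i u v w eps : u != v -> u \notin S ->
  minor1 (signed_mx (flip (i, u) eps)) S v w = minor1 (signed_mx eps) S v w.
Proof.
move=> uv uS; apply: (@detF_col_free _ _ _ _ u u).
- by move=> b; rewrite /upd (negbTE uv) /keep (negbTE uS).
- by move=> b; rewrite /upd (negbTE uv) /keep (negbTE uS).
move=> a b au bu; rewrite /upd; case: eqP => // _.
by rewrite /keep; case: ifP => // _; rewrite signed_mx_flip.
Qed.

(** A path which enters [u] by the atom [j] and goes on in another atom [i] contains the sign of
[(i, u)] exactly once, so that its average is zero. *)
Lemma kappa_rec j S u v : u \in S -> v \notin S ->
  kappa j S u v = \sum_(w | Z j u w) kappa j (S :\ u) w v.
Proof.
move=> uS vS; have uv : u != v by apply: contraNneq vS => <-.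
have uS' : u \notin S :\ u by rewrite !inE eqxx.
rewrite /kappa; under eq_bigr do rewrite minor1_rec //.
transitivity (\sum_w \sum_i \sum_eps (Z i u w)%:R * (sg eps j u * sg eps i u) *
    (sg eps i w * sg eps j v * minor1 (signed_mx eps) (S :\ u) v w)).
  under [RHS]eq_bigr do rewrite exchange_big.
  rewrite exchange_big; apply: eq_bigr => eps _.
  rewrite -sumrN mulr_sumr; apply: eq_bigr => w _.
  have [->|wu] := eqVneq w u.
    rewrite minor1_out // mulr0 oppr0 mulr0 big1 // => i _.
    by rewrite !mulr0.
  rewrite /signed_mx eq_sym (negbTE wu) mulr0 sub0r mulNr opprK mulr_suml mulr_sumr.
  by apply: eq_bigr => i _; ring.
rewrite [RHS]big_mkcond; apply: eq_bigr => w _.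
have [->|wu] := eqVneq w u.
  rewrite Zirr big1 // => i _; rewrite big1 // => eps _.
  by rewrite minor1_out // !mulr0.
rewrite (bigD1 j) //= [X in _ + X]big1 ?addr0 => [|i ij].
  case: (Z j u w); last by rewrite big1 // => eps _; rewrite !mul0r.
  by apply: eq_bigr => eps _; rewrite mul1r sg_sq mul1r.
apply: (@sum_odd0 (i, u)) => eps; rewrite minor1_flip // !sg_flip !xpair_eqE !eqxx.
by rewrite (negbTE wu) (eq_sym j i) (negbTE ij) (eq_sym v u) (negbTE uv) !andbF /=; ring.
Qed.

Lemma alpha_set0_gt0 : 0 < alpha set0.
Proof.
have -> : alpha set0 = \sum_(eps : signing) 1.
  apply: eq_bigr => eps _; rewrite /minor /detF.
  have -> : mxF (keep (signed_mx eps) set0) = 1%:M; last by rewrite det1.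
  apply/matrixP => i j; rewrite !mxE /keep inE /unit_row.
  by rewrite (inj_eq enum_val_inj) eq_sym.
rewrite sumr_const ltr0n; apply/card_gt0P; by exists [ffun=> false].
Qed.

(* [Y] is a cover of [W], with [lift j y w] the point over [w] in the copy of the atom [j] that
contains [y], and [f] is a positive function on it with a superharmonic bound [fsuper]. *)
Variables (Y : Type) (over : Y -> W -> Prop) (lift : 'I_c -> Y -> W -> Y) (f : Y -> R) (x' : R).
Hypothesis fpos : forall y u, over y u -> 0 < f y.
Hypothesis fge0 : forall y, 0 <= f y.
Hypothesis over_lift : forall j y u w, over y u -> Z j u w -> over (lift j y w) w.
Hypothesis lift_lift : forall j y u w z, over y u -> Z j u w ->
  f (lift j (lift j y w) z) = f (lift j y z).
Hypothesis lift_id : forall j y u, over y u -> f (lift j y u) = f y.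
Hypothesis fsuper : forall y u, over y u ->
  \sum_i \sum_(w | Z i u w) f (lift i y w) <= x' * f y.
Hypothesis over_surj : forall u, exists y, over y u.
Hypothesis x'x : x' < x.

(** The last bound says that the paths from [u], continued in the cover from [y], carry at most
the weight of [y]. In the induction, [alpha S] is [x * alpha (S :\ u)] minus the paths which leave
[u] and return to it within an atom. For each neighbour [w] of [u] in the atom [i], the induction
hypothesis at [lift i y w] charges both the paths from [w] that return to [u] and those that
leave [S] against [alpha (S :\ u) * f (lift i y w)]. By [fsuper] the total charge is at
most [x' * alpha (S :\ u) * f y], and a positive gap remains because of [x' < x]. *)
Lemma alpha_kappa_bounds S :
  [/\ 0 < alpha S,
      forall j u v, u \in S -> v \notin S -> 0 <= kappa j S u v &
      forall j y u, over y u -> u \in S ->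
        \sum_(t | t \notin S) kappa j S u t * f (lift j y t) <= alpha S * f y].
Proof.
move: {2}#|S| (erefl #|S|) => n; elim: n S => [S /eqP|n IH S cS].
  rewrite cards_eq0 => /eqP ->; split; [exact: alpha_set0_gt0| |] => j u v; rewrite inE //.
have IHu u : u \in S -> [/\ 0 < alpha (S :\ u),
      forall j w v, w \in S :\ u -> v \notin S :\ u -> 0 <= kappa j (S :\ u) w v &
      forall j y w, over y w -> w \in S :\ u ->
        \sum_(t | t \notin S :\ u) kappa j (S :\ u) w t * f (lift j y t) <= alpha (S :\ u) * f y].
  by move=> uS; apply: IH; move: cS; rewrite (cardsD1 u) uS => -[].
have nS' u : u \notin S :\ u by rewrite !inE eqxx.
have k_ge0 j u v : u \in S -> v \notin S -> 0 <= kappa j S u v.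
  move=> uS vS; have [a0 k0 _] := IHu u uS.
  have vS' : v \notin S :\ u by rewrite inE (negbTE vS) andbF.
  rewrite kappa_rec //; apply: sumr_ge0 => w _.
  have [->|wv] := eqVneq w v; first by rewrite kappa_diag // ltW.
  have [wS|wS] := boolP (w \in S :\ u); first exact: k0.
  by rewrite kappa_out.
have main y u : over y u -> u \in S ->
   alpha (S :\ u) * ((x - x') * f y) <= alpha S * f y /\
   forall j, alpha (S :\ u) * ((x - x') * f y) +
   \sum_(t | t \notin S) kappa j S u t * f (lift j y t) <= alpha S * f y.
  move=> yu uS; have [a0 k0 b0] := IHu u uS; set S' := S :\ u in a0 k0 b0 *.
  have uS' : u \notin S' by apply: nS'.
  have aE : alpha S = x * alpha S' - \sum_i \sum_(w | Z i u w) kappa i S' w u.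
    by rewrite -alphaU // setD1K.
  pose C i := \sum_(w | Z i u w && (w \in S')) kappa i S' w u * f y.
  (* [C i] is the weight of the paths that return to [u] within the atom [i]. *)
  have CE i : \sum_(w | Z i u w) kappa i S' w u * f y = C i.
    rewrite (bigID (mem S')) /= [X in _ + X]big1 ?addr0 // => w /andP[uw wS].
    rewrite kappa_out ?mul0r //; by apply: contraTneq uw => ->; rewrite Zirr.
  have liftb i w : Z i u w -> w \in S' ->
      \sum_(t | t \notin S') kappa i S' w t * f (lift i y t) <= alpha S' * f (lift i y w).
    move=> uw wS; have := b0 i (lift i y w) w (over_lift yu uw) wS.
    by under eq_bigr => t _ do rewrite (lift_lift _ yu uw).
  have Cle i : C i <= alpha S' * \sum_(w | Z i u w) f (lift i y w).
    rewrite mulr_sumr [X in _ <= X](bigID (mem S')) /=; apply: ler_wpDr.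
      by apply: sumr_ge0 => w _; apply: mulr_ge0; [exact: ltW | exact: fge0].
    apply: ler_sum => w /andP[uw wS]; apply: le_trans (liftb i w uw wS).
    rewrite (bigD1 u) //= (lift_id _ yu) lerDl; apply: sumr_ge0 => t /andP[tS _].
    by apply: mulr_ge0 => //; apply: k0.
  have tS' t : t \notin S -> t \notin S' by rewrite inE => /negbTE ->; rewrite andbF.
  (* Paths from [w] that avoid [u] end either at [u] itself or outside [S]; together they are
  charged to [w]. *)
  have LE j : C j + \sum_(t | t \notin S) kappa j S u t * f (lift j y t)
      <= alpha S' * \sum_(w | Z j u w) f (lift j y w).
    have -> : \sum_(t | t \notin S) kappa j S u t * f (lift j y t) =
        \sum_(w | Z j u w && (w \in S')) \sum_(t | t \notin S) kappa j S' w t * f (lift j y t)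
        + \sum_(t | Z j u t && (t \notin S')) alpha S' * f (lift j y t).
      transitivity (\sum_(t | t \notin S) (\sum_(w | Z j u w && (w \in S')) kappa j S' w t * f (lift j y t)
          + (if Z j u t then alpha S' * f (lift j y t) else 0))).
        apply: eq_bigr => t tS; rewrite kappa_rec // mulr_suml (bigID (mem S')) /=.
        congr (_ + _); case: ifPn => ut.
          rewrite (bigD1 t) /=; last by rewrite ut tS'.
          rewrite kappa_diag ?tS' // big1 ?addr0 // => w /andP[/andP[_ wS] wt].
          by rewrite kappa_out // mul0r.
        rewrite big1 // => w /andP[uw wS]; rewrite kappa_out ?mul0r //.
        by apply: contraNneq ut => <-.
      rewrite big_split /= exchange_big /=; congr (_ + _).
      rewrite -big_mkcondr; apply: eq_bigl => t; rewrite /S' !inE andbC.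
      have [->|tu] := eqVneq t u; first by rewrite Zirr.
      by [].
    rewrite addrA -big_split /= mulr_sumr [X in _ <= X](bigID (mem S')) /= lerD2r.
    apply: ler_sum => w /andP[uw wS]; apply: le_trans (liftb j w uw wS).
    rewrite [X in _ <= X](bigD1 u) //= (lift_id _ yu) lerD2l.
    rewrite le_eqVlt; apply/orP; left; apply/eqP; apply: eq_bigl => t.
    rewrite /S' !inE; case: (eqVneq t u) => [->|]; by rewrite ?uS ?andbT.
  have sup := ler_wpM2l (ltW a0) (fsuper yu).
  have aE' : alpha S * f y = x * alpha S' * f y - \sum_i C i.
    by rewrite aE mulrBl mulr_suml; congr (_ - _); apply: eq_bigr => i _; rewrite mulr_suml CE.
  split=> [|j].
    have : \sum_i C i <= alpha S' * (x' * f y).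
      by apply: le_trans sup; rewrite mulr_sumr; apply: ler_sum.
    by rewrite aE'; move: (\sum_i C i) => r h; lra.
  rewrite (bigD1 j) //= in sup; rewrite aE' (bigD1 j) //=.
  have rest : \sum_(i | i != j) C i <= alpha S' * \sum_(i | i != j) \sum_(w | Z i u w) f (lift i y w).
    by rewrite mulr_sumr; apply: ler_sum.
  rewrite mulrDr in sup; have := LE j.
  move: sup rest; move: (\sum_(i | i != j) C i) (alpha S' * _) (alpha S' * \sum_(i | i != j) _).
  by move=> r1 r2 r3; move: (\sum_(t | t \notin S) _) (C j) => r4 r5 *; lra.
have [u uS] : exists u, u \in S by apply/card_gt0P; rewrite cS.
have gap y w : over y w -> w \in S -> 0 < alpha (S :\ w) * ((x - x') * f y).
  by move=> yw wS; have [a0 _ _] := IHu w wS; rewrite !mulr_gt0 ?subr_gt0 // (fpos yw).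
have [y yu] := over_surj u; have fy := fpos yu.
split=> // [|j z w zw wS].
  rewrite -(pmulr_lgt0 _ fy); have [h _] := main y u yu uS.
  exact: lt_le_trans (gap _ _ yu uS) h.
have [_ /(_ j)] := main z w zw wS; apply: le_trans; rewrite lerDr.
exact/ltW/gap.
Qed.

Theorem alpha_gt0 : 0 < alpha setT.
Proof. by have [] := alpha_kappa_bounds setT. Qed.

End SignAverage.

(** * Matrices indexed by finite types *)

Section TypeMatrix.
Variable R : comNzRingType.

Lemma mxF_mul (S T U : finType) (f : S -> T -> R) (g : T -> U -> R) :
  mxF f *m mxF g = mxF (fun a b => \sum_t f a t * g t b).
Proof.
apply/matrixP => i j; rewrite !mxE (big_enum_val (fun t => f (enum_val i) t * g t (enum_val j))).
by apply: eq_bigr => k _; rewrite !mxE.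
Qed.

Lemma mxF_tr (S T : finType) (f : S -> T -> R) : (mxF f)^T = mxF (fun a b => f b a).
Proof. by apply/matrixP => i j; rewrite !mxE. Qed.

Lemma eq_mxF (S T : finType) (f g : S -> T -> R) : f =2 g -> mxF f = mxF g.
Proof. by move=> E; apply/matrixP => i j; rewrite !mxE E. Qed.

Lemma mxF1 (S : finType) : mxF (fun a b : S => (a == b)%:R) = 1%:M :> 'M[R]_#|S|.
Proof. by apply/matrixP => i j; rewrite !mxE (inj_eq enum_val_inj). Qed.

End TypeMatrix.

(** * An orthonormal frame of the vectors of sum zero *)

Section StandardFrame.
Variables (R : rcfType) (d : nat).

(** An identity matrix shifted by a constant, with a last column that makes the row sums zero; the
constant is chosen to make the rows orthonormal. *)
Definition simplex_frame (a : 'I_d) (b : 'I_d.+1) : R :=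
  let g := (Num.sqrt d.+1%:R)^-1 in
  if b == ord_max then - g else (val a == val b)%:R - (1 - g) / d%:R.

Lemma simplex_frame_facts :
  [/\ forall a a', \sum_b simplex_frame a b * simplex_frame a' b = (a == a')%:R,
      forall b b', \sum_a simplex_frame a b * simplex_frame a b' = (b == b')%:R - d.+1%:R^-1 &
      forall a, \sum_b simplex_frame a b = 0].
Proof.
set g : R := (Num.sqrt d.+1%:R)^-1; set beta := (1 - g) / d%:R.
have N0 : (d.+1%:R : R) != 0 by rewrite pnatr_eq0.
have gg : g * g = d.+1%:R^-1 by rewrite /g -invfM -expr2 sqr_sqrtr ?ler0n.
have UE a b : simplex_frame a b =
   if b == ord_max then - g else (val a == val b)%:R - beta by [].
have Uw a (l : 'I_d) : simplex_frame a (widen_ord (leqnSn d) l) = (a == l)%:R - beta.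
  by rewrite UE -val_eqE /= ltn_eqF.
have Um a : simplex_frame a ord_max = - g by rewrite UE eqxx.
have Ng : d%:R * (g * g) = 1 - g * g.
  by rewrite gg -natr1; field; rewrite natr1.
have db (a : 'I_d) : d%:R * beta = 1 - g.
  rewrite /beta mulrC divfK // pnatr_eq0 -lt0n; exact: leq_ltn_trans (ltn_ord a).
have sumI (F : 'I_d -> R) (a : 'I_d) : \sum_b (a == b)%:R * F b = F a.
  rewrite (bigD1 a) //= eqxx mul1r big1 ?addr0 // => i ia.
  by rewrite eq_sym (negbTE ia) mul0r.
have sumc (k : R) : \sum_(b < d) k = d%:R * k by rewrite sumr_const card_ord mulr_natl.
have bb (a : 'I_d) : d%:R * (beta * beta) - 2 * beta = - (g * g).
  have d0 : (d%:R : R) != 0 by rewrite pnatr_eq0 -lt0n; exact: leq_ltn_trans (ltn_ord a).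
  apply: (mulfI d0); rewrite mulrBr; transitivity ((d%:R * beta) * (d%:R * beta) - 2 * (d%:R * beta)).
    by ring.
  rewrite (db a); rewrite mulrN Ng; ring.
have sum1 (a : 'I_d) : \sum_(b < d) ((a == b)%:R : R) = 1.
  by rewrite -[RHS](sumI (fun=> 1) a); apply: eq_bigr => b _; rewrite mulr1.
have sum1' (a : 'I_d) : \sum_(b < d) ((b == a)%:R : R) = 1.
  by rewrite -[RHS](sum1 a); apply: eq_bigr => b _; rewrite eq_sym.
split.
- move=> a a'; rewrite big_ord_recr /= !Um.
  transitivity (\sum_(b < d)
    ((a == b)%:R * ((a' == b)%:R - beta) - beta * (a' == b)%:R + beta * beta) + g * g).
    by rewrite mulrNN; congr (_ + _); apply: eq_bigr => b _; rewrite !Uw; ring.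
  rewrite big_split /= sumrB sumI -mulr_sumr sum1 sumc mulr1 (eq_sym a' a).
  transitivity ((a == a')%:R + (d%:R * (beta * beta) - 2 * beta) + g * g); first by ring.
  by rewrite (bb a); ring.
- move=> b b'; have spl (c : 'I_d.+1) : c = ord_max \/ exists l : 'I_d, c = widen_ord (leqnSn d) l.
    case: (ltnP c d) => h; last by left; apply/val_inj/eqP; rewrite eqn_leq h -ltnS ltn_ord.
    by right; exists (Ordinal h); apply: val_inj.
  have wm (l : 'I_d) : (widen_ord (leqnSn d) l == ord_max) = false.
    by rewrite -val_eqE /= ltn_eqF.
  case: (spl b) => [->|[l ->]]; case: (spl b') => [->|[l' ->]]; rewrite -gg.
  + under eq_bigr do rewrite !Um mulrNN.
    by rewrite sumc Ng eqxx.
  + under eq_bigr do rewrite Um Uw mulrBr.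
    rewrite sumrB -mulr_sumr sum1' sumc eq_sym wm mulr1 /=.
    by transitivity (- g + g * (d%:R * beta)); [ring | rewrite (db l'); ring].
  + under eq_bigr do rewrite Um Uw mulrBl.
    rewrite sumrB -mulr_suml sum1' sumc wm mul1r /=.
    by transitivity (- g + g * (d%:R * beta)); [ring | rewrite (db l); ring].
  + transitivity (\sum_(a < d) ((l == a)%:R * ((a == l')%:R - beta) - beta * (a == l')%:R + beta * beta)).
      by apply: eq_bigr => a _; rewrite !Uw (eq_sym l a); ring.
    rewrite big_split /= sumrB sumI -mulr_sumr sum1' sumc mulr1.
    have -> : (widen_ord (leqnSn d) l == widen_ord (leqnSn d) l') = (l == l') by rewrite -val_eqE.
    transitivity ((l == l')%:R + (d%:R * (beta * beta) - 2 * beta)); first by ring.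
    by rewrite (bb l).
- move=> a; rewrite big_ord_recr /= Um; under eq_bigr do rewrite Uw.
  by rewrite sumrB sum1 sumc (db a); ring.
Qed.

End StandardFrame.

(** * Lifts as permuted copies of the atoms *)

Section Lift.
Variables (R : rcfType) (V : finType) (c : nat) (A : 'I_c -> rel V).
Hypothesis Asym : forall j, symmetric (A j).

Notation J := ('I_c * V)%type.
Definition copies k : finType := (J * 'I_k)%type.
Definition verts k : finType := (V * 'I_k)%type.
(** Permutations are only allowed to mix the copies of one vertex in one atom. *)
Definition siteof k (i : 'I_#|copies k|) : J := (enum_val i).1.

Definition atoms_fun k (p q : copies k) : R :=
  [&& p.1.1 == q.1.1, A p.1.1 p.1.2 q.1.2 & p.2 == q.2]%:R.
Definition atoms_mx k : 'M[R]_#|copies k| := mxF (@atoms_fun k).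

(** Identifies the points of different atoms that are copies of the same vertex with the same number. *)
Definition glue k : 'M[R]_(#|verts k|, #|copies k|) :=
  mxF (fun (w : verts k) (p : copies k) => ((p.1.2, p.2) == w)%:R).

Lemma glue_conj k (g : copies k -> copies k -> R) :
  glue k *m mxF g *m (glue k)^T =
  mxF (fun w w' : verts k => \sum_i \sum_j g ((i, w.1), w.2) ((j, w'.1), w'.2)).
Proof.
have S (h : copies k -> R) (w : verts k) :
   \sum_p ((p.1.2, p.2) == w)%:R * h p = \sum_i h ((i, w.1), w.2).
  rewrite (eq_bigr (fun p : copies k => if (p.1.2, p.2) == w then h p else 0)); last first.
    by move=> p _; case: ifP => _; rewrite ?mul1r ?mul0r.
  rewrite -big_mkcond (reindex_onto (fun i : 'I_c => ((i, w.1), w.2) : copies k) (fun p : copies k => p.1.1)) /=.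
    by apply: eq_bigl => i; rewrite -surjective_pairing !eqxx.
  by case=> [[i v] b] /= /eqP <-.
rewrite /glue mxF_tr !mxF_mul; apply: eq_mxF => w w'.
under eq_bigr do rewrite S mulrC.
rewrite (S (fun q => \sum_i g ((i, w.1), w.2) q)) exchange_big.
by [].
Qed.

Section SitePerms.
Variables (k : nat) (s : 'S_#|copies k|).
Hypothesis sf : s \in fixing (@siteof k) #|copies k|.

Definition label j v (b : 'I_k) : 'I_k := (enum_val (s (enum_rank ((j, v), b) ))).2.

Lemma site_permE j v b : enum_val (s (enum_rank (((j, v), b) : copies k))) = ((j, v), label j v b).
Proof.
rewrite [LHS]surjective_pairing; congr (_, _).
by case/fixingP: sf => h _; have := h (enum_rank ((j, v), b)); rewrite /siteof enum_rankK.
Qed.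

Lemma label_inj j v : injective (label j v).
Proof.
move=> b b' E; have : enum_rank (((j, v), b) : copies k) = enum_rank (((j, v), b') : copies k).
  by apply: (@perm_inj _ s); apply: enum_val_inj; rewrite !site_permE E.
by move/enum_rank_inj => [].
Qed.

(** The atoms of the lift, read off from the permutation [s] of the copies. *)
Definition lifted j : rel (verts k) :=
  fun w w' => A j w.1 w'.1 && (label j w'.1 w'.2 == label j w.1 w.2).

Lemma relabel_atoms : relabel s (atoms_mx k) = mxF (fun p q : copies k =>
  (p.1.1 == q.1.1)%:R * (lifted p.1.1 (p.1.2, p.2) (q.1.2, q.2))%:R).
Proof.
apply/matrixP => i j; rewrite !mxE; case Ei: (enum_val i) => [[i1 v] b].
case Ej: (enum_val j) => [[j1 u] b'].
have si : enum_val (s i) = ((i1, v), label i1 v b) by rewrite -site_permE -Ei enum_valK.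
have sj : enum_val (s j) = ((j1, u), label j1 u b') by rewrite -site_permE -Ej enum_valK.
rewrite /atoms_fun si sj /lifted /= -natrM mulnb; congr (_%:R); congr nat_of_bool.
by case: eqVneq => //= ->; rewrite [in RHS]eq_sym.
Qed.

Lemma glue_relabel_signs (eps : {ffun 'I_#|copies k| -> bool}) :
  glue k *m (signs R eps *m relabel s (atoms_mx k) *m signs R eps) *m (glue k)^T =
  mxF (fun w w' : verts k => \sum_j (-1) ^+ eps (enum_rank ((j, w.1), w.2)) *
     (-1) ^+ eps (enum_rank ((j, w'.1), w'.2)) * (lifted j w w')%:R).
Proof.
have -> : signs R eps *m relabel s (atoms_mx k) *m signs R eps = mxF (fun p q : copies k =>
   (-1) ^+ eps (enum_rank p) * ((p.1.1 == q.1.1)%:R * (lifted p.1.1 (p.1.2, p.2) (q.1.2, q.2))%:R)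
     * (-1) ^+ eps (enum_rank q)).
  rewrite relabel_atoms /signs; apply/matrixP => i j.
  by rewrite mul_mx_diag mul_diag_mx !mxE !enum_valK.
rewrite glue_conj; apply: eq_mxF => w w' /=; apply: eq_bigr => i _.
rewrite (bigD1 i) //= big1 ?addr0 => [|j ji].
  by rewrite eqxx mul1r -!surjective_pairing mulrAC.
by rewrite eq_sym (negbTE ji) mul0r mulr0 mul0r.
Qed.

Lemma glue_relabel : glue k *m relabel s (atoms_mx k) *m (glue k)^T =
  mxF (fun w w' : verts k => \sum_j (lifted j w w')%:R).
Proof.
have := glue_relabel_signs [ffun=> false]; rewrite signs0 mul1mx mulmx1 => ->.
by apply: eq_mxF => w w'; apply: eq_bigr => j _; rewrite !ffunE expr0 !mul1r.
Qed.

End SitePerms.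

Lemma tr_atoms k : (atoms_mx k)^T = atoms_mx k.
Proof.
rewrite /atoms_mx mxF_tr; apply: eq_mxF => p q; rewrite /atoms_fun; congr (_%:R).
rewrite (eq_sym q.1.1) (eq_sym q.2); case: eqVneq => //= ->.
by rewrite Asym.
Qed.

Variable d : nat.
Notation N := d.+1.
Notation U := (@simplex_frame R d).

Definition frame : 'M[R]_(#|copies d|, #|copies N|) :=
  mxF (fun (p : copies d) (q : copies N) => (p.1 == q.1)%:R * U p.2 q.2).

Definition frameV : 'M[R]_(#|verts d|, #|verts N|) :=
  mxF (fun (p : verts d) (q : verts N) => (p.1 == q.1)%:R * U p.2 q.2).

Lemma sum_pairD (S T : finType) (s0 : S) (h : S -> T -> R) :
  \sum_(p : S * T) (s0 == p.1)%:R * h p.1 p.2 = \sum_t h s0 t.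
Proof.
rewrite -(pair_big xpredT xpredT (fun s t => (s0 == s)%:R * h s t)) /=.
rewrite (bigD1 s0) //= [X in _ + X]big1 ?addr0 => [|s ss].
  by apply: eq_bigr => t _; rewrite eqxx mul1r.
by rewrite big1 // => t _; rewrite eq_sym (negbTE ss) mul0r.
Qed.

Lemma frame_gram (S : finType) :
  let F := mxF (fun (p : S * 'I_d) (q : S * 'I_N) => (p.1 == q.1)%:R * U p.2 q.2) in
  F *m F^T = 1%:M /\
  F^T *m F = mxF (fun p q : S * 'I_N => (p.1 == q.1)%:R * ((p.2 == q.2)%:R - N%:R^-1)).
Proof.
have [UUt UtU _] := simplex_frame_facts R d.
move=> F; split; rewrite /F mxF_tr mxF_mul.
  rewrite -mxF1; apply: eq_mxF => p q.
  transitivity (\sum_(r : S * 'I_N) (p.1 == r.1)%:R * ((q.1 == r.1)%:R * (U p.2 r.2 * U q.2 r.2))).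
    by apply: eq_bigr => r _; ring.
  rewrite (sum_pairD p.1 (fun s t => (q.1 == s)%:R * (U p.2 t * U q.2 t))).
  rewrite -mulr_sumr UUt -natrM mulnb [p]surjective_pairing [q]surjective_pairing xpair_eqE.
  by rewrite eq_sym.
apply: eq_mxF => p q.
transitivity (\sum_(r : S * 'I_d) (p.1 == r.1)%:R * ((r.1 == q.1)%:R * (U r.2 p.2 * U r.2 q.2))).
  by apply: eq_bigr => r _; rewrite (eq_sym p.1); ring.
rewrite (sum_pairD p.1 (fun s t => (s == q.1)%:R * (U t p.2 * U t q.2))).
by rewrite -mulr_sumr UtU.
Qed.

Lemma frameF : frame *m frame^T = 1%:M.
Proof. by have [] := frame_gram ('I_c * V)%type. Qed.

Lemma frame_site i b : siteof i != siteof b -> frame i b = 0.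
Proof. by rewrite /siteof mxE => /negbTE ->; rewrite mul0r. Qed.

Lemma frame_sum i : \sum_b frame i b = 0.
Proof.
have [_ _ U0] := simplex_frame_facts R d.
rewrite (reindex (@enum_rank (copies N))) /=; last by apply/onW_bij/enum_rank_bij.
under eq_bigr do rewrite mxE enum_rankK.
by rewrite (sum_pairD _ (fun s t => U (enum_val i).2 t)) U0.
Qed.

Lemma frame_diff b b' : siteof b = siteof b' ->
  (e_ R b - e_ R b') *m (frame^T *m frame) = e_ R b - e_ R b'.
Proof.
rewrite /siteof => bb; have [_ ->] := frame_gram ('I_c * V)%type.
rewrite mulmxBl -!rowE; apply/rowP => j; rewrite !mxE bb eqxx /=.
rewrite -!(inj_eq enum_val_inj).
have pE (p q : copies N) : (p == q)%:R = (p.1 == q.1)%:R * (p.2 == q.2)%:R :> R.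
  by rewrite -natrM mulnb [p]surjective_pairing [q]surjective_pairing xpair_eqE.
rewrite !(eq_sym (enum_val j)) !pE bb; ring.
Qed.

Lemma frame_glue : frameV *m glue N = glue d *m frame.
Proof.
rewrite /frameV /glue /frame !mxF_mul; apply: eq_mxF => w q.
transitivity ((w.1 == q.1.2)%:R * U w.2 q.2).
  rewrite (bigD1 (q.1.2, q.2)) //= eqxx mulr1 big1 ?addr0 // => r.
  by rewrite eq_sym => /negbTE ->; rewrite mulr0.
transitivity (\sum_(i < c) ((((i, w.1), w.2) : copies d).1 == q.1)%:R * U w.2 q.2).
  rewrite (bigD1 q.1.1) //= big1 ?addr0 => [|i ii].
    by rewrite [q.1]surjective_pairing xpair_eqE eqxx.
  by rewrite [q.1]surjective_pairing xpair_eqE (negbTE ii) mul0r.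
rewrite [RHS](eq_bigr (fun p : copies d => if (p.1.2, p.2) == w then (p.1 == q.1)%:R * U p.2 q.2 else 0)); last first.
  by move=> p _; case: ifP => _; rewrite ?mul1r ?mul0r.
rewrite -[RHS]big_mkcond (reindex_onto (fun i : 'I_c => ((i, w.1), w.2) : copies d) (fun p : copies d => p.1.1)) /=.
  by apply: eq_bigl => i; rewrite -surjective_pairing !eqxx.
by case=> [[i v] b] /= /eqP <-.
Qed.

Lemma frame_atoms : frame *m atoms_mx N = atoms_mx d *m frame.
Proof.
rewrite /frame /atoms_mx !mxF_mul; apply: eq_mxF => p q.
transitivity (\sum_(r : copies N) (p.1 == r.1)%:R *
  (U p.2 r.2 * [&& r.1.1 == q.1.1, A r.1.1 r.1.2 q.1.2 & r.2 == q.2]%:R)).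
  by apply: eq_bigr => r _; rewrite mulrA.
rewrite (sum_pairD p.1 (fun s t => U p.2 t * [&& s.1 == q.1.1, A s.1 s.2 q.1.2 & t == q.2]%:R)).
transitivity ((p.1.1 == q.1.1)%:R * (A p.1.1 p.1.2 q.1.2)%:R * U p.2 q.2).
  rewrite (bigD1 q.2) //= eqxx andbT big1 ?addr0 => [|t tq].
    by rewrite -natrM mulnb mulrC.
  by rewrite (negbTE tq) !andbF mulr0.
transitivity (\sum_(r : copies d) (q.1 == r.1)%:R *
  ([&& p.1.1 == r.1.1, A p.1.1 p.1.2 r.1.2 & p.2 == r.2]%:R * U r.2 q.2)); last first.
  by apply: eq_bigr => r _; rewrite (eq_sym q.1); ring.
rewrite (sum_pairD q.1 (fun s t => [&& p.1.1 == s.1, A p.1.1 p.1.2 s.2 & p.2 == t]%:R * U t q.2)).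
rewrite (bigD1 p.2) //= eqxx andbT [X in _ + X]big1 ?addr0 => [|t tp].
  by rewrite -natrM mulnb.
by rewrite (eq_sym p.2) (negbTE tp) !andbF mul0r.
Qed.

(** Its rows span the functions on the lift with sum zero on each fibre, pulled back to the
copies of the atoms. *)
Definition newpart : 'M[R]_(#|verts d|, #|copies N|) := frameV *m glue N.

(** Glueing and the adjacency of the copies act in the same way on each copy, so they commute with
the passage to vectors of sum zero; this leaves [d] copies, with permutations acting by [std]. *)
Lemma newpart_relabel s : s \in fixing (@siteof N) #|copies N| ->
  newpart *m relabel s (atoms_mx N) *m newpart^T =
  glue d *m (std frame s *m atoms_mx d *m (std frame s)^T) *m (glue d)^T.
Proof.
move=> sf; rewrite /newpart frame_glue trmx_mul !mulmxA; congr (_ *m _).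
rewrite -!mulmxA; congr (_ *m _); rewrite !mulmxA relabel_perm_mx.
have comm := frame_comm frame_diff sf.
have comm' : (perm_mx s)^T *m (frame^T *m frame) = frame^T *m frame *m (perm_mx s)^T.
  have ET : (frame^T *m frame)^T = frame^T *m frame by rewrite trmx_mul trmxK.
  by rewrite -[in LHS]ET -trmx_mul -comm trmx_mul ET.
have FE0 : frame *m (frame^T *m frame) = frame by rewrite mulmxA frameF mul1mx.
rewrite /std !trmx_mul trmxK.
transitivity (frame *m (perm_mx s *m (frame^T *m frame)) *m atoms_mx N *m (perm_mx s)^T *m frame^T).
  by rewrite comm (mulmxA frame _ (perm_mx s)) FE0 !mulmxA.
rewrite -!mulmxA; do 3!congr (_ *m _).
by rewrite !mulmxA frame_atoms.
Qed.

(** Sylvester's identity moves the glueing into the fixed factor, so as to reach the form of the terms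
of an orbit sum. *)
Lemma glue_det w n (L : 'M[R]_(w, n)) (Y : 'M[R]_n) x : x != 0 ->
  x ^+ n * \det (x%:M - L *m Y *m L^T) = x ^+ w * \det (x%:M + (- (L^T *m L)) *m Y).
Proof.
move=> x0; have E1 : x%:M - L *m Y *m L^T = x *: (1%:M + (- (x^-1 *: L)) *m (Y *m L^T)).
  by rewrite scalerDr scalemx1 mulNmx scalerN -scalemxAl scalerA mulfV // scale1r mulmxA.
have E2 : x%:M + (- (L^T *m L)) *m Y = x *: (1%:M + (- L^T) *m ((x^-1 *: L) *m Y)).
  rewrite scalerDr scalemx1 !mulNmx scalerN -scalemxAl -scalemxAr scalerA mulfV //.
  by rewrite scale1r mulmxA.
rewrite E1 E2 !detZ mulrCA; congr (_ * (_ * _)).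
by rewrite [RHS]det_mulC_add mulNmx mulmxN mulmxA.
Qed.

Lemma signed_lift_det (s : 'S_#|copies d|) (sf : s \in fixing (@siteof d) #|copies d|) x :
  \sum_(eps : {ffun 'I_#|copies d| -> bool})
    \det (x%:M - glue d *m (signs R eps *m relabel s (atoms_mx d) *m signs R eps) *m (glue d)^T)
  = alpha (lifted s) x setT.
Proof.
pose h (e : {ffun 'I_c * verts d -> bool}) : {ffun 'I_#|copies d| -> bool} :=
  [ffun i => e ((enum_val i).1.1, ((enum_val i).1.2, (enum_val i).2))].
pose h' (e : {ffun 'I_#|copies d| -> bool}) : {ffun 'I_c * verts d -> bool} :=
  [ffun p => e (enum_rank ((p.1, p.2.1), p.2.2))].
have hb : bijective h.
  exists h' => e; apply/ffunP => p; rewrite !ffunE ?enum_rankK -?surjective_pairing //.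
  by rewrite enum_valK.
rewrite (reindex h) /=; last exact: onW_bij.
apply: eq_bigr => e _; rewrite glue_relabel_signs // /minor /detF; congr (\det _).
apply/matrixP => i j; rewrite !mxE /keep inE /signed_mx (inj_eq enum_val_inj) mulr_natr.
by congr (_ - _); apply: eq_bigr => l _; rewrite /h !ffunE !enum_rankK /= -!surjective_pairing.
Qed.

(** By [std_avg_eq_signed_avg] this sum is, up to positive factors, the sum over the signed
permutations of [d] copies, that is, the sum of [alpha (lifted s)] over all [s]. *)
Theorem new_sum_gt0 x : 0 < x ->
  (forall s, s \in fixing (@siteof d) #|copies d| -> 0 < alpha (lifted s) x setT) ->
  0 < \sum_(s in fixing (@siteof N) #|copies N|)
        \det (x%:M - newpart *m relabel s (atoms_mx N) *m newpart^T).
Proof.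
move=> xp apos; have x0 : x != 0 by rewrite gt_eqF.
have xn k : 0 < x ^+ k by rewrite exprn_gt0.
pose K := - ((glue d)^T *m glue d).
rewrite -(pmulr_rgt0 _ (xn #|copies d|)) mulr_sumr.
under eq_bigr => s sf do rewrite newpart_relabel // glue_det //.
rewrite -mulr_sumr pmulr_rgt0 //.
have Fx (i : 'I_#|copies d|) : exists b : 'I_#|copies N|, siteof b = siteof i.
  by exists (enum_rank (((enum_val i).1, ord0) : copies N)); rewrite /siteof enum_rankK.
have := std_avg_eq_signed_avg frameF frame_site frame_sum frame_diff x0 K (atoms_mx d) Fx.
set inB := [pred p | _]; set psiS := orbit_sum _ _ _ _ _; set psiB := orbit_sum _ _ _ _ _.
move=> E; change (0 < psiS).
have cB : 0 < (#|inB|%:R : R).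
  rewrite ltr0n; apply/card_gt0P; exists (1%g, [ffun=> false]); rewrite inE /=.
  exact: fixing1.
rewrite -(pmulr_rgt0 _ cB) E; apply: mulr_gt0; first by rewrite ltr0n card_fixing_gt0.
rewrite -(pmulr_rgt0 _ (xn #|verts d|)) mulr_sumr.
under eq_bigr => p _ do rewrite -glue_det // /sgn_perm conj_mulmx tr_signs -relabel_perm_mx.
rewrite -mulr_sumr pmulr_rgt0 //.
rewrite (eq_bigl (fun p : 'S_#|copies d| * {ffun 'I_#|copies d| -> bool} =>
  (p.1 \in fixing (@siteof d) #|copies d|) && true)); last first.
  by move=> p; rewrite andbT.
rewrite -(pair_big (fun s => s \in fixing (@siteof d) #|copies d|) xpredT
  (fun s (eps : {ffun 'I_#|copies d| -> bool}) =>
   \det (x%:M - glue d *m (signs R eps *m relabel s (atoms_mx d) *m signs R eps) *m (glue d)^T))) /=.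
rewrite (eq_bigr (fun s => alpha (lifted s) x setT)); last first.
  by move=> s sf; rewrite signed_lift_det.
have f1 : (1%g : 'S_#|copies d|) \in fixing (@siteof d) #|copies d| by apply: fixing1.
rewrite (bigD1 1%g) //=; apply: ltr_pwDl; first exact: apos.
by apply: sumr_ge0 => s /andP[sf _]; apply: ltW; apply: apos.
Qed.

Lemma horner_char_poly n (Y : 'M[R]_n) x : (char_poly Y).[x] = \det (x%:M - Y).
Proof.
rewrite /char_poly -horner_evalE -det_map_mx; congr (\det _).
apply/matrixP => i j; rewrite !mxE /= horner_evalE hornerD hornerN hornerC.
by rewrite hornerMn hornerX.
Qed.

Theorem exists_good_lift t0 : 0 < t0 ->
  (forall x s, t0 <= x -> s \in fixing (@siteof d) #|copies d| -> 0 < alpha (lifted s) x setT) ->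
  exists2 g, g \in fixing (@siteof N) #|copies N| &
    pos_from t0 (char_poly (newpart *m relabel g (atoms_mx N) *m newpart^T)).
Proof.
move=> t0p apos.
have [_ H] := @averageable_fixing _ _ (@siteof N) R _ (leqnn #|copies N|) _ _ (hyperbolic_char_poly newpart).
apply: (H (atoms_mx N) t0) => [|x t0x]; first exact: tr_atoms.
have xp : 0 < x by apply: lt_le_trans t0x.
rewrite /avg hornerZ mulr_gt0 ?invr_gt0 ?ltr0n ?card_fixing_gt0 //.
rewrite horner_sum; under eq_bigr do rewrite horner_char_poly.
by apply: new_sum_gt0 => // s sf; apply: apos.
Qed.

Lemma char_poly_orth m k (T : 'M[R]_(k, m)) (Y : 'M[R]_m) : T *m T^T = 1%:M -> T^T *m T = 1%:M ->
  char_poly (T *m Y *m T^T) = char_poly Y.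
Proof.
move=> T1 T2; have mk : m = k.
  by apply/eqP; rewrite eqn_leq (mulmx1_min T1) (mulmx1_min T2).
subst k; rewrite /char_poly.
have -> : char_poly_mx (T *m Y *m T^T) = map_mx polyC T *m char_poly_mx Y *m map_mx polyC T^T.
  rewrite /char_poly_mx mulmxBr mulmxBl !map_mxM; congr (_ - _).
  by rewrite mul_mx_scalar -scalemxAl -map_mxM T1 map_mx1 scalemx1.
rewrite !det_mulmx mulrAC -det_mulmx -map_mxM T1 map_mx1 det1 mul1r.
by [].
Qed.

Lemma char_poly_diag_block m k (P : 'M[R]_m) (Q : 'M[R]_k) :
  char_poly (block_mx P 0 0 Q) = char_poly P * char_poly Q.
Proof.
rewrite /char_poly /char_poly_mx map_block_mx !map_mx0 (scalar_mx_block m k) opp_block_mx.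
by rewrite add_block_mx !oppr0 !addr0 det_ublock.
Qed.

(** In an orthonormal basis made of functions constant on the fibres and functions with sum zero on the
fibres, the adjacency matrix of the lift is block diagonal. *)
Lemma char_poly_lift g : g \in fixing (@siteof N) #|copies N| ->
  char_poly (glue N *m relabel g (atoms_mx N) *m (glue N)^T) =
  char_poly (mxF (fun v u : V => \sum_j (A j v u)%:R) : 'M[R]_#|V|) *
  char_poly (newpart *m relabel g (atoms_mx N) *m newpart^T).
Proof.
move=> gf; set M := glue N *m _ *m _; set H := mxF _.
have ME : M = mxF (fun w w' : verts N => \sum_j (lifted g j w w')%:R) by rewrite /M glue_relabel.
pose gam : R := (Num.sqrt N%:R)^-1.
have gg : gam * gam = N%:R^-1 by rewrite /gam -invfM -expr2 sqr_sqrtr ?ler0n.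
have N0 : (N%:R : R) != 0 by rewrite pnatr_eq0.
pose T1 : 'M[R]_(#|V|, #|verts N|) := mxF (fun v (w : verts N) => (v == w.1)%:R * gam).
have [_ _ U0] := simplex_frame_facts R d.
have [T22 T22'] := frame_gram V; rewrite -/frameV in T22 T22'.
have T11 : T1 *m T1^T = 1%:M.
  rewrite /T1 mxF_tr mxF_mul -mxF1; apply: eq_mxF => v u.
  transitivity (\sum_(w : V * 'I_N) (v == w.1)%:R * ((u == w.1)%:R * N%:R^-1 : R)).
    by apply: eq_bigr => w _; rewrite -gg; ring.
  rewrite (sum_pairD v (fun s t => (u == s)%:R * N%:R^-1)) sumr_const card_ord.
  by rewrite -mulrnAr -[_^-1 *+ _]mulr_natl mulfV // mulr1 eq_sym.
have T12 : T1 *m frameV^T = 0.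
  rewrite /T1 /frameV mxF_tr mxF_mul; apply/matrixP => i j; rewrite !mxE.
  transitivity (\sum_(w : V * 'I_N) (enum_val i == w.1)%:R * ((enum_val j).1 == w.1)%:R *
     (gam * U (enum_val j).2 w.2)).
    by apply: eq_bigr => w _; ring.
  under eq_bigr do rewrite -mulrA.
  rewrite (sum_pairD _ (fun s t => ((enum_val j).1 == s)%:R * (gam * U (enum_val j).2 t))).
  by rewrite -!mulr_sumr U0 !mulr0.
have T1' : T1^T *m T1 + frameV^T *m frameV = 1%:M.
  rewrite T22' /T1 mxF_tr mxF_mul; apply/matrixP => i j; rewrite !mxE.
  rewrite -[i == j](inj_eq enum_val_inj) [enum_val i]surjective_pairing [enum_val j]surjective_pairing.
  move: (enum_val i) (enum_val j) => p q; rewrite xpair_eqE /=.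
  rewrite (bigD1 p.1) //= eqxx big1 ?addr0 => [|v vp].
    by rewrite -mulnb natrM mul1r mulrCA gg; ring.
  by rewrite (negbTE vp) !mul0r.
have T1M : T1 *m M = H *m T1.
  rewrite ME /T1 /H !mxF_mul; apply: eq_mxF => v w.
  transitivity (gam * \sum_j (A j v w.1)%:R).
    transitivity (\sum_(r : V * 'I_N) (v == r.1)%:R * (gam * \sum_j (lifted g j (r.1, r.2) w)%:R)).
      by apply: eq_bigr => r _; rewrite -surjective_pairing mulrA.
    rewrite (sum_pairD v (fun s t => gam * \sum_j (lifted g j (s, t) w)%:R)) -mulr_sumr; congr (_ * _).
    rewrite exchange_big; apply: eq_bigr => j _; rewrite /lifted /=.
    case: (A j v w.1) => /=; last by rewrite big1.
    have [l lK kl] := injF_bij (@label_inj _ _ gf j v).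
    rewrite (bigD1 (l (label g j w.1 w.2))) //= kl eqxx big1 ?addr0 // => b bl.
    by apply/eqP; rewrite pnatr_eq0 eqb0; apply: contraNN bl => /eqP ->; rewrite lK.
  rewrite [RHS](bigD1 w.1) //= eqxx mul1r [X in _ = _ + X]big1 ?addr0 => [|u uw].
    by rewrite mulrC.
  by rewrite (negbTE uw) mul0r mulr0.
have T1M' : T1 *m M *m frameV^T = 0 by rewrite T1M -mulmxA T12 mulmx0.
have MT : M^T = M.
  by rewrite /M !trmx_mul trmxK tr_relabel ?tr_atoms // mulmxA.
have T2M' : frameV *m M *m T1^T = 0.
  by rewrite -[LHS]trmxK (trmx_mul (frameV *m M)) (trmx_mul frameV M) trmxK MT mulmxA T1M' trmx0.
(* [T1] spans the functions constant on the fibres, [frameV] those of sum zero. *)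
pose T := col_mx T1 frameV.
have TT : T *m T^T = 1%:M.
  rewrite /T tr_col_mx mul_col_row T11 T22 T12.
  have -> : frameV *m T1^T = 0 by rewrite -[LHS]trmxK trmx_mul trmxK T12 trmx0.
  by rewrite -scalar_mx_block.
have TT' : T^T *m T = 1%:M by rewrite /T tr_col_mx mul_row_col T1'.
rewrite -(char_poly_orth M TT TT') /T tr_col_mx mul_col_mx mul_col_row T1M' T2M'.
rewrite char_poly_diag_block T1M -(mulmxA H) T11 mulmx1.
by rewrite /M /newpart (trmx_mul frameV) !mulmxA.
Qed.

End Lift.

(** * Words of the additive product *)

Section Words.
Local Open Scope nat_scope.
Variables (V : finType) (c : nat) (A : 'I_c -> rel V) (v1 : V).
Hypothesis Airr : forall j, irreflexive (A j).
Hypothesis Asym : forall j, symmetric (A j).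
Local Notation word := (seq ('I_c * V)).
Implicit Types (y s : word) (C : 'I_c) (u v w : V).

Definition wend y : V := last v1 (map snd y).
Definition wcol y : option 'I_c := last None (map (fun p => Some p.1) y).
Definition valid y : bool := addprod_word A None v1 y.

Lemma wend_rcons s C v : wend (rcons s (C, v)) = v.
Proof. by rewrite /wend map_rcons last_rcons. Qed.

Lemma wcol_rcons s C v : wcol (rcons s (C, v)) = Some C.
Proof. by rewrite /wcol map_rcons last_rcons. Qed.

Lemma valid_rcons s C v : valid (rcons s (C, v)) =
  valid s && [&& wcol s != Some C, wend s != v, wend s \in nonisolated (A C)
    & v \in nonisolated (A C)].
Proof.
rewrite /valid /wcol /wend; elim: s None v1 => [|[C' v'] s IH] o u /=.
  by rewrite !andbT.
by rewrite IH !andbA.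
Qed.

(** The vertex of the additive product at which the copy of the atom [C] containing [y] is attached. *)
Definition wbase C y : word := if wcol y == Some C then take (size y).-1 y else y.

Lemma wbase_rcons_eq C s v : wbase C (rcons s (C, v)) = s.
Proof. by rewrite /wbase wcol_rcons eqxx size_rcons /= -cats1 take_size_cat. Qed.

Lemma wbase_neq C y : wcol y != Some C -> wbase C y = y.
Proof. by rewrite /wbase => /negbTE ->. Qed.

(** The vertex over [v] in the copy of the atom [C] that contains [y]. *)
Definition jump C y v : word := let b := wbase C y in
  if v == wend b then b else rcons b (C, v).

Lemma wend_jump C y v : wend (jump C y v) = v.
Proof. by rewrite /jump; case: eqP => [->|_] //; rewrite wend_rcons. Qed.

Lemma wbase_spec C y : valid y -> valid (wbase C y) /\ wcol (wbase C y) != Some C.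
Proof.
case/lastP: y => [|s [C' u]] vy; first by [].
have [E|CC] := eqVneq C' C.
  move: vy; rewrite E wbase_rcons_eq valid_rcons => /andP[vs].
  by case/andP=> ->.
have h : wcol (rcons s (C', u)) != Some C by rewrite wcol_rcons; apply: contraNneq CC => -[->].
by rewrite wbase_neq.
Qed.

Lemma wbase_jump C y v : valid y -> wbase C (jump C y v) = wbase C y.
Proof.
move=> vy; have [_ h] := wbase_spec C vy; rewrite /jump; case: eqP => _.
  by rewrite wbase_neq.
by rewrite wbase_rcons_eq.
Qed.

Lemma jump_jump C y v w : valid y -> jump C (jump C y v) w = jump C y w.
Proof. by move=> vy; rewrite [LHS]/jump wbase_jump. Qed.

Lemma jump_id C y : valid y -> jump C y (wend y) = y.
Proof.
case/lastP: y => [|s [C' u]] vy; first by rewrite /jump eqxx.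
have [E|CC] := eqVneq C' C.
  move: vy; rewrite E /jump wbase_rcons_eq wend_rcons valid_rcons.
  by case/and3P => _ _ /andP[/negbTE su _]; rewrite eq_sym su.
have h : wcol (rcons s (C', u)) != Some C by rewrite wcol_rcons; apply: contraNneq CC => -[->].
by rewrite /jump wbase_neq // eqxx.
Qed.

Lemma wend_wbase_nonisolated C y : valid y -> wend y \in nonisolated (A C) ->
  wend (wbase C y) \in nonisolated (A C).
Proof.
case/lastP: y => [|s [C' u]] vy; first by [].
have [E|CC] := eqVneq C' C.
  by move: vy; rewrite E wbase_rcons_eq valid_rcons => /and5P[].
have h : wcol (rcons s (C', u)) != Some C by rewrite wcol_rcons; apply: contraNneq CC => -[->].
by rewrite wbase_neq.
Qed.

Lemma valid_jump C y v : valid y -> wend y \in nonisolated (A C) ->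
  v \in nonisolated (A C) -> valid (jump C y v).
Proof.
move=> vy yC vC; have [vb bC] := wbase_spec C vy; rewrite /jump.
case: eqVneq => // vb'; rewrite valid_rcons vb bC vC eq_sym vb' /=.
by rewrite wend_wbase_nonisolated.
Qed.

Lemma edge_nonisolated C u v : A C u v -> u \in nonisolated (A C).
Proof. by move=> uv; rewrite inE; apply/existsP; exists v. Qed.

Definition word_edge s s' := addprod_arc A v1 s s' \/ addprod_arc A v1 s' s.

Lemma arc_next b C w : A C (wend b) w -> addprod_arc A v1 b (rcons b (C, w)).
Proof.
case/lastP: b => [|s [C' u]]; first exact: addprod_root.
by rewrite wend_rcons => uw; apply: addprod_next.
Qed.

Lemma jump_edge C y u w : A C u w -> word_edge (jump C y u) (jump C y w).
Proof.
move=> uw; have uw' : u != w by apply: contraTneq uw => ->; rewrite Airr.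
rewrite /jump; set b := wbase C y; case: (eqVneq u (wend b)) => [E|ub].
  rewrite -E eq_sym (negbTE uw'); left; apply: arc_next; by rewrite -E.
case: (eqVneq w (wend b)) => [E|wb]; last by left; apply: addprod_same.
by right; apply: arc_next; rewrite -E Asym.
Qed.

(** Two copies of atoms have at most one vertex in common. In terms of words, a jump by an atom other
than that of the last letter makes the word longer, while a jump by the atom of the last letter does
not. *)
Lemma jump_inj y C C' u u' : valid y -> A C (wend y) u -> A C' (wend y) u' ->
  jump C y u = jump C' y u' -> (C, u) = (C', u').
Proof.
move=> vy yu yu' E; have uu : u = u' by rewrite -(wend_jump C y u) E wend_jump.
subst u'; have [->//|CC] := eqVneq C C'; exfalso.
have uy : u != wend y by apply: contraTneq yu => ->; rewrite Airr.
(* A jump by [D] lengthens the word unless the last letter has the atom [D]. *)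
have sz D : size (jump D y u) = (size y).+1 \/ (wcol y = Some D /\ (size (jump D y u) <= size y)%N).
  case: (eqVneq (wcol y) (Some D)) => h; last first.
    by left; rewrite /jump wbase_neq // (negbTE uy) size_rcons.
  right; split=> //; case/lastP: y h {vy yu yu' E uy} => [|s [D' w]] // .
  rewrite wcol_rcons => -[->]; rewrite /jump wbase_rcons_eq size_rcons.
  by case: ifP => _; rewrite ?size_rcons // leqnSn.
have rc D : wcol y != Some D -> jump D y u = rcons y (D, u).
  by move=> h; rewrite /jump wbase_neq // (negbTE uy).
have [h|h] := eqVneq (wcol y) (Some C).
  have h' : wcol y != Some C' by rewrite h; apply: contraNneq CC => -[->].
  case: (sz C) => [s1|[_ s1]]; last by move: s1; rewrite E rc // size_rcons ltnn.
  case/lastP: y h {vy yu yu' uy sz rc h'} s1 E => [|s [D' w]] //.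
  rewrite wcol_rcons => -[->]; rewrite /jump wbase_rcons_eq size_rcons.
  case: ifP => _; rewrite ?size_rcons => /eqP; rewrite ?eqSS.
    by rewrite -[X in X == _]addn0 -addn2 eqn_add2l.
  by rewrite -[X in X == _]addn0 -addn1 eqn_add2l.
have [h'|h'] := eqVneq (wcol y) (Some C').
  case: (sz C') => [s1|[_ s1]]; last by move: s1; rewrite -E rc // size_rcons ltnn.
  case/lastP: y h' {vy yu yu' uy sz rc h} s1 E => [|s [D' w]] //.
  rewrite wcol_rcons => -[->]; rewrite /jump wbase_rcons_eq size_rcons.
  case: ifP => _; rewrite ?size_rcons => /eqP; rewrite ?eqSS.
    by rewrite -[X in X == _]addn0 -addn2 eqn_add2l.
  by rewrite -[X in X == _]addn0 -addn1 eqn_add2l.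
move: E; rewrite !rc // => /eqP; rewrite eqseq_rcons => /andP[_ /eqP[CC']].
by rewrite CC' eqxx in CC.
Qed.

End Words.

(** * Walks and the Green function *)

Section Walks.
Local Open Scope nat_scope.
Variables (X : choiceType) (E : X -> X -> Prop).
Hypothesis finE : forall x, finite_set [set y | E x y]%classic.

Lemma nb_walks_step (zs : seq X) y v t : uniq zs -> {in zs, forall z, E y z} ->
  \sum_(z <- zs) nb_walks E z v t <= nb_walks E y v t.+1.
Proof.
move=> uz Ez; pose W z : seq (seq X) := fset_set (walks E z v t).
pose s := [seq z :: p | z <- zs, p <- W z].
have -> : \sum_(z <- zs) nb_walks E z v t = size s.
  by rewrite size_allpairs_dep sumnE big_map.
apply: uniq_leq_size.
  apply: allpairs_uniq_dep => //.
    by move=> z _; apply: fset_uniq.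
  by move=> [z p] [z' p'] _ _ /= [-> ->].
move=> q /allpairsPdep[z [p [zin pin ->]]].
move: pin; rewrite /W !in_fset_set ?classical_sets.inE; try exact: finite_walks.
move=> [sp Ep lp]; split=> //=; first by rewrite sp.
by rewrite Ep andbT; apply/asboolP/Ez.
Qed.

Lemma nb_walks0 y : 0 < nb_walks E y y 0.
Proof.
apply: (@uniq_leq_size _ [:: [::] : seq X]) => // p; rewrite inE => /eqP ->.
by rewrite in_fset_set ?classical_sets.inE; [split | exact: finite_walks].
Qed.

Definition reach y z := exists k, forall w t, nb_walks E z w t <= nb_walks E y w (t + k).

Lemma reach_refl y : reach y y.
Proof. by exists 0 => w t; rewrite addn0. Qed.

Lemma reach_trans y z w : reach y z -> reach z w -> reach y w.
Proof.
move=> [k h] [l h']; exists (l + k) => a t.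
by apply: leq_trans (h' a t) _; rewrite addnA.
Qed.

Lemma reach_edge y z : E y z -> reach y z.
Proof.
move=> yz; exists 1 => w t; rewrite addn1.
have := @nb_walks_step [:: z] y w t; rewrite big_seq1; apply=> //.
by move=> z'; rewrite inE => /eqP ->.
Qed.

Local Open Scope classical_set_scope.
Local Open Scope ring_scope.
Variables (R : realType).

(** A finite number of terms below the threshold of the limit superior is absorbed by the
constant [M]. *)
Lemma spectral_radius_lt (x0 y0 : X) (x' : R) :
  (spectral_radius R E x0 y0 < x'%:E)%E ->
  exists x2 M : R, [/\ 0 < x2, x2 < x' & forall t, (nb_walks E x0 y0 t)%:R <= M * x2 ^+ t].
Proof.
rewrite /spectral_radius /limn_esup limf_esupE => /ereal_inf_lt[_ [B [T _ TB] <-] supB].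
set u := fun t => _ in supB.
have uB t : (T <= t)%N -> (u t <= ereal_sup (u @` B))%E.
  by move=> Tt; apply: ereal_sup_ubound; exists t => //; apply: TB.
have [r rE] : exists r : R, ereal_sup (u @` B) = r%:E.
  have := uB T (leqnn T); move: supB; rewrite /u.
  by case: (ereal_sup _) => [r _ _|//|//]; exists r.
rewrite rE lte_fin in supB uB *.
have r0 : 0 <= r.
  by have := uB T (leqnn T); rewrite /u lee_fin; apply: le_trans; apply: powR_ge0.
(* Room is needed on both sides, as powers of [x2] must dominate and [x2 / x'] must be below [1]. *)
pose x2 := (r + x') / 2.
have x2p : 0 < x2 by rewrite /x2; lra.
have x2x : x2 < x' by rewrite /x2; lra.
have big t : (maxn T 1 <= t)%N -> (nb_walks E x0 y0 t)%:R <= x2 ^+ t.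
  rewrite geq_max => /andP[/uB]; rewrite /u lee_fin => ut t0.
  have tn0 : (t%:R : R) != 0 by rewrite pnatr_eq0 -lt0n.
  have -> : ((nb_walks E x0 y0 t)%:R : R) = (((nb_walks E x0 y0 t)%:R : R) `^ (t%:R)^-1) `^ t%:R.
    by rewrite -powRrM mulVf // powRr1 ?ler0n.
  rewrite -(powR_mulrn _ (ltW x2p)); apply: ge0_ler_powR; rewrite ?ler0n ?nnegrE ?powR_ge0 //.
    exact: ltW.
  by apply: le_trans ut _; rewrite /x2; lra.
pose S := \sum_(t < maxn T 1) (nb_walks E x0 y0 t)%:R / x2 ^+ t.
have S0 : 0 <= S by apply: sumr_ge0 => t _; rewrite divr_ge0 ?ler0n // exprn_ge0 // ltW.
exists x2, (1 + S); split=> // t.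
case: (leqP (maxn T 1) t) => h.
  apply: le_trans (big t h) _; by rewrite ler_peMl ?lerDl // exprn_ge0 // ltW.
rewrite -ler_pdivrMr ?exprn_gt0 //.
rewrite /S (bigD1 (Ordinal h)) //= addrCA lerDl addr_ge0 // sumr_ge0 // => i _.
by rewrite divr_ge0 ?ler0n // exprn_ge0 // ltW.
Qed.

Variables (x0 y0 : X) (x' x2 M : R).
Hypotheses (x2p : 0 < x2) (x2x : x2 < x').
Hypothesis Mb : forall t, (nb_walks E x0 y0 t)%:R <= M * x2 ^+ t.
Hypothesis conn : forall y z, reach y z.

Let x'p : 0 < x'. Proof. exact: lt_trans x2x. Qed.

Definition green_partial y n : R := \sum_(t < n) (nb_walks E y y0 t)%:R / x' ^+ t.
(** The generating function of the walks from [y] to [y0], at [1 / x']. *)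
Definition green y : R := limn (green_partial y).

Lemma green_partial_nd y : nondecreasing_seq (green_partial y).
Proof.
apply/nondecreasing_seqP => n; rewrite /green_partial big_ord_recr /= lerDl.
by rewrite divr_ge0 ?ler0n // exprn_ge0 // ltW.
Qed.

Lemma green_cvg y : cvgn (green_partial y).
Proof.
apply: nondecreasing_is_cvgn; first exact: green_partial_nd.
have [k hk] := conn x0 y; pose q := x2 / x'.
have q1 : q < 1 by rewrite /q ltr_pdivrMr // mul1r.
have q0 : 0 <= q by rewrite /q divr_ge0 // ltW.
have M0 : 0 <= M.
  have := Mb 0; rewrite expr0 mulr1; apply: le_trans; exact: ler0n.
exists (M * x2 ^+ k / (1 - q)) => _ [n _ <-].
have geo m : \sum_(t < m) q ^+ t <= (1 - q)^-1.
  rewrite -[leRHS]mul1r ler_pdivlMr ?subr_gt0 //.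
  have -> : (\sum_(t < m) q ^+ t) * (1 - q) = 1 - q ^+ m.
    elim: m => [|m IH]; first by rewrite big_ord0 mul0r expr0 subrr.
    by rewrite big_ord_recr /= mulrDl IH exprS; ring.
  by rewrite gerBl exprn_ge0.
apply: (@le_trans _ _ (M * x2 ^+ k * \sum_(t < n) q ^+ t)); last first.
  by apply: ler_wpM2l => //; rewrite mulr_ge0 // exprn_ge0 // ltW.
rewrite mulr_sumr; apply: ler_sum => t _.
rewrite /q expr_div_n mulrA ler_pM2r ?invr_gt0 ?exprn_gt0 // -mulrA -exprD addnC.
by apply: le_trans (Mb _); rewrite ler_nat.
Qed.

Lemma green_partial_le y n : green_partial y n <= green y.
Proof. exact: nondecreasing_cvgn_le (@green_partial_nd y) (@green_cvg y) n. Qed.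

Lemma green_ge0 y : 0 <= green y.
Proof. by apply: le_trans (green_partial_le y 0); rewrite /green_partial big_ord0. Qed.

Lemma green_gt0 y : 0 < green y.
Proof.
have [k hk] := conn y y0; apply: lt_le_trans (green_partial_le y k.+1).
rewrite /green_partial big_ord_recr /=; apply: ltr_wpDl.
  by apply: sumr_ge0 => t _; rewrite divr_ge0 ?ler0n // exprn_ge0 // ltW.
rewrite divr_gt0 ?exprn_gt0 // ltr0n.
by apply: leq_trans (nb_walks0 y0) _; apply: leq_trans (hk y0 0%N) _.
Qed.

(** A walk of length [t + 1] from [y] is a step to a neighbour [z] followed by a walk of length [t], so
the sum over the neighbours is [x' * green y] without the contribution of the walks of length [0]. *)
Lemma green_super (zs : seq X) y : uniq zs -> {in zs, forall z, E y z} ->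
  \sum_(z <- zs) green z <= x' * green y.
Proof.
move=> uz Ez.
have part n : \sum_(z <- zs) green_partial z n <= x' * green y.
  apply: (@le_trans _ _ (x' * green_partial y n.+1)); last first.
    by rewrite ler_pM2l // green_partial_le.
  rewrite /green_partial big_ord_recl /= mulrDr exchange_big /=.
  apply: ler_wpDl; first by rewrite mulr_ge0 ?divr_ge0 ?ler0n ?exprn_ge0 ?ltW.
  rewrite mulr_sumr; apply: ler_sum => t _.
  rewrite -mulr_suml -natr_sum /= exprS invfM mulrCA mulrA -mulrA.
  have -> : x' * (x'^-1 / x' ^+ t) = (x' ^+ t)^-1 by rewrite mulrA mulfV ?mul1r // gt_eqF.
  rewrite ler_pM2r ?invr_gt0 ?exprn_gt0 // ler_nat.
  exact: nb_walks_step.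
have cv : (fun n => \sum_(z <- zs) green_partial z n) @ \oo --> \sum_(z <- zs) green z.
  elim: zs {uz Ez part} => [|z zs IH].
    under eq_fun do rewrite big_nil; rewrite big_nil; exact: cvg_cst.
  under eq_fun do rewrite big_cons; rewrite big_cons; apply: cvgD IH.
  exact: green_cvg.
rewrite -(cvg_lim _ cv) //; apply: limr_le; first by apply/cvg_ex; exists (\sum_(z <- zs) green z).
by near=> n; apply: part.
Unshelve. all: by end_near.
Qed.

End Walks.

(** * The Green function of the additive product *)

Section Product.
Variables (V : finType) (c : nat) (A : 'I_c -> rel V) (v1 : V).
Hypothesis Asym : forall j, symmetric (A j).
Hypothesis Airr : forall j, irreflexive (A j).
Hypothesis Hconn : connected_multigraph (sum_graph A).
Hypothesis Aconn : forall j, connected_graph (core (A j)).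

Notation E := (@addprod_edge V c A v1).
Notation X := (addprod A v1).
Let finE (x : X) : finite_set [set y | E x y]%classic := finite_addprod_edge x.
Notation valid := (valid A v1).

Definition to_word s (vs : valid s) : X := exist (fun s => addprod_word A None v1 s) s vs.

Definition linked (s s' : seq ('I_c * V)) := exists (y z : X),
  [/\ val y = s, val z = s', reach E y z & reach E z y].

Lemma linked_trans s s' s'' : linked s s' -> linked s' s'' -> linked s s''.
Proof.
move=> [y [z [<- <- yz zy]]] [z' [w [E1 <- zw wz]]].
have zz : z' = z by apply: val_inj.
subst z'; exists y, w; split=> //; first exact: reach_trans zw.
exact: reach_trans zy.
Qed.

Lemma linked_edge s s' : valid s -> valid s' -> word_edge A v1 s s' -> linked s s'.
Proof.
move=> vs vs' e; pose y : X := exist _ s vs; pose z : X := to_word vs'.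
exists y, z; split=> //; apply: (reach_edge finE) => //.
by case: e => h; [right | left].
Qed.

(** This is where the connectedness of the atoms enters: a path in the core of the atom [C] is
followed in the copy of [C] through [s]. *)
Lemma linked_block C s v : valid s -> wend v1 s \in nonisolated (A C) -> v \in nonisolated (A C) ->
  linked (jump v1 C s (wend v1 s)) (jump v1 C s v).
Proof.
move=> vs sC vC.
pose a : {u : V | u \in nonisolated (A C)} := exist (fun u => u \in nonisolated (A C)) _ sC.
pose b : {u : V | u \in nonisolated (A C)} := exist (fun u => u \in nonisolated (A C)) _ vC.
have [_ /(_ a b) /connectP[p pp bE]] := Aconn C.
rewrite -[v]/(val b) -[wend v1 s]/(val a) bE.
move: a pp {b vC bE}; elim: p => [|b p IH] a /= .
  move=> _; have va : valid (jump v1 C s (val a)).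
    by apply: valid_jump => //; exact: (valP a).
  by exists (to_word va), (to_word va); split=> //; apply: reach_refl.
move=> /andP[ab pp]; apply: linked_trans (IH b pp).
apply: linked_edge; last exact: jump_edge.
  by apply: valid_jump => //; exact: (valP a).
by apply: valid_jump => //; exact: (valP b).
Qed.

Lemma linked_root s : valid s -> linked [::] s.
Proof.
elim/last_ind: s => [v0|s [C v] IH].
  by exists (to_word v0), (to_word v0); split=> //; apply: reach_refl.
rewrite valid_rcons => /and5P[vs sC sv uC vC]; apply: linked_trans (IH vs) _.
have := linked_block vs uC vC; rewrite (jump_id (A := A)) //.
by rewrite /jump wbase_neq // eq_sym (negbTE sv).
Qed.

Lemma reach_all (y z : X) : reach E y z.
Proof.
have [r [y' [r0 Ey _ yr]]] := linked_root (valP y).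
have [r' [z' [r0' Ez rz _]]] := linked_root (valP z).
have <- : y' = y by apply: val_inj.
have <- : z' = z by apply: val_inj.
have rr : r = r' by apply: val_inj; rewrite r0 r0'.
by apply: reach_trans yr _; rewrite rr.
Qed.

(** A path from [v1] to [v] in the sum graph lifts to the additive product. *)
Lemma word_ending v : exists y, valid y /\ wend v1 y = v.
Proof.
have [_ /(_ v1 v)/connectP[p pp ->]] := Hconn.
suff : forall y u, valid y -> wend v1 y = u -> path (fun u v => (0 < sum_graph A u v)%N) u p ->
   exists z, valid z /\ wend v1 z = last u p by move/(_ [::] v1); apply.
move=> y u; elim: p y u {pp} => [|w p IH] y u vy yu /=; first by exists y.
case/andP=> uw; have [i iuw] : exists i, A i u w.
  apply/existsP; apply: contraTT uw; rewrite negb_exists => /forallP h.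
  by rewrite /sum_graph big1 // => i _; rewrite (negbTE (h i)).
move=> pw; apply: (IH _ _ _ (wend_jump v1 i y w) pw); apply: valid_jump => //.
  by rewrite yu; apply: edge_nonisolated iuw.
by apply: (@edge_nonisolated _ _ _ _ _ u); rewrite Asym.
Qed.

Variables (R : realType) (d : nat) (s : 'S_#|copies V c d|).
Hypothesis sf : s \in fixing (@siteof V c d) #|copies V c d|.
Variables (x0 y0 : X) (x' x2 M x : R).
Hypotheses (x2p : 0 < x2) (x2x : x2 < x') (x'x : x' < x).
Hypothesis Mb : forall t, (nb_walks E x0 y0 t)%:R <= M * x2 ^+ t.

Let G := green E y0 x'.

(** Jumps are defined on all words, so the Green function is extended by zero. *)
Definition green_word (y : seq ('I_c * V)) : R := if insub y is Some z then G z else 0.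

Lemma green_word_val (z : X) : green_word (val z) = G z.
Proof. by rewrite /green_word valK. Qed.

(** Over every neighbour of [w.1] in the atom [i] there is exactly one neighbour of [w] in the lift, so
the left-hand side is a sum over the neighbours of the word [y]. *)
Lemma green_word_super y w : valid y -> wend v1 y = w.1 ->
  \sum_i \sum_(u | lifted A s i w u) green_word (jump v1 i y u.1) <= x' * green_word y.
Proof.
move=> vy yw.
have one i : \sum_(u | lifted A s i w u) green_word (jump v1 i y u.1) =
    \sum_(v | A i w.1 v) green_word (jump v1 i y v).
  transitivity (\sum_(v | A i w.1 v) \sum_(b | label s i v b == label s i w.1 w.2)
      green_word (jump v1 i y v)).
    by rewrite pair_big_dep.
  apply: eq_bigr => v _; have [l lK kl] := injF_bij (@label_inj _ _ _ _ sf i v).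
  rewrite (big_pred1 (l (label s i w.1 w.2))) // => b /=.
  by apply/eqP/eqP => [<-|->]; rewrite ?lK ?kl.
under eq_bigr do rewrite one.
rewrite pair_big_dep /=.
pose P := [pred p : 'I_c * V | A p.1 w.1 p.2].
pose vals := [seq jump v1 p.1 y p.2 | p <- enum P].
have vv : all valid vals.
  apply/allP => q /mapP[p]; rewrite mem_enum inE => wp ->.
  apply: valid_jump => //; first by rewrite yw; apply: edge_nonisolated wp.
  by apply: (@edge_nonisolated _ _ _ _ _ w.1); rewrite Asym.
pose zs : seq X := pmap insub vals.
have zsE : map val zs = vals.
  by rewrite /zs pmap_filter; [apply/all_filterP; apply: sub_all vv => q; rewrite isSome_insub | exact: insubK].
have -> : \sum_(p | A p.1 w.1 p.2) green_word (jump v1 p.1 y p.2) = \sum_(z <- zs) G z.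
  under [RHS]eq_bigr do rewrite -green_word_val.
  by rewrite -(big_map val xpredT green_word) zsE /vals big_map big_enum.
have -> : green_word y = G (to_word vy) by rewrite -green_word_val.
apply: (green_super finE x2p x2x Mb reach_all).
  rewrite -(map_inj_uniq val_inj) zsE map_inj_in_uniq ?enum_uniq // => p q.
  rewrite !mem_enum !inE => wp wq h; rewrite [p]surjective_pairing [q]surjective_pairing.
  by apply: (jump_inj (A := A) (v1 := v1) Airr vy _ _ h); rewrite yw.
move=> z zin; have : val z \in vals by rewrite -zsE map_f.
case/mapP => p; rewrite mem_enum inE -yw => wp zE.
by have := jump_edge v1 Airr Asym y wp; rewrite -zE (jump_id (A := A)).
Qed.

Lemma lift_alpha_gt0 : 0 < alpha (lifted A s) x [set: verts V d]%SET.
Proof.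
pose over (y : seq ('I_c * V)) (w : verts V d) := valid y /\ wend v1 y = w.1.
apply: (@alpha_gt0 R (verts V d) c (lifted A s) x _ (seq ('I_c * V)) over
   (fun j y w => jump v1 j y w.1) green_word x') => //.
- by move=> j w; rewrite /lifted Airr.
- move=> y w [vy _]; rewrite -[y]/(val (to_word vy)) green_word_val.
  exact: (green_gt0 finE x2p x2x Mb reach_all).
- move=> y; rewrite /green_word; case: insub => // z.
  exact: (green_ge0 x2p x2x Mb reach_all).
- move=> j y u w [vy yu] /andP[uw _]; split; last exact: wend_jump.
  apply: valid_jump => //; first by rewrite yu; apply: edge_nonisolated uw.
  by apply: (@edge_nonisolated _ _ _ _ _ u.1); rewrite Asym.
- by move=> j y u w z [vy _] _; rewrite (jump_jump (A := A)).
- by move=> j y u [vy <-]; rewrite (jump_id (A := A)).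
- by move=> y u [vy yu]; apply: green_word_super.
- by move=> u; apply: word_ending.
Qed.

End Product.

Theorem theorem8p1 (R : realType) (V : finType) (c : nat) (A : 'I_c -> rel V)
    (Asym : forall j : 'I_c, symmetric (A j))
    (Airr : forall j : 'I_c, irreflexive (A j))
    (Hconn : connected_multigraph (sum_graph A))
    (Aconn : forall j : 'I_c, connected_graph (core (A j)))
    (v1 : V) (N : nat) (hN : (1 <= N)%N) :
  exists Q : 'I_c -> V -> 'S_N,
    forall lambda : R,
      lambda \in (spec R (additive_lift A Q) `\` spec R (sum_graph A))%mset ->
      forall x y : addprod A v1,
        (lambda%:E <= spectral_radius R (@addprod_edge V c A v1) x y)%E.
Proof.
case: N hN => // d _.
pose G := fixing (@siteof V c d.+1) #|copies V c d.+1|.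
pose new g : {poly R} :=
  char_poly (newpart R V c d *m relabel g (atoms_mx R A d.+1) *m (newpart R V c d)^T).
(* The permutation at a site is the restriction of [g] to its copies. *)
pose Q g : 'I_c -> V -> 'S_d.+1 := fun j v =>
  if pselect (g \in G) is left gf then perm (@label_inj _ _ _ _ gf j v) else 1%g.
have diff_root g lambda : g \in G ->
    lambda \in (spec R (additive_lift A (Q g)) `\` spec R (sum_graph A))%mset -> root (new g) lambda.
  move=> gf; rewrite in_msetB !specE.
  have -> : adj_mx R (additive_lift A (Q g)) =
    glue R V c d.+1 *m relabel g (atoms_mx R A d.+1) *m (glue R V c d.+1)^T.
    rewrite glue_relabel //; apply/matrixP => i j; rewrite !mxE /additive_lift /sum_graph natr_sum.
    apply: eq_bigr => k _; rewrite /lift_atom /lifted /Q; case: pselect => // gf'.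
    by rewrite !permE.
  rewrite char_poly_lift //.
  have -> : adj_mx R (sum_graph A) = mxF (fun v u : V => \sum_j (A j v u)%:R).
    by apply/matrixP => i j; rewrite !mxE /sum_graph natr_sum.
  rewrite mupM ?monic_neq0 ?char_poly_monic // -[X in (X < _)%N]addn0 ltn_add2l.
  by apply: contraTT => /mupNroot ->.
apply: contrapT => /forallNP nQ.
(* If no lift works, each of them has a new eigenvalue above the spectral radius. *)
have H g : exists lambda : R, g \in G -> root (new g) lambda /\
    exists x y : addprod A v1, (spectral_radius R (@addprod_edge V c A v1) x y < lambda%:E)%E.
  have [gf|gf] := boolP (g \in G); last by exists 0.
  have /existsNP[lambda /not_implyP[lin /existsNP[x /existsNP[y h]]]] := nQ (Q g).
  exists lambda => _; split; first exact: diff_root.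
  by exists x, y; rewrite ltNge; apply/negP.
have [lam lamP] := choice H.
have G1 : (1%g : 'S_#|copies V c d.+1|) \in G by apply: fixing1.
case: (@Order.TotalTheory.arg_minP _ _ _ (1%g : 'S_#|copies V c d.+1|) (fun g => g \in G) lam G1)
  => g gG gmin.
have [_ [x0 [y0 rho]]] := lamP g gG.
have [x2 [M [x2p x2x Mb]]] := spectral_radius_lt rho.
have [||g' g'G g'pos] := @exists_good_lift R V c A Asym d (lam g).
- exact: lt_trans x2x.
- move=> x s gx sf.
  have h1 : x2 < (x2 + lam g) / 2 by lra.
  have h2 : (x2 + lam g) / 2 < x by lra.
  exact: (lift_alpha_gt0 Asym Airr Hconn Aconn sf x2p h1 h2 Mb).
have [rt _] := lamP g' g'G.
by have := g'pos _ (gmin g' g'G); rewrite (rootP rt) ltxx.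
Qed.
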